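(* Let $S_\omega(t)=e^{t\mathbb{A}_\omega}$ be the $C_0$-semigroup of contractions on $\mathcal{H}_\omega$ generated by $\mathbb{A}_\omega$. The following resolvent estimates hold, and the semigroups have the following Gevrey regularity for $t>0$: (i) if $\omega=0$ and $\frac12<\sigma<1$, then $\limsup_{|\lambda|\to\infty}|\lambda|^{2\sigma-1}\|(i\lambda I-\mathbb{A}_0)^{-1}\|_{\mathcal{L}(\mathcal{H}_0)}<\infty$, and $S_0(t)$ is of Gevrey class $s$ for every $s>\frac{1}{2\sigma-1}$; (ii) if $\omega=0$ and $1<\sigma<\frac32$, then $\limsup_{|\lambda|\to\infty}|\lambda|^{1/\sigma}\|(i\lambda I-\mathbb{A}_0)^{-1}\|_{\mathcal{L}(\mathcal{H}_0)}<\infty$, and $S_0(t)$ is of Gevrey class $s$ for every $s>\sigma$; (iii) if $\omega>0$ and $1<\sigma<\frac54$, then $\limsup_{|\lambda|\to\infty}|\lambda|^{4(\sigma-1)}\|(i\lambda I-\mathbb{A}_\omega)^{-1}\|_{\mathcal{L}(\mathcal{H}_\omega)}<\infty$, and $S_\omega(t)$ is of Gevrey class $s$ for every $s>\frac{1}{4(\sigma-1)}$. Here $\lambda$ ranges over $\mathbb{R}$.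
   Context: Let $\mathbf{H}$ be a complex Hilbert space with inner product $\langle\cdot,\cdot\rangle$ and norm $\|\cdot\|$, and let $A:\mathfrak{D}(A)\subseteq\mathbf{H}\to\mathbf{H}$ be an unbounded, self-adjoint, positive definite (strictly positive) operator with compact resolvent. For $r\in\mathbb{R}$ let $\mathbf{H}^r=\mathfrak{D}(A^{r/2})$ with $\langle u,v\rangle_r=\langle A^{r/2}u,A^{r/2}v\rangle$ and $\|u\|_r=\|A^{r/2}u\|$, except that for $\omega>0$ the space $\mathbf{H}^1$ also carries the equivalent norm $\|z\|_{\mathbf{H}^1}=(\|z\|^2+\omega\|z\|_1^2)^{1/2}$; for $r>0$, $\mathbf{H}^{-r}$ is the completion of $\mathbf{H}$ in $\|\cdot\|_{-r}$ (the dual of $\mathbf{H}^r$), and $A^s$ is extended to act $\mathbf{H}^r\to\mathbf{H}^{r-2s}$. For $\omega>0$ the operator $I+\omega A:\mathbf{H}^1\to\mathbf{H}^{-1}$ is defined by $\langle(I+\omega A)z_1,z_2\rangle_{\mathbf{H}^{-1}\times\mathbf{H}^1}=\langle z_1,z_2\rangle+\omega\langle A^{1/2}z_1,A^{1/2}z_2\rangle$ and is invertible. The system considered is, for $\sigma\in[0,\frac32]$ and $\omega\ge0$, $$u_{tt}+\omega Au_{tt}+A^2u-A^\sigma\theta=0,\qquad \theta_t+A\theta+A^\sigma u_t=0.$$ Phase spaces: $\mathcal{H}_0=\mathbf{H}^2\times\mathbf{H}\times\mathbf{H}$ with $\|(u,v,\theta)\|_{\mathcal{H}_0}^2=\|u\|_2^2+\|v\|^2+\|\theta\|^2$,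 and, for $\omega>0$, $\mathcal{H}_\omega=\mathbf{H}^2\times\mathbf{H}^1\times\mathbf{H}$ with $\|(u,v,\theta)\|_{\mathcal{H}_\omega}^2=\|u\|_2^2+\|v\|_{\mathbf{H}^1}^2+\|\theta\|^2$. The operator $\mathbb{A}_\omega$ on $\mathcal{H}_\omega$ is $$\mathbb{A}_\omega(u,v,\theta)=\big(v,\;(I+\omega A)^{-1}(-A^2u+A^\sigma\theta),\;-A\theta-A^\sigma v\big),$$ where $-A^2u+A^\sigma\theta=A^2(-u+A^{\sigma-2}\theta)$ and $-A\theta-A^\sigma v=A(-\theta-A^{\sigma-1}v)$, with domain the set of $(u,v,\theta)\in\mathcal{H}_\omega$ such that $v\in\mathbf{H}^2$, $-\theta-A^{\sigma-1}v\in\mathbf{H}^2$, and $-u+A^{\sigma-2}\theta\in\mathbf{H}^4$ if $\omega=0$, respectively $-u+A^{\sigma-2}\theta\in\mathbf{H}^3$ if $\omega>0$. For $0\le\sigma\le\frac32$ it is known that $\mathbb{A}_\omega$ generates a $C_0$-semigroup of contractions $S_\omega(t)=e^{t\mathbb{A}_\omega}$ on $\mathcal{H}_\omega$. Gevrey class: a strongly continuous semigroup $S(t)$ on a Banach space $\mathcal{H}$ is of Gevrey class $s>1$ for $t>t_0$ ($t_0\ge0$) if $S(t)$ is infinitely differentiable for $t>t_0$ and for every compact $K\subset(t_0,\infty)$ and every $\mu>0$ there is a constant $C=C(\mu,K)>0$ such that $\|S^{(n)}(t)\|_{\mathcal{L}(\mathcal{H})}\le C\mu^n(n!)^s$ for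 all $t\in K$, $n=0,1,2,\dots$. ''Of Gevrey class $s$'' means with $t_0=0$. *)

(* Defs.v *)
From HB Require Import structures.
From mathcomp Require Import all_boot all_order all_algebra.
From mathcomp Require Import sesquilinear.
From mathcomp Require Import complex.
From mathcomp Require Import all_classical all_reals all_analysis.

Set Implicit Arguments.
Unset Strict Implicit.
Unset Printing Implicit Defensive.

Import Order.TTheory GRing.Theory Num.Theory.
Import numFieldNormedType.Exports.

Local Open Scope classical_set_scope.
Local Open Scope ring_scope.
Local Open Scope complex_scope.

(* The phase spaces are subsets of H * H * H carrying a norm of their own, so
   the notions of operator and semigroup theory are stated for a linear
   subspace X of a complex vector space V together with a real-valued norm N
   on X. An operator is a total function with an explicit domain; its values
   outside the domain are irrelevant. *)
Section OperatorTheory.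
Variables (R : realType) (V : lmodType R[i]) (X : set V) (N : V -> R).

Definition linear_on (D : set V) (T : V -> V) : Prop :=
  D 0 /\ forall (a : R[i]) (u v : V), D u -> D v ->
    D (a *: u + v) /\ T (a *: u + v) = a *: T u + T v.

Definition opnorm (T : V -> V) : \bar R :=
  ereal_sup [set (N (T u))%:E | u in [set u | X u /\ N u <= 1]].

Definition bounded_operator (T : V -> V) : Prop :=
  [/\ set_fun X X T, linear_on X T & (opnorm T < +oo)%E].

Definition resolvent (D : set V) (T : V -> V) (z : R[i]) : V -> V :=
  'pinv_(fun=> 0) D (fun u => z *: u - T u).

Definition resolvent_set (D : set V) (T : V -> V) : set R[i] :=
  [set z | set_bij D X (fun u => z *: u - T u) /\
           (opnorm (resolvent D T z) < +oo)%E].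

(* The value is +oo outside the resolvent set: a finite upper limit of this
   quantity forces z to be eventually in the resolvent set. *)
Definition resolvent_norm (D : set V) (T : V -> V) (z : R[i]) : \bar R :=
  if `[< resolvent_set D T z >] then opnorm (resolvent D T z) else +oo%E.

Definition at_infinity : set (set R) :=
  [set P | exists M : R, forall l : R, M < `|l| -> P l].

Definition resolvent_limsup (D : set V) (T : V -> V) (a : R) : \bar R :=
  limf_esup
    (fun l : R => ((`|l| `^ a)%:E * resolvent_norm D T (Complex 0%R l))%E)
    at_infinity.

Definition C0_semigroup (S : R -> V -> V) : Prop :=
  [/\ forall t, 0 <= t -> bounded_operator (S t),
      forall u, X u -> S 0 u = u,
      forall s t u, 0 <= s -> 0 <= t -> X u -> S (s + t) u = S s (S t u) &
      forall u, X u -> N (S t u - u) @[t --> 0^'+] --> (0 : R)].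

Definition contractive (S : R -> V -> V) : Prop :=
  forall t u, 0 <= t -> X u -> N (S t u) <= N u.

Definition is_generator (D : set V) (T : V -> V) (S : R -> V -> V) : Prop :=
  [/\ D `<=` X, set_fun D X T &
      forall u w, X u -> X w ->
        (D u /\ T u = w) <->
        (N ((h^-1)%:C *: (S h u - u) - w) @[h --> 0^'+] --> (0 : R))].

(* S' is the derivative at t of S, in the norm of L(X). *)
Definition is_op_derive (S : R -> V -> V) (t : R) (S' : V -> V) : Prop :=
  opnorm (fun u => (h^-1)%:C *: (S (t + h) u - S t u) - S' u)
    @[h --> 0^'] --> (0 : \bar R)%E.

(* Gevrey class s for t > t0; dS n t is the n-th derivative of S at t. *)
Definition gevrey_class (s t0 : R) (S : R -> V -> V) : Prop :=
  exists dS : nat -> R -> V -> V,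
    [/\ forall t u, t0 < t -> X u -> dS 0%N t u = S t u,
        forall n t, t0 < t ->
          bounded_operator (dS n t) /\ is_op_derive (dS n) t (dS n.+1 t) &
        forall K : set R, compact K -> K `<=` [set t | t0 < t] ->
        forall mu : R, 0 < mu ->
        exists2 C : R, 0 < C & forall t n, K t ->
          (opnorm (dS n t) <= (C * mu ^+ n * (n`!%:R `^ s))%:E)%E].

End OperatorTheory.

Section HilbertSpace.
Variables (R : realType) (H : completeNormedModType R[i]).
Variable dot : {dot H for (@Num.conj R[i])}.

(* The norm of H takes its values in R[i]. *)
Definition hnorm (u : H) : R := complex.Re `|u|.

Variables (domA : set H) (A : H -> H).

(* (x, y) belongs to the graph of A iff it belongs to that of its adjoint. *)
Definition self_adjoint : Prop :=
  dense domA /\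
  forall x y, (domA x /\ A x = y) <->
              (forall u, domA u -> dot (A u) x = dot u y).

Definition positive_definite : Prop :=
  forall u, domA u -> u != 0 -> 0 < dot (A u) u.

Definition compact_resolvent : Prop :=
  exists2 z, resolvent_set setT hnorm domA A z &
    precompact (resolvent domA A z @` [set u | hnorm u <= 1]).

Definition unbounded : Prop :=
  ~ exists M : R, forall u, domA u -> hnorm (A u) <= M * hnorm u.

Definition eigenbasis (e : nat -> H) (mu : nat -> R) : Prop :=
  [/\ forall n m, dot (e n) (e m) = (n == m)%:R,
      forall n, domA (e n) /\ A (e n) = (mu n)%:C *: e n &
      forall u, series (fun n => dot u (e n) *: e n) @ \oo --> u].

(* A^s u = \sum_n mu_n^s <u, e_n> e_n; as A has compact resolvent, an
   eigenbasis exists, and the sum does not depend on its choice. *)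
Definition fpow_graph (s : R) (u w : H) : Prop :=
  exists e mu, eigenbasis e mu /\
    series (fun n => ((mu n `^ s)%:C * dot u (e n)) *: e n) @ \oo --> w.

Definition fpow_dom (s : R) : set H := [set u | exists w, fpow_graph s u w].

Definition fpow (s : R) (u : H) : H := xget 0 [set w | fpow_graph s u w].

(* The spaces H^r, used for r > 0 only. *)
Definition hs (r : R) : set H := fpow_dom (r / 2).

Definition hs_norm (r : R) (u : H) : R := hnorm (fpow (r / 2) u).

(* Elements of H^{-q}, q > 0, are represented by the antilinear functionals
   z |-> <f, z>_{H^{-q} x H^q} on H^q. For w in H^r and r - 2 s = - q < 0, the
   extended operator A^s sends w to the following functional, which is
   continuous in w for the norm of H^r and equals z |-> <A^s w, z> when w lies
   in the domain of A^s. *)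
Definition fpow_dual (r s : R) (w z : H) : R[i] :=
  dot (fpow (r / 2) w) (fpow (s - r / 2) z).

Variable omega : R.

(* (I + omega A) z1 as a functional on H^1, and its inverse H^{-1} -> H^1. *)
Definition IomegaA (z1 z2 : H) : R[i] :=
  dot z1 z2 + omega%:C * dot (fpow (1 / 2) z1) (fpow (1 / 2) z2).

Definition IomegaA_inv (f : H -> R[i]) : H :=
  xget 0 [set z | hs 1 z /\ forall z2, hs 1 z2 -> IomegaA z z2 = f z2].

Definition phase : set (H * H * H) :=
  [set U | hs 2 U.1.1 /\ (if omega == 0 then setT else hs 1) U.1.2].

(* For omega = 0 the third summand vanishes. *)
Definition phase_norm (U : H * H * H) : R :=
  Num.sqrt (hs_norm 2 U.1.1 ^+ 2
            + (hnorm U.1.2 ^+ 2 + omega * hs_norm 1 U.1.2 ^+ 2)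
            + hnorm U.2 ^+ 2).

Variable sigma : R.

Definition sys_dom : set (H * H * H) :=
  [set U | let: (u, v, theta) := U in
    [/\ phase U, hs 2 v, hs 2 (- theta - fpow (sigma - 1) v) &
        hs (if omega == 0 then 4 else 3) (- u + fpow (sigma - 2) theta)]].

Definition sys_op (U : H * H * H) : H * H * H :=
  let: (u, v, theta) := U in
  let w := - u + fpow (sigma - 2) theta in
  (v,
   if omega == 0 then fpow 2 w else IomegaA_inv (fpow_dual 3 2 w),
   A (- theta - fpow (sigma - 1) v)).

Definition sys_resolvent_limsup (a : R) : \bar R :=
  @resolvent_limsup R (H * H * H)%type phase phase_norm sys_dom sys_op a.

Definition sys_semigroup (S : R -> H * H * H -> H * H * H) : Prop :=
  [/\ @C0_semigroup R (H * H * H)%type phase phase_norm S,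
      @contractive R (H * H * H)%type phase phase_norm S &
      @is_generator R (H * H * H)%type phase phase_norm sys_dom sys_op S].

Definition sys_gevrey (s : R) (S : R -> H * H * H -> H * H * H) : Prop :=
  @gevrey_class R (H * H * H)%type phase phase_norm s 0 S.

End HilbertSpace.

(* Main.v *)
(* Expanding in an eigenbasis of A, the coordinates
   (m u, sqrt (1 + omega m) v, theta) belonging to an eigenvalue m turn the
   phase norm into the Euclidean norm of C^3 and the generator into
     M = [[0, p, 0], [-p, 0, q], [0, -q, -r]],
     p = m / sqrt (1 + omega m), q = m^sigma / sqrt (1 + omega m), r = m,
   so everything reduces to estimates on M that are uniform in m.
   If q <= r (cases (i) and (iii)) the heat component is slaved to the velocity
   and the mode decays at the rate k = q^2 / r; if p = r and q = p g with g
   large (case (ii)) the slow variable g u + theta decays at the rate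
   k = p / (g^2 + 1), and the two other directions at a rate of order p.
   For the resolvent, x = (i l - M)^-1 F satisfies r |x_3|^2 <= |F| |x|, which
   propagates to the other coordinates; this gives |x| <= C |F| / |l|^a, with
   a = 2 sigma - 1, 1 / sigma and 4 (sigma - 1) in the three cases.
   For the regularity, Lyapunov functions give |M exp (t M)| <= C t^-b on
   (0, 1] with b = 1 / a, i.e. |T S(t)| <= C t^-b for the generator T; then
   T^n S(t) = (T S(t / n))^n yields |T^n S(t)| <= (C (n / t)^b)^n, which is of
   Gevrey order s for every s > b. *)
Require Import Defs.
From HB Require Import structures.
From mathcomp Require Import all_boot all_order all_algebra.
From mathcomp Require Import sesquilinear.
From mathcomp Require Import complex.
From mathcomp Require Import all_classical all_reals all_analysis.
From mathcomp Require Import ring lra.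
Import Order.TTheory GRing.Theory Num.Theory.
Import numFieldNormedType.Exports.
Local Open Scope classical_set_scope.
Local Open Scope ring_scope.

Set Implicit Arguments.
Unset Strict Implicit.
Unset Printing Implicit Defensive.

(** The semigroup [S] is known only through its generator, so the regularity proof uses neither a
    matrix exponential nor the resolvent estimate: the modes are followed in time, as real solutions
    of a linear ODE along orbits that start in the domain of the squared generator, and general data
    are reached by cutting off high modes. The obstacle is that $|M x|$ is poorly controlled by
    $|x|$. In case (iii), $r$ is of order $p^2$ while the energy decays only at the rate $k$, a
    power of $p$; estimating $|M x|$ by $r |x|$ would double the exponent $b$. Splitting off the
    fast variable $q x_2 + r x_3$ leaves only the factor $p$ on the slowly decaying part. In case
    (ii) the entry $q = p g$ is larger than both decay rates, and the slow direction has to be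
    located so accurately that $M$ acts on it like the small eigenvalue $k$. Small eigenvalues $m$
    obey crude bounds, so the inequalities between $p$, $q$ and $r$ are needed for large $m$ only.
    No eigenbasis is assumed: it is built from the compact operator $(A + I)^{-1}$. *)

Section Modulus.
Variable R : realType.
Local Open Scope complex_scope.
Implicit Types z w : R[i].

Definition cmod z : R := complex.Re `|z|.

Lemma norm_cmod z : `|z| = (cmod z)%:C.
Proof. by rewrite /cmod RRe_real // ger0_real. Qed.

Lemma cmodE z : cmod z = Num.sqrt (complex.Re z ^+ 2 + complex.Im z ^+ 2).
Proof. by rewrite /cmod normc_def. Qed.

Lemma cmod_ge0 z : 0 <= cmod z. Proof. by rewrite cmodE sqrtr_ge0. Qed.

Lemma cmod_sq z : cmod z ^+ 2 = complex.Re z ^+ 2 + complex.Im z ^+ 2.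
Proof. by rewrite cmodE sqr_sqrtr // addr_ge0 // sqr_ge0. Qed.

Lemma cmodM z w : cmod (z * w) = cmod z * cmod w.
Proof. by apply: (@complexI R); rewrite rmorphM /= -!norm_cmod normrM. Qed.

Lemma cmodD z w : cmod (z + w) <= cmod z + cmod w.
Proof. by rewrite -lecR rmorphD /= -!norm_cmod ler_normD. Qed.

Lemma cmodN z : cmod (- z) = cmod z. Proof. by rewrite /cmod normrN. Qed.

Lemma cmodB z w : cmod (z - w) <= cmod z + cmod w.
Proof. by rewrite -(cmodN w) cmodD. Qed.

Lemma cmod0 : cmod 0 = 0. Proof. by rewrite /cmod normr0. Qed.

Lemma cmod_eq0 z : cmod z = 0 -> z = 0.
Proof. by move=> z0; apply/eqP; rewrite -normr_eq0 norm_cmod z0. Qed.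

Lemma cmodR (x : R) : cmod x%:C = `|x|.
Proof. by rewrite cmodE /= expr0n addr0 sqrtr_sqr. Qed.

Lemma cmod_iR (x : R) : cmod (Complex 0 x) = `|x|.
Proof. by rewrite cmodE /= expr0n add0r sqrtr_sqr. Qed.

Lemma cmod1 : cmod 1 = 1. Proof. by rewrite -[1]/(1%:C) cmodR normr1. Qed.

Lemma cmodJ z : cmod z^* = cmod z.
Proof. by rewrite !cmodE; case: z => a b /=; rewrite sqrrN. Qed.

Lemma Re_le_cmod z : complex.Re z <= cmod z.
Proof.
rewrite cmodE (le_trans (ler_norm _)) // -sqrtr_sqr ler_wsqrtr //.
by rewrite lerDl sqr_ge0.
Qed.

Lemma conjCR (x : R) : Num.conj (x%:C : R[i]) = x%:C.
Proof. exact: conjc_real. Qed.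

Lemma mulc_conj z : z * Num.conj z = (cmod z ^+ 2)%:C.
Proof. by rewrite -normCK norm_cmod rmorphXn. Qed.

Lemma ReD z w : complex.Re (z + w) = complex.Re z + complex.Re w.
Proof. by case: z; case: w. Qed.
Lemma ImD z w : complex.Im (z + w) = complex.Im z + complex.Im w.
Proof. by case: z; case: w. Qed.
Lemma ReN z : complex.Re (- z) = - complex.Re z. Proof. by case: z. Qed.
Lemma ImN z : complex.Im (- z) = - complex.Im z. Proof. by case: z. Qed.
Lemma ReZ (x : R) z : complex.Re (x%:C * z) = x * complex.Re z.
Proof. by case: z => a b /=; rewrite mul0r subr0. Qed.
Lemma ImZ (x : R) z : complex.Im (x%:C * z) = x * complex.Im z.
Proof. by case: z => a b /=; rewrite mul0r addr0. Qed.

End Modulus.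

(** * Geometry of a complex Hilbert space *)

Section Hilbert.
Variables (R : realType) (H : completeNormedModType R[i]).
Variable dot : {dot H for (@Num.conj R[i])}.
Hypothesis norm_dot : forall u : H, `|u| ^+ 2 = dot u u.
Local Open Scope complex_scope.
Implicit Types u v w : H.
Notation hn := (@hnorm R H).

Lemma norm_hnorm u : `|u| = (hn u)%:C.
Proof. by rewrite /hnorm RRe_real // ger0_real. Qed.

Lemma hnorm_ge0 u : 0 <= hn u.
Proof. by rewrite -lecR -norm_hnorm normr_ge0. Qed.

Lemma hnorm0 : hn 0 = 0. Proof. by rewrite /hnorm normr0. Qed.

Lemma hnorm_eq0 u : hn u = 0 -> u = 0.
Proof. by move=> u0; apply/eqP; rewrite -normr_eq0 norm_hnorm u0. Qed.

Lemma hnormZ (a : R[i]) u : hn (a *: u) = cmod a * hn u.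
Proof.
apply: (@complexI R).
by rewrite rmorphM /= -norm_hnorm -norm_hnorm -norm_cmod normrZ.
Qed.

Lemma hnormD u v : hn (u + v) <= hn u + hn v.
Proof. by rewrite -lecR rmorphD /= -!norm_hnorm ler_normD. Qed.

Lemma hnormN u : hn (- u) = hn u. Proof. by rewrite /hnorm normrN. Qed.

Lemma hnormB u v : hn (u - v) <= hn u + hn v.
Proof. by rewrite -(hnormN v) hnormD. Qed.

Lemma hnorm_distC u v : hn (u - v) = hn (v - u).
Proof. by rewrite -hnormN opprB. Qed.

Lemma dotDl u v w : dot (u + v) w = dot u w + dot v w.
Proof. by rewrite linearDl. Qed.
Lemma dotDr u v w : dot u (v + w) = dot u v + dot u w.
Proof. by rewrite linearDr. Qed.
Lemma dotZl a u v : dot (a *: u) v = a * dot u v.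
Proof. by rewrite linearZl_LR. Qed.
Lemma dotZr a u v : dot u (a *: v) = a^* * dot u v.
Proof. by rewrite linearZr_LR. Qed.
Lemma dotNl u v : dot (- u) v = - dot u v.
Proof. by rewrite linearNl. Qed.
Lemma dotNr u v : dot u (- v) = - dot u v.
Proof. by rewrite linearNr. Qed.
Lemma dotBl u v w : dot (u - v) w = dot u w - dot v w.
Proof. by rewrite linearBl. Qed.
Lemma dotBr u v w : dot u (v - w) = dot u v - dot u w.
Proof. by rewrite linearBr. Qed.
Lemma dot0l u : dot 0 u = 0. Proof. by rewrite linear0l. Qed.
Lemma dot0r u : dot u 0 = 0. Proof. by rewrite linear0r. Qed.
Lemma dotC u v : dot u v = (dot v u)^*.
Proof. by rewrite hermC /= expr0 mul1r. Qed.

Lemma dot_self u : dot u u = (hn u ^+ 2)%:C.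
Proof. by rewrite -norm_dot norm_hnorm rmorphXn. Qed.

Lemma hnormD_sq u v :
  hn (u + v) ^+ 2 = hn u ^+ 2 + hn v ^+ 2 + 2 * complex.Re (dot u v).
Proof.
apply: (@complexI R); rewrite -dot_self dotDl !dotDr !dot_self (dotC v u).
rewrite !rmorphD /= rmorphM/=.
have -> : dot u v = complex.Re (dot u v) +i* complex.Im (dot u v).
  by case: (dot u v).
by simpc; apply/eqP; rewrite eq_complex /=; apply/andP; split; apply/eqP; ring.
Qed.

(** Pythagoras for the projection onto the line of [v]. It yields Cauchy-Schwarz, and later the
    orthogonality of the residual at a nearest point. *)
Lemma hnorm_sub_proj u v : hn v != 0 ->
  hn (u - (dot u v / (hn v ^+ 2)%:C) *: v) ^+ 2 =
  hn u ^+ 2 - cmod (dot u v) ^+ 2 / hn v ^+ 2.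
Proof.
move=> v0; set a : R[i] := _ / _; rewrite hnormD_sq hnormN hnormZ dotNr dotZr.
have -> : complex.Re (- (a^* * dot u v)) = - (cmod (dot u v) ^+ 2 / hn v ^+ 2).
  rewrite /a -fmorphV cmod_sq; case: (dot u v) => x y /=.
  by rewrite !mulr0 subr0 add0r; ring.
have -> : cmod a = cmod (dot u v) / hn v ^+ 2.
  by rewrite /a -fmorphV /= cmodM cmodR ger0_norm // invr_ge0 sqr_ge0.
by field.
Qed.

Lemma cauchy_schwarz u v : cmod (dot u v) <= hn u * hn v.
Proof.
have [v0|v0] := eqVneq (hn v) 0.
  by rewrite (hnorm_eq0 v0) dot0r cmod0 hnorm0 mulr0.
have vp : 0 < hn v by rewrite lt0r v0 hnorm_ge0.
have := sqr_ge0 (hn (u - (dot u v / (hn v ^+ 2)%:C) *: v)).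
rewrite hnorm_sub_proj // subr_ge0 ler_pdivrMr ?exprn_gt0 // -exprMn.
by rewrite ler_pXn2r // nnegrE ?mulr_ge0 ?hnorm_ge0 ?cmod_ge0.
Qed.

Lemma parallelogram u v :
  hn (u + v) ^+ 2 + hn (u - v) ^+ 2 = 2 * hn u ^+ 2 + 2 * hn v ^+ 2.
Proof. by rewrite !hnormD_sq hnormN dotNr ReN; ring. Qed.

Lemma cvg_hnorm (f : nat -> H) (l : H) :
  (f @ \oo --> l) <->
  (forall e : R, 0 < e -> exists N, forall n, (N <= n)%N -> hn (f n - l) < e).
Proof.
split=> [fl e e0|fl].
  have /fl : nbhs l (ball l (e%:C : R[i])) by apply: nbhsx_ballx; rewrite ltcR.
  case=> N _ HN; exists N => n /HN /=.
  by rewrite -ball_normE /= norm_hnorm ltcR hnorm_distC.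
apply/cvgrPdist_lt => e e0.
have er : e = (complex.Re e)%:C by rewrite RRe_real // gtr0_real.
move: e0; rewrite er ltcR => /fl[N HN].
by exists N => // n /= /HN; rewrite norm_hnorm ltcR hnorm_distC.
Qed.

Lemma hcomplete (f : nat -> H) :
  (forall e : R, 0 < e -> exists N, forall m n, (N <= m)%N -> (N <= n)%N ->
     hn (f m - f n) < e) ->
  exists l : H, f @ \oo --> l.
Proof.
move=> fc; have : cauchy (f @ \oo).
  apply/cauchy_ballP => e e0.
  have er : e = (complex.Re e)%:C by rewrite RRe_real // gtr0_real.
  move: e0; rewrite er ltcR => /fc[N HN].
  exists (f @` [set m | (N <= m)%N], f @` [set m | (N <= m)%N]) => /=.
    by split; exists N => // n /= Nn; exists n.
  move=> [_ _] /= [[m /= Nm <-] [n /= Nn <-]].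
  by rewrite -ball_normE /= norm_hnorm ltcR HN.
by move/cauchy_cvg => fcv; exists (lim (f @ \oo)).
Qed.

(** A cluster point takes the place of the limit of a subsequence: infinitely many terms close to
    [y] are all that the compactness arguments below require. *)
Lemma precompact_seq (B : set H) (f : nat -> H) :
  precompact B -> (forall n, B (f n)) ->
  exists y, forall e : R, 0 < e -> forall N, exists2 n, (N <= n)%N & hn (f n - y) < e.
Proof.
rewrite precompactE => cB Bf.
have FB : (f @ \oo) (closure B) by exists 0%N => // n _ /=; apply: subset_closure.
have [y [_ cy]] := cB (f @ \oo) _ FB.
exists y => e e0 N.
have [] := cy (f @` [set n | (N <= n)%N]) (ball y (e%:C : R[i])).
- by exists N => // n /= Nn; exists n.
- by apply: nbhsx_ballx; rewrite ltcR.
move=> _ [[n /= Nn <-]]; rewrite -ball_normE /= norm_hnorm ltcR => h.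
by exists n => //; rewrite hnorm_distC.
Qed.

Lemma cmod_small_eq0 (z : R[i]) : (forall e : R, 0 < e -> cmod z <= e) -> z = 0.
Proof.
move=> ze; apply: cmod_eq0; apply/eqP; rewrite eq_le cmod_ge0 andbT.
by apply/ler_addgt0Pr => e /ze; rewrite add0r.
Qed.

Lemma hnorm_small_eq0 u : (forall e : R, 0 < e -> hn u <= e) -> u = 0.
Proof.
move=> ze; apply: hnorm_eq0; apply/eqP; rewrite eq_le hnorm_ge0 andbT.
by apply/ler_addgt0Pr => e /ze; rewrite add0r.
Qed.

Lemma dot_cvgr (f : nat -> H) (l u : H) : f @ \oo --> l ->
  forall e : R, 0 < e -> exists N, forall n, (N <= n)%N ->
  cmod (dot u (f n) - dot u l) < e.
Proof.
move=> /cvg_hnorm fl e e0.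
have hp : 0 < hn u + 1 by rewrite ltr_wpDl ?hnorm_ge0.
have [N HN] := fl (e / (hn u + 1)) (divr_gt0 e0 hp).
exists N => n /HN {}HN; rewrite -dotBr (le_lt_trans (cauchy_schwarz _ _)) //.
rewrite ltr_pdivlMr // in HN; rewrite (le_lt_trans _ HN) // mulrC.
by rewrite ler_wpM2l ?hnorm_ge0 // lerDl.
Qed.

(** Projection theorem: by the parallelogram law a sequence in [F] minimising the distance to [x] is
    Cauchy; its limit [l] is a nearest point, so [x - l] is orthogonal to [F] and hence zero. *)
Lemma closed_subspace_full (F : set H) :
  F 0 -> (forall a u v, F u -> F v -> F (a *: u + v)) ->
  (forall (f : nat -> H) l, (forall n, F (f n)) -> f @ \oo --> l -> F l) ->
  (forall x, (forall u, F u -> dot x u = 0) -> x = 0) ->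
  forall x, F x.
Proof.
move=> F0 Flin Fcl Fperp x.
pose E := [set hn (x - u) | u in F].
have hE : has_inf E.
  split; first by exists (hn (x - 0)); exists 0.
  by exists 0 => _ [u _ <-]; exact: hnorm_ge0.
pose D := inf E.
have DE u : F u -> D <= hn (x - u) by move=> Fu; apply: ge_inf; [case: hE|exists u].
have D0 : 0 <= D by apply: lb_le_inf; [case: hE|move=> _ [u _ <-]; exact: hnorm_ge0].
have near_inf (n : nat) : exists u, F u /\ hn (x - u) < D + n.+1%:R^-1.
  have [_ [u Fu <-] h] := inf_adherent (eps := n.+1%:R^-1 : R) ltac:(by rewrite invr_gt0 ltr0n) hE.
  by exists u.
have /choice[f Hf] := near_inf.
have Fhalf u v : F u -> F v -> F (2^-1 *: (u + v)).
  move=> Fu Fv; rewrite -[_ *: _]addr0; apply: (Flin) => //.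
  by rewrite -[u]scale1r; apply: Flin.
have [l fl] : exists l : H, f @ \oo --> l.
  apply: hcomplete => e e0.
  have d0 : 0 < 8 * D + 5 by lra.
  (* The parallelogram law bounds |f n - f m|^2 by 4 (D + d)^2 - 4 D^2 = 8 D d + 4 d^2. As d <= 1
     this is at most d (8 D + 4), and the 5 makes it strictly less than e^2. *)
  pose d := Num.min 1 (e ^+ 2 / (8 * D + 5)).
  have dp : 0 < d by rewrite lt_min ltr01 divr_gt0 ?exprn_gt0.
  have dd : 8 * D * d + 4 * d ^+ 2 < e ^+ 2.
    have d1 : d <= 1 by rewrite ge_min lexx.
    have : d * (8 * D + 5) <= e ^+ 2 by rewrite -ler_pdivlMr // ge_min lexx orbT.
    nra.
  have [N HN] : exists N : nat, forall n, (N <= n)%N -> n.+1%:R^-1 < d.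
    have [N _ HN] := near_infty_natSinv_lt (PosNum dp).
    by exists N => n /HN.
  exists N => m n Nm Nn.
  have [Fm hm] := Hf m; have [Fn hn'] := Hf n.
  have := DE _ (Fhalf _ _ Fm Fn).
  have -> : x - 2^-1 *: (f m + f n) = (2^-1 : R[i]) *: ((x - f m) + (x - f n)).
    have -> : x - f m + (x - f n) = (2%:R : R[i]) *: x - (f m + f n).
      by rewrite addrACA -opprD scaler_nat mulr2n.
    by rewrite scalerBr scalerA mulVf ?pnatr_eq0 // scale1r.
  have -> : (2^-1 : R[i]) = (2^-1 : R)%:C by rewrite fmorphV rmorph_nat.
  rewrite hnormZ cmodR ger0_norm ?invr_ge0 // => DD.
  have := parallelogram (x - f m) (x - f n).
  have -> : x - f m - (x - f n) = f n - f m by rewrite opprB addrC addrA subrK.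
  rewrite hnorm_distC => P.
  have := HN _ Nm; have := HN _ Nn => en em.
  rewrite -(@ltr_pXn2r _ 2) ?nnegrE ?hnorm_ge0 ?(ltW e0) //.
  move: (hnorm_ge0 (x - f m)) (hnorm_ge0 (x - f n)) => *.
  have h1 : hn (x - f m) <= D + d by rewrite ltW // (lt_trans hm) // ltrD2l.
  have h2 : hn (x - f n) <= D + d by rewrite ltW // (lt_trans hn') // ltrD2l.
  have h3 : 4 * D ^+ 2 <= hn (x - f m + (x - f n)) ^+ 2.
    by move: DD; set y := hn (_ + _); move=> DD; have : 2 * D <= y; [lra|nra].
  have h4 : hn (x - f m) ^+ 2 <= (D + d) ^+ 2 by rewrite ler_pXn2r ?nnegrE //; lra.
  have h5 : hn (x - f n) ^+ 2 <= (D + d) ^+ 2 by rewrite ler_pXn2r ?nnegrE //; lra.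
  nra.
have Fl : F l by apply: Fcl fl => n; case: (Hf n).
have lD : hn (x - l) <= D.
  apply/ler_addgt0Pr => e e0.
  have [N1 HN1] := (cvg_hnorm f l).1 fl (e / 2) ltac:(by rewrite divr_gt0).
  have [N2 _ HN2] := near_infty_natSinv_lt (PosNum (divr_gt0 e0 (ltr0n R 2))).
  have := HN1 (maxn N1 N2) (leq_maxl _ _).
  have /= := HN2 (maxn N1 N2) (leq_maxr _ _).
  have [_] := Hf (maxn N1 N2); set m := maxn _ _ => h1 h2 h3.
  have -> : x - l = (x - f m) + (f m - l) by rewrite addrA subrK.
  have h4 : hn (x - f m) < D + e / 2 by rewrite (lt_trans h1) // ltrD2l.
  by apply: (le_trans (hnormD _ _)); lra.
suff : x - l = 0 by move/eqP; rewrite subr_eq0 => /eqP ->.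
apply: Fperp => u Fu; have [u0|u0] := eqVneq (hn u) 0.
  by rewrite (hnorm_eq0 u0) dot0r.
(* Moving [l] by the projection of [x - l] onto [u] lowers the squared distance by |<x - l, u>|^2 /
   |u|^2, which minimality forces to vanish. *)
have := DE (l + (dot (x - l) u / (hn u ^+ 2)%:C) *: u)
  ltac:(by rewrite addrC; apply: Flin).
rewrite opprD addrA => /(le_trans lD).
rewrite -(@ler_pXn2r _ 2) ?nnegrE ?hnorm_ge0 // hnorm_sub_proj // => h.
apply: cmod_eq0; apply/eqP; rewrite -sqrf_eq0 eq_le sqr_ge0 andbT.
have up : 0 < hn u ^+ 2 by rewrite exprn_gt0 // lt0r u0 hnorm_ge0.
have {}up : 0 < (hn u ^+ 2)^-1 by rewrite invr_gt0.
by rewrite -(pmulr_lle0 _ up); move: h; rewrite lerBrDr gerDl.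
Qed.

End Hilbert.

(** * The spectral theorem for A *)

Section OrthonormalSystem.
Variables (R : realType) (H : completeNormedModType R[i]).
Variable dot : {dot H for (@Num.conj R[i])}.
Hypothesis norm_dot : forall u : H, `|u| ^+ 2 = dot u u.
Local Open Scope complex_scope.
Implicit Types u v w : H.
Notation hn := (@hnorm R H).

Variable e : nat -> H.

Definition coef u n : R[i] := dot u (e n).
Definition psum u N := \sum_(i < N) coef u i *: e i.

Lemma psumD a u v N : psum (a *: u + v) N = a *: psum u N + psum v N.
Proof.
rewrite /psum scaler_sumr -big_split /=; apply: eq_bigr => i _.
by rewrite /coef dotDl dotZl scalerDl scalerA.
Qed.

Lemma dot_suml (I : Type) (r : seq I) (P : pred I) (F : I -> H) v :
  dot (\sum_(i <- r | P i) F i) v = \sum_(i <- r | P i) dot (F i) v.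
Proof.
apply: (big_morph (fun u => dot u v)); last exact: dot0l.
by move=> a b; rewrite dotDl.
Qed.

Variable N : nat.
(** Orthonormality is asked only below [N], so that finite families are covered as well as initial
    segments of a sequence under construction. *)
Hypothesis orth : forall i j, (i < N)%N -> (j < N)%N -> dot (e i) (e j) = (i == j)%:R.

Lemma coef_sum (c : nat -> R[i]) j : (j < N)%N ->
  coef (\sum_(i < N) c i *: e i) j = c j.
Proof.
move=> jN; rewrite /coef dot_suml (bigD1 (Ordinal jN)) //= big1 ?addr0.
  by rewrite dotZl orth // eqxx mulr1.
by move=> i /negPf ij; rewrite dotZl orth // -(inj_eq val_inj) /= in ij *; rewrite ij mulr0.
Qed.

Lemma psum_orth u j : (j < N)%N -> dot (u - psum u N) (e j) = 0.
Proof. by move=> jN; rewrite dotBl -/(coef _ _) -/(coef _ _) coef_sum // subrr. Qed.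

Lemma hnorm_sum_sq (c : nat -> R[i]) :
  hn (\sum_(i < N) c i *: e i) ^+ 2 = \sum_(i < N) cmod (c i) ^+ 2.
Proof.
apply: (@complexI R); rewrite -(dot_self norm_dot) {1}dot_suml rmorph_sum /=.
apply: eq_bigr => i _; rewrite dotZl dotC -/(coef _ _) coef_sum //.
by rewrite mulc_conj.
Qed.

Lemma psum_pythagoras u :
  hn (u - psum u N) ^+ 2 = hn u ^+ 2 - \sum_(i < N) cmod (coef u i) ^+ 2.
Proof.
have : hn u ^+ 2 = hn (u - psum u N) ^+ 2 + hn (psum u N) ^+ 2.
  rewrite -{1}[u](subrK (psum u N)) (hnormD_sq norm_dot (u - psum u N)).
  suff -> : dot (u - psum u N) (psum u N) = 0 by rewrite /= mulr0 addr0.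
  rewrite dotC dot_suml big1 ?rmorph0 // => i _.
  by rewrite dotZl dotC psum_orth // rmorph0 mulr0.
by rewrite /psum hnorm_sum_sq => ->; rewrite addrK.
Qed.

Lemma psum_contr u : hn (u - psum u N) <= hn u.
Proof.
rewrite -(@ler_pXn2r _ 2) ?nnegrE ?hnorm_ge0 // psum_pythagoras gerBl.
by apply: sumr_ge0 => i _; rewrite sqr_ge0.
Qed.

End OrthonormalSystem.

(** * Eigenvectors of an injective positive compact operator *)

Section CompactOperator.
Variables (R : realType) (H : completeNormedModType R[i]).
Variable dot : {dot H for (@Num.conj R[i])}.
Hypothesis norm_dot : forall u : H, `|u| ^+ 2 = dot u u.
Local Open Scope complex_scope.
Implicit Types u v w : H.
Notation hn := (@hnorm R H).

Variable K : H -> H.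
Hypothesis K_lin : forall a u v, K (a *: u + v) = a *: K u + K v.
Hypothesis K_sym : forall u v, dot (K u) v = dot u (K v).
Hypothesis K_pos : forall u, 0 <= complex.Re (dot (K u) u).
Hypothesis K_contr : forall u, hn (K u) <= hn u.
Hypothesis K_inj : forall u, K u = 0 -> u = 0.
Hypothesis K_compact : forall f : nat -> H, (forall n, hn (f n) <= 1) ->
  exists y, forall d : R, 0 < d -> forall N,
    exists2 n, (N <= n)%N & hn (K (f n) - y) < d.

Lemma K0 : K 0 = 0.
Proof. by have := K_lin (-1) 0 0; rewrite scaler0 addr0 scaleN1r addNr. Qed.
Lemma KD u v : K (u + v) = K u + K v.
Proof. by rewrite -{1}[u]scale1r K_lin scale1r. Qed.
Lemma KZ a u : K (a *: u) = a *: K u.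
Proof. by rewrite -[a *: u]addr0 K_lin K0 addr0. Qed.
Lemma KB u v : K (u - v) = K u - K v.
Proof. by rewrite KD -scaleN1r KZ scaleN1r. Qed.

Definition rayleigh u : R := complex.Re (dot (K u) u).

Lemma rayleigh_sub_K (t : R) u :
  rayleigh (u - t%:C *: K u) =
  rayleigh u - 2 * t * hn (K u) ^+ 2 + t ^+ 2 * rayleigh (K u).
Proof.
rewrite /rayleigh KB KZ dotBl !dotBr !dotZr !dotZl.
rewrite (K_sym (K u) u) (dot_self norm_dot) conjCR.
move: (dot (K (K u)) (K u)) (dot (K u) u) => [a b] [c d].
by rewrite -rmorphM /= !mul0r !subr0; ring.
Qed.

(** Positivity of the form at u - t K u, expanded in t. The choice t = 1/m turns an upper bound m of
    the form into |K u|^2 <= m <K u, u>. *)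
Lemma K_rayleigh (m t : R) u :
  (rayleigh (K u) <= m * hn (K u) ^+ 2) ->
  (2 * t - t ^+ 2 * m) * hn (K u) ^+ 2 <= rayleigh u.
Proof.
move=> h; have := K_pos (u - t%:C *: K u); rewrite -/(rayleigh _) rayleigh_sub_K.
have : t ^+ 2 * rayleigh (K u) <= t ^+ 2 * (m * hn (K u) ^+ 2).
  by rewrite ler_wpM2l ?sqr_ge0.
rewrite mulrBl -[t ^+ 2 * m * _]mulrA; lra.
Qed.

Lemma rayleigh_le u : rayleigh u <= hn (K u) * hn u.
Proof. by rewrite (le_trans (Re_le_cmod _)) ?cauchy_schwarz. Qed.

Lemma rayleighZ (t : R) u : rayleigh (t%:C *: u) = t ^+ 2 * rayleigh u.
Proof.
rewrite /rayleigh KZ dotZl dotZr conjCR mulrA -rmorphM ReZ; ring.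
Qed.

(** By the last clause the eigenvalue of [x] is the norm of [K] on the orthocomplement of [s]; this
    is what orders the eigenvalues and controls the remainders of expansions. *)
Definition eigen_step (s : seq H) x :=
  [/\ hn x = 1, forall y, y \in s -> dot x y = 0,
      K x = (rayleigh x)%:C *: x, 0 < rayleigh x &
      forall u, (forall y, y \in s -> dot u y = 0) -> hn (K u) <= rayleigh x * hn u].

(** Let m be the supremum of <K u, u> over the unit ball of the orthocomplement Q of [s], which is
    invariant under [K] by symmetry. Along a maximising sequence f_n the vectors K f_n - m f_n tend
    to 0, and a cluster point of K f_n is an eigenvector for m. *)
Lemma max_eigenvector (s : seq H) :
  (forall y, y \in s -> exists l : R[i], K y = l *: y) ->
  (exists2 u : H, u != 0 & forall y, y \in s -> dot u y = 0) ->
  exists x, eigen_step s x.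
Proof.
move=> sK [u0 u00 u0s].
pose Q := [set u | forall y, y \in s -> dot u y = 0].
have QK u : Q u -> Q (K u).
  by move=> Qu y ys; rewrite K_sym; have [l ->] := sK y ys; rewrite dotZr Qu // mulr0.
have QZ a u : Q u -> Q (a *: u).
  by move=> Qu y ys; rewrite dotZl Qu // mulr0.
have Q0 : Q 0 by move=> y _; rewrite dot0l.
pose E := [set rayleigh u | u in [set u | Q u /\ hn u <= 1]].
have hE : has_sup E.
  split; first by exists (rayleigh 0), 0 => //=; rewrite hnorm0.
  exists 1 => _ [u [Qu u1] <-]; rewrite (le_trans (rayleigh_le _)) //.
  rewrite (le_trans (ler_pM _ _ (K_contr u) (lexx _))) ?hnorm_ge0 //.
  by rewrite mulr_ile1 ?hnorm_ge0.
pose m := sup E.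
have mE u : Q u -> hn u <= 1 -> rayleigh u <= m.
  by move=> Qu u1; apply: ub_le_sup; [case: hE|exists u].
have normal u : u != 0 -> hn ((hn u)^-1%:C *: u) = 1.
  move=> un; have : hn u != 0 by apply: contra_neq un; exact: hnorm_eq0.
  by move=> h; rewrite hnormZ cmodR ger0_norm ?invr_ge0 ?hnorm_ge0 // mulVf.
have mQ u : Q u -> rayleigh u <= m * hn u ^+ 2.
  move=> Qu; have [->|un] := eqVneq u 0.
    by rewrite /rayleigh K0 dot0l hnorm0 expr0n mulr0.
  have un' : 0 < hn u.
    by rewrite lt0r hnorm_ge0 andbT; apply: contra_neq un; exact: hnorm_eq0.
  have := mE _ (QZ (hn u)^-1%:C _ Qu); rewrite normal // lexx => /(_ isT).
  rewrite rayleighZ exprVn ler_pdivrMl ?exprn_gt0 //.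
  by rewrite mulrC.
(* Injectivity of [K] enters here: a unit vector v of Q has K v nonzero, and [K_rayleigh] with m = t
   = 1 gives <K v, v> >= |K v|^2. *)
have m0 : 0 < m.
  pose v := (hn u0)^-1%:C *: u0.
  have v1 : hn v = 1 by exact: normal.
  have Qv : Q v by apply: QZ.
  have Kv : 0 < hn (K v).
    rewrite lt0r hnorm_ge0 andbT; apply/eqP => /hnorm_eq0 /K_inj v0.
    by move: v1; rewrite v0 hnorm0 => /eqP; rewrite eq_sym oner_eq0.
  apply: lt_le_trans (mE v Qv _); last by rewrite v1.
  apply: lt_le_trans (@K_rayleigh 1 1 v _).
    by rewrite expr1n !mulr1 mulr_gt0 ?exprn_gt0 //; lra.
  rewrite mul1r expr2 (le_trans (rayleigh_le _)) //.
  by rewrite ler_wpM2r ?hnorm_ge0.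
have Ksq u : Q u -> hn (K u) ^+ 2 <= m * rayleigh u.
  move=> Qu; have := @K_rayleigh m m^-1 u (mQ _ (QK _ Qu)).
  have -> : 2 * m^-1 - m^-1 ^+ 2 * m = m^-1 by field; rewrite gt_eqF.
  by rewrite ler_pdivrMl.
have /choice[f Hf] (n : nat) : exists u, [/\ Q u, hn u <= 1 & m - n.+1%:R^-1 < rayleigh u].
  have [_ [u [Qu u1] <-] h] := sup_adherent (eps := n.+1%:R^-1 : R)
    ltac:(by rewrite invr_gt0 ltr0n) hE.
  by exists u.
have [y Hy] := K_compact (fun n => let: And3 _ h _ := Hf n in h).
(* Expanding the square and using |K f|^2 <= m <K f, f> and |f| <= 1 leaves m^2 - m <K f, f>, which
   is small near the supremum. *)
have approx n : hn (K (f n) - m%:C *: f n) ^+ 2 <= m * n.+1%:R^-1.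
  have [Qn n1 nm] := Hf n.
  rewrite (hnormD_sq norm_dot) hnormN hnormZ cmodR dotNr dotZr conjCR ReN ReZ.
  rewrite (gtr0_norm m0) -/(rayleigh _).
  have h1 := Ksq _ Qn.
  have h2 : hn (f n) ^+ 2 <= 1 by rewrite expr_le1 ?hnorm_ge0.
  rewrite exprMn; move: (n.+1%:R^-1) nm => d nm.
  have : m ^+ 2 * hn (f n) ^+ 2 <= m ^+ 2 by rewrite ler_piMr ?sqr_ge0.
  have : m * (m - d) <= m * rayleigh (f n) by rewrite ler_wpM2l ?ltW.
  by rewrite mulrBr -expr2; lra.
have near d : 0 < d -> exists2 n, hn (K (f n) - m%:C *: f n) < d &
    hn (K (f n) - y) < d /\ m - d < rayleigh (f n).
  move=> d0; have dm : 0 < Num.min d (d ^+ 2 / m).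
    by rewrite lt_min d0 divr_gt0 ?exprn_gt0.
  have [N _ HN] := near_infty_natSinv_lt (PosNum dm).
  have [n Nn hn1] := Hy d d0 N; exists n.
    rewrite -(@ltr_pXn2r _ 2) ?nnegrE ?hnorm_ge0 ?(ltW d0) //.
    apply: le_lt_trans (approx n) _; rewrite -ltr_pdivlMl // mulrC.
    by apply: lt_le_trans (HN n Nn) _; rewrite /= ge_min lexx orbT.
  split=> //; have [_ _] := Hf n; apply: le_lt_trans.
  rewrite lerD2l lerN2; apply: le_trans (ltW (HN n Nn)) _.
  by rewrite /= ge_min lexx.
have Ky : K y = m%:C *: y.
  apply/eqP; rewrite -subr_eq0; apply/eqP/hnorm_small_eq0 => d d0.
  have d30 : 0 < d / (2 + m) by rewrite divr_gt0 // addr_gt0.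
  have [n h1 [h2 _]] := near _ d30.
  (* Two of the three terms are contracted by [K] and the third carries the factor m, whence the
     tolerance d / (2 + m). *)
  have -> : K y - m%:C *: y = K (y - K (f n)) + K (K (f n) - m%:C *: f n)
      + m%:C *: (K (f n) - y).
    by rewrite !KB KZ scalerBr !addrA !subrK.
  rewrite (le_trans (hnormD _ _)) // (le_trans (lerD (hnormD _ _) (lexx _))) //.
  rewrite hnormZ cmodR (gtr0_norm m0).
  have := K_contr (y - K (f n)); rewrite hnorm_distC.
  have := K_contr (K (f n) - m%:C *: f n).
  have : m * hn (K (f n) - y) <= m * (d / (2 + m)).
    by rewrite ler_wpM2l ?ltW.
  have : d = 2 * (d / (2 + m)) + m * (d / (2 + m)) by field; rewrite gt_eqF ?addr_gt0.
  rewrite [hn (y - _)]hnorm_distC; move: (d / (2 + m)) h1 h2 => d'; lra.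
have Qy : Q y.
  move=> z zs; apply: cmod_small_eq0 => d d0.
  have d10 : 0 < d / (1 + hn z) by rewrite divr_gt0 // ltr_pwDl ?hnorm_ge0.
  have [n _ [h _]] := near _ d10.
  have -> : dot y z = - dot (K (f n) - y) z.
    rewrite dotBl (_ : dot (K (f n)) z = 0) ?sub0r ?opprK //.
    by apply: QK => //; case: (Hf n).
  rewrite cmodN (le_trans (cauchy_schwarz norm_dot _ _)) //.
  rewrite ltr_pdivlMr ?ltr_pwDl ?hnorm_ge0 // in h.
  by rewrite (le_trans _ (ltW h)) // ler_wpM2l ?hnorm_ge0 // lerDr.
have y0 : y != 0.
  (* If the cluster point were 0, some |K f_n| would be below m / 2, although it dominates <K f_n,
     f_n> > m / 2. *)
  apply/eqP => y0; have m20 : 0 < m / 2 by rewrite divr_gt0.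
  have [n _ []] := near _ m20; rewrite y0 subr0 => h1 h2.
  have [_ n1 _] := Hf n.
  have := rayleigh_le (f n).
  have : hn (K (f n)) * hn (f n) <= hn (K (f n)) by rewrite ler_piMr ?hnorm_ge0.
  lra.
pose x := (hn y)^-1%:C *: y.
have x1 : hn x = 1 by exact: normal.
have Kx : K x = m%:C *: x by rewrite KZ Ky !scalerA mulrC.
have rx : rayleigh x = m.
  by rewrite /rayleigh Kx dotZl ReZ (dot_self norm_dot) x1 /= expr1n mulr1.
exists x; split => //; rewrite ?rx //.
- by apply: QZ.
- move=> u Qu; rewrite -(@ler_pXn2r _ 2) ?nnegrE ?hnorm_ge0 ?mulr_ge0 ?hnorm_ge0 ?(ltW m0) //.
  rewrite (le_trans (Ksq _ Qu)) // exprMn expr2 -mulrA ler_wpM2l ?(ltW m0) //.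
  exact: mQ.
Qed.

(** Only families in the range of [K] are considered: with [K] the inverse of A + I this is where
    [A] acts, and where unboundedness can be contradicted. *)
Hypothesis infinite_dim : forall (N : nat) (f : nat -> H),
  (forall i j, (i < N)%N -> (j < N)%N -> dot (f i) (f j) = (i == j)%:R) ->
  (forall i, (i < N)%N -> exists g, f i = K g) ->
  exists2 u : H, u != 0 & forall i, (i < N)%N -> dot u (f i) = 0.

Definition eigen_next s := xget 0 (eigen_step s).
Definition eigen_chain n := iter n (fun s => rcons s (eigen_next s)) [::].
Definition eigen_vec n := eigen_next (eigen_chain n).

Lemma mem_eigen_chain n (y : H) :
  reflect (exists2 i, (i < n)%N & y = eigen_vec i) (y \in eigen_chain n).
Proof.
elim: n => [|n IH] /=; first by apply: (iffP idP) => // -[].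
rewrite mem_rcons inE -/(eigen_chain n); apply: (iffP orP).
  case=> [/eqP->|h]; first by exists n.
  have [i ilt ->] := elimT IH h.
  by exists i => //; exact: ltnW.
case=> i; rewrite ltnS leq_eqVlt => /orP[/eqP-> ->|ilt yi]; first by left.
by right; apply/IH; exists i.
Qed.

(** Strong induction: the next choice is legitimate, and its default 0 never taken, because the
    previous choices are orthonormal eigenvectors in the range of [K]. *)
Lemma eigen_vecP n : eigen_step (eigen_chain n) (eigen_vec n).
Proof.
elim/ltn_ind: n => n IH.
have orth i j : (i < n)%N -> (j < n)%N -> dot (eigen_vec i) (eigen_vec j) = (i == j)%:R.
  move=> ilt jlt; have [ij|ji|->] := ltngtP i j.
  - have [_ h _ _ _] := IH j jlt; rewrite dotC h ?rmorph0 //.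
    by apply/mem_eigen_chain; exists i.
  - have [_ h _ _ _] := IH i ilt; rewrite h //.
    by apply/mem_eigen_chain; exists j.
  - by have [h _ _ _ _] := IH j jlt; rewrite (dot_self norm_dot) h expr1n.
have eig i : (i < n)%N -> K (eigen_vec i) = (rayleigh (eigen_vec i))%:C *: eigen_vec i.
  by move=> /IH[].
have [x Px] : exists x, eigen_step (eigen_chain n) x.
  apply: max_eigenvector.
    by move=> y /mem_eigen_chain[i /eig h ->]; eexists; exact: h.
  have [i ilt|u u0 uo] := infinite_dim orth.
    exists ((rayleigh (eigen_vec i))^-1%:C *: eigen_vec i); rewrite KZ eig //.
    have [_ _ _ h _] := IH i ilt.
    by rewrite scalerA -rmorphM mulVf ?gt_eqF //= scale1r.
  by exists u => // y /mem_eigen_chain[i ilt ->]; apply: uo.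
by rewrite /eigen_vec /eigen_next; case: xgetP => [z -> //|/(_ x)].
Qed.

Lemma eigen_orth i j : dot (eigen_vec i) (eigen_vec j) = (i == j)%:R.
Proof.
have [ij|ji|->] := ltngtP i j.
- have [_ h _ _ _] := eigen_vecP j; rewrite dotC h ?rmorph0 //.
  by apply/mem_eigen_chain; exists i.
- have [_ h _ _ _] := eigen_vecP i; rewrite h //.
  by apply/mem_eigen_chain; exists j.
- by have [h _ _ _ _] := eigen_vecP j; rewrite (dot_self norm_dot) h expr1n.
Qed.

(** Vector [j] is orthogonal to all those before [i], so the norm of [K] on their orthocomplement
    bounds its eigenvalue. *)
Lemma eigen_val_noninc i j : (i <= j)%N ->
  rayleigh (eigen_vec j) <= rayleigh (eigen_vec i).
Proof.
move=> ij; have [n1 _ Kj pj _] := eigen_vecP j; have [_ _ _ _ h] := eigen_vecP i.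
have := h (eigen_vec j); rewrite Kj hnormZ n1 !mulr1 cmodR gtr0_norm //; apply.
move=> y /mem_eigen_chain[k ki ->]; rewrite eigen_orth.
by rewrite gtn_eqF // (leq_trans ki).
Qed.

(** Otherwise the vectors K e_n would be orthogonal of norm at least d, hence at mutual distance at
    least sqrt 2 d, and could have no cluster point. *)
Lemma eigen_val_cvg0 (d : R) : 0 < d -> exists n, rayleigh (eigen_vec n) < d.
Proof.
move=> d0; apply: contrapT => /forallNP h.
have ge n : d <= rayleigh (eigen_vec n) by rewrite leNgt; apply/negP.
have norm1 n : hn (eigen_vec n) <= 1 by have [->] := eigen_vecP n.
have [y Hy] := K_compact norm1.
have d20 : 0 < d / 2 by rewrite divr_gt0.
have [n _ h1] := Hy _ d20 0%N; have [m nm h2] := Hy _ d20 n.+1.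
have : hn (K (eigen_vec n) - K (eigen_vec m)) < d.
  have -> : K (eigen_vec n) - K (eigen_vec m) =
     (K (eigen_vec n) - y) - (K (eigen_vec m) - y).
    by rewrite opprB addrA subrK.
  by apply: le_lt_trans (hnormB _ _) _; lra.
have [n1 _ Kn _ _] := eigen_vecP n; have [m1 _ Km _ _] := eigen_vecP m.
rewrite -(@ltr_pXn2r _ 2) ?nnegrE ?hnorm_ge0 ?(ltW d0) //.
rewrite (hnormD_sq norm_dot) hnormN dotNr Kn Km dotZl dotZr eigen_orth.
rewrite (ltn_eqF nm) !mulr0 oppr0 mulr0 addr0 !hnormZ n1 m1 !cmodR !mulr1 !real_normK ?num_real //.
have := ge n; have := ge m; nra.
Qed.

(** The remainder of K x after N terms is [K] applied to the remainder of x, and on that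
    orthocomplement [K] has norm equal to the N-th eigenvalue. *)
Lemma eigen_complete_range x : exists2 e : nat -> R, (forall d, 0 < d -> exists n,
    forall m, (n <= m)%N -> e m < d) &
  forall N, hn (K x - psum dot eigen_vec (K x) N) <= e N.
Proof.
exists (fun N => rayleigh (eigen_vec N) * hn x).
  move=> d d0; have p : 0 < hn x + 1 by rewrite ltr_wpDl ?hnorm_ge0.
  have [n h] := eigen_val_cvg0 (divr_gt0 d0 p); exists n => m nm.
  rewrite ltr_pdivlMr // in h; apply: le_lt_trans h.
  have [_ _ _ p1 _] := eigen_vecP n.
  by rewrite ler_pM ?hnorm_ge0 ?eigen_val_noninc ?lerDl //; case: (eigen_vecP m) => _ _ _ /ltW.
move=> N.
have orthN i j (_ : (i < N)%N) (_ : (j < N)%N) := eigen_orth i j.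
have -> : K x - psum dot eigen_vec (K x) N = K (x - psum dot eigen_vec x N).
  rewrite KB; congr (_ - _); rewrite /psum (big_morph K KD K0).
  apply: eq_bigr => i _; rewrite KZ /coef K_sym.
  have [_ _ -> _ _] := eigen_vecP i.
  by rewrite dotZr conjCR scalerA mulrC.
have [_ _ _ p h] := eigen_vecP N.
apply: (le_trans (h _ _)); last by rewrite ler_wpM2l ?(ltW p) ?psum_contr.
by move=> y /mem_eigen_chain[i iN ->]; rewrite psum_orth.
Qed.

(** Convergence passes from the range of [K] to its closure because the remainder maps are
    contractions. *)
Lemma eigen_complete u :
  (forall d : R, 0 < d -> exists x, hn (u - K x) < d) ->
  series (fun n => coef dot eigen_vec u n *: eigen_vec n) @ \oo --> u.
Proof.
move=> du; apply/cvg_hnorm => d d0.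
have d20 : 0 < d / 2 by rewrite divr_gt0.
have [x ux] := du _ d20.
have [e e0 he] := eigen_complete_range x; have [N HN] := e0 _ d20.
exists N => n /HN en; rewrite hnorm_distC /series /= big_mkord -/(psum _ _ _ _).
have orthN i j (_ : (i < n)%N) (_ : (j < n)%N) := eigen_orth i j.
have -> : u - psum dot eigen_vec u n = ((u - K x) - psum dot eigen_vec (u - K x) n)
   + (K x - psum dot eigen_vec (K x) n).
  have -> : u - K x = (-1) *: K x + u by rewrite scaleN1r addrC.
  rewrite psumD !scaleN1r opprD opprK.
  set P := psum _ _ u n; set Q := psum _ _ (K x) n; move: (K x) P Q => k P Q.
  rewrite [- k + u + _]addrACA [RHS]addrAC [- k + Q + _]addrACA.
  by rewrite addNr subrr !add0r.
apply: le_lt_trans (hnormD _ _) _.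
have := psum_contr norm_dot orthN (u - K x); have := he n; lra.
Qed.

End CompactOperator.

(** * An eigenbasis of A from the compact inverse of A + I *)

Section Eigenbasis.
Variables (R : realType) (H : completeNormedModType R[i]).
Variable dot : {dot H for (@Num.conj R[i])}.
Hypothesis norm_dot : forall u : H, `|u| ^+ 2 = dot u u.
Variables (domA : set H) (A : H -> H).
Hypothesis A_linear : linear_on domA A.
Hypothesis A_self_adjoint : self_adjoint dot domA A.
Hypothesis A_positive : positive_definite dot domA A.
Local Open Scope complex_scope.
Implicit Types u v w x : H.
Notation hn := (@hnorm R H).

Lemma domA0 : domA 0. Proof. by case: A_linear. Qed.
Lemma A0 : A 0 = 0.
Proof.
have [d0 /(_ 1 0 0 d0 d0)[_]] := A_linear.
by rewrite scaler0 addr0 scale1r => /eqP; rewrite -subr_eq0 opprD addNKr oppr_eq0 => /eqP.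
Qed.
Lemma domAZ a u : domA u -> domA (a *: u) /\ A (a *: u) = a *: A u.
Proof.
move=> du; have [_ /(_ a u 0 du domA0)] := A_linear.
by rewrite !addr0 A0 addr0.
Qed.
Lemma domAD u v : domA u -> domA v -> domA (u + v) /\ A (u + v) = A u + A v.
Proof. by move=> du dv; have [_ /(_ 1 u v du dv)] := A_linear; rewrite !scale1r. Qed.

Lemma A_sym u v : domA u -> domA v -> dot (A u) v = dot u (A v).
Proof.
move=> du dv; have [_ /(_ v (A v))[h _]] := A_self_adjoint.
exact: (h (conj dv erefl)).
Qed.

Lemma A_ge0 u : domA u -> 0 <= complex.Re (dot (A u) u).
Proof.
move=> du; have [->|u0] := eqVneq u 0; first by rewrite dot0r.
by have := A_positive du u0; rewrite ltcE => /andP[_ /ltW].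
Qed.

Lemma A1_expand u : domA u -> hn u <= hn (A u + u).
Proof.
move=> du; rewrite -(@ler_pXn2r _ 2) ?nnegrE ?hnorm_ge0 // (hnormD_sq norm_dot).
have := A_ge0 du; have := sqr_ge0 (hn (A u)); lra.
Qed.

(** The range of A + I is closed, since A is closed and A + I does not decrease norms, and its
    orthocomplement is trivial. *)
Lemma A1_surj f : exists2 x, domA x & A x + x = f.
Proof.
pose F := [set f | exists2 x, domA x & A x + x = f].
suff : F f by [].
apply: (closed_subspace_full norm_dot).
- by exists 0; [exact: domA0 | rewrite A0 addr0].
- move=> a _ _ [u du <-] [v dv <-]; have [_ /(_ a u v du dv)[d1 d2]] := A_linear.
  by exists (a *: u + v) => //; rewrite d2 scalerDr addrACA.
- move=> g l Hg gl.
  have /choice[x Hx] n : exists x, domA x /\ A x + x = g n.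
    by have [x] := Hg n; exists x.
  have dx n : domA (x n) by case: (Hx n).
  have gx n : A (x n) + x n = g n by case: (Hx n).
  have [y xy] : exists y : H, x @ \oo --> y.
    apply: hcomplete => e e0.
    have [N HN] := (cvg_hnorm g l).1 gl (e / 2) ltac:(by rewrite divr_gt0).
    exists N => m n Nm Nn.
    have [d1 e1] := domAZ (-1) (dx n); have [d2 e2] := domAD (dx m) d1.
    rewrite -scaleN1r; apply: le_lt_trans (A1_expand d2) _.
    rewrite e2 e1 !scaleN1r addrACA -opprD !gx.
    have -> : g m - g n = (g m - l) - (g n - l) by rewrite opprB addrA subrK.
    apply: le_lt_trans (hnormB _ _) _.
    by have := HN m Nm; have := HN n Nn; lra.
  (* Closedness of the graph: self-adjointness reduces A y = l - y to an identity tested against the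
     domain, and such identities survive limits. *)
  have [_ /(_ y (l - y))[_ h]] := A_self_adjoint.
  have [|d1 d2] := h; last by exists y => //; rewrite d2 subrK.
  move=> u du; apply/eqP; rewrite -subr_eq0; apply/eqP/cmod_small_eq0 => e e0.
  have e30 : 0 < e / 3 by rewrite divr_gt0.
  have [N1 H1] := dot_cvgr norm_dot (A u) xy e30.
  have [N2 H2] := dot_cvgr norm_dot u gl e30.
  have [N3 H3] := dot_cvgr norm_dot u xy e30.
  pose n := maxn N1 (maxn N2 N3).
  have {}H1 := H1 n (leq_maxl _ _).
  have {}H2 := H2 n (leq_trans (leq_maxl _ _) (leq_maxr _ _)).
  have {}H3 := H3 n (leq_trans (leq_maxr _ _) (leq_maxr _ _)).
  have -> : dot (A u) y - dot u (l - y) = - (dot (A u) (x n) - dot (A u) y)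
     + ((dot u (g n) - dot u l) - (dot u (x n) - dot u y)).
    by rewrite (A_sym du (dx n)) -(gx n) dotBr dotDr; ring.
  rewrite (le_trans (cmodD _ _)) // (le_trans (lerD (lexx _) (cmodB _ _))) //.
  by rewrite cmodN; lra.
(* A vector orthogonal to the range satisfies <A u, x> = <u, -x> on the domain, so A x = -x, and
   positivity leaves only x = 0. *)
- move=> x hx; have [_ /(_ x (- x))[_ h]] := A_self_adjoint.
  have [|dx Ax] := h.
    move=> u du; have /hx : F (A u + u) by exists u.
    rewrite dotDr dotNr => /eqP; rewrite addr_eq0 => /eqP E.
    by rewrite dotC E rmorphN /= -dotC.
  have := A_ge0 dx; rewrite Ax dotNl (dot_self norm_dot) /= => h1.
  apply: hnorm_eq0; apply/eqP; rewrite -sqrf_eq0 eq_le sqr_ge0 andbT; lra.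
Qed.

Definition A1_inv f := xget 0 [set x | domA x /\ A x + x = f].

Lemma A1_invP f : domA (A1_inv f) /\ A (A1_inv f) + A1_inv f = f.
Proof.
have [x dx e] := A1_surj f.
by rewrite /A1_inv; case: xgetP => [y _ //|/(_ x)[]].
Qed.

Lemma A1_invK x : domA x -> A1_inv (A x + x) = x.
Proof.
move=> dx; have [d1 e1] := A1_invP (A x + x).
have [d2 e2] := domAZ (-1) dx; have [d3 e3] := domAD d1 d2.
apply/eqP; rewrite -subr_eq0; apply/eqP/hnorm_eq0/eqP.
rewrite eq_le hnorm_ge0 andbT -scaleN1r (le_trans (A1_expand d3)) //.
by rewrite e3 e2 addrACA e1 -scalerDr scaleN1r subrr hnorm0.
Qed.

Lemma A1_inv_lin a u v : A1_inv (a *: u + v) = a *: A1_inv u + A1_inv v.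
Proof.
have [du eu] := A1_invP u; have [dv ev] := A1_invP v.
have [_ /(_ a _ _ du dv)[d1 d2]] := A_linear.
rewrite -[in LHS]eu -[in LHS]ev -(A1_invK d1) d2; congr A1_inv.
by rewrite scalerDr addrACA.
Qed.

Lemma A1_inv_sym u v : dot (A1_inv u) v = dot u (A1_inv v).
Proof.
have [du eu] := A1_invP u; have [dv ev] := A1_invP v.
by rewrite -{1}ev -{2}eu dotDr dotDl A_sym.
Qed.

Lemma A1_inv_pos u : 0 <= complex.Re (dot (A1_inv u) u).
Proof.
have [du eu] := A1_invP u; rewrite -{2}eu dotDr -A_sym // ReD addr_ge0 ?A_ge0 //.
by rewrite (dot_self norm_dot) /= sqr_ge0.
Qed.

Lemma A1_inv_contr u : hn (A1_inv u) <= hn u.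
Proof. by have [du eu] := A1_invP u; rewrite -{2}eu A1_expand. Qed.

Lemma A1_inv_inj u : A1_inv u = 0 -> u = 0.
Proof. by move=> h; have [_ <-] := A1_invP u; rewrite h A0 addr0. Qed.

Hypothesis A_compact_resolvent : compact_resolvent domA A.
Hypothesis A_unbounded : unbounded domA A.

(** Resolvent identity: the compactness hypothesis concerns some unknown point z, and the inverse of
    A + I at f is the resolvent at z of (z + 1) (A + I)^{-1} f - f, whose norm is at most [M] when
    |f| <= 1. *)
Lemma A1_inv_compact (f : nat -> H) : (forall n, hn (f n) <= 1) ->
  exists y, forall d : R, 0 < d -> forall N,
    exists2 n, (N <= n)%N & hn (A1_inv (f n) - y) < d.
Proof.
move=> f1; have [z [zbij _] zc] := A_compact_resolvent.
pose M := cmod (z + 1) + 1.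
have M0 : 0 < M by rewrite ltr_wpDl ?cmod_ge0.
pose g n := z *: A1_inv (f n) - A (A1_inv (f n)).
have gM n : hn (M^-1%:C *: g n) <= 1.
  have [_ e] := A1_invP (f n).
  have -> : g n = (z + 1) *: A1_inv (f n) - f n.
    by rewrite -[in X in _ = _ - X]e scalerDl scale1r opprD addrA addrAC addrK.
  rewrite hnormZ cmodR gtr0_norm ?invr_gt0 // ler_pdivrMl // mulr1.
  rewrite (le_trans (hnormB _ _)) // hnormZ lerD // ler_piMr ?cmod_ge0 //.
  exact: le_trans (A1_inv_contr _) (f1 n).
have resE n : resolvent domA A z (M^-1%:C *: g n) = M^-1%:C *: A1_inv (f n).
  have [dn _] := A1_invP (f n); have [d2 e2] := domAZ M^-1%:C dn.
  have -> : M^-1%:C *: g n =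
      z *: (M^-1%:C *: A1_inv (f n)) - A (M^-1%:C *: A1_inv (f n)).
    by rewrite e2 /g scalerBr !scalerA mulrC.
  exact: (@pinvKV _ _ (fun=> 0) _ _ (set_bij_inj zbij) _ (mem_set d2)).
have [|y Hy] := @precompact_seq _ _ _ (fun n => M^-1%:C *: A1_inv (f n)) zc.
  by move=> n; exists (M^-1%:C *: g n); [exact: gM|exact: resE].
exists (M%:C *: y) => d d0 N.
have [n Nn h] := Hy (d / M) (divr_gt0 d0 M0) N; exists n => //.
have -> : A1_inv (f n) - M%:C *: y = M%:C *: (M^-1%:C *: A1_inv (f n) - y).
  by rewrite scalerBr scalerA -rmorphM mulfV ?gt_eqF //= scale1r.
by rewrite hnormZ cmodR gtr0_norm // mulrC -ltr_pdivlMr.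
Qed.

Lemma hnorm_sum (I : Type) (r : seq I) (P : pred I) (F : I -> H) :
  hn (\sum_(i <- r | P i) F i) <= \sum_(i <- r | P i) hn (F i).
Proof.
elim/big_ind2 : _ => //; first by rewrite hnorm0.
by move=> a b c d ab cd; rewrite (le_trans (hnormD _ _)) // lerD.
Qed.

(** If nothing were orthogonal to the family, A u would equal the sum of <u, A f_i> f_i, and [A]
    would be bounded by the sum of the |A f_i|. *)
Lemma A1_infinite_dim (N : nat) (f : nat -> H) :
  (forall i j, (i < N)%N -> (j < N)%N -> dot (f i) (f j) = (i == j)%:R) ->
  (forall i, (i < N)%N -> exists g, f i = A1_inv g) ->
  exists2 u : H, u != 0 & forall i, (i < N)%N -> dot u (f i) = 0.
Proof.
move=> forth fK; apply: contrapT => hu; apply: A_unbounded.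
exists (\sum_(i < N) hn (A (f i))) => u du.
have fdom i : (i < N)%N -> domA (f i).
  by move=> /fK[g ->]; case: (A1_invP g).
have -> : A u = psum dot f (A u) N.
  apply/eqP; rewrite -subr_eq0; apply/negPn/negP => h; apply: hu.
  exists (A u - psum dot f (A u) N) => // i iN.
  exact: psum_orth.
rewrite /psum (le_trans (hnorm_sum _ _ _)) // mulr_suml ler_sum // => i _.
have fi1 : hn (f i) = 1.
  apply/eqP; rewrite -(@eqrXn2 _ 2) ?hnorm_ge0 //; apply/eqP/(@complexI R).
  by rewrite -(dot_self norm_dot) forth // eqxx expr1n.
rewrite hnormZ fi1 mulr1 /coef (A_sym du (fdom _ (ltn_ord i))) mulrC.
exact: cauchy_schwarz.
Qed.

(** An eigenvalue l of (A + I)^{-1} gives the eigenvalue 1/l - 1 of [A]. The uniform lower bound is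
    the value at index 0: it is positive by positive definiteness, and the 1/l - 1 increase as the l
    decrease. *)
Theorem eigenbasis_exists : exists e mu, eigenbasis dot domA A e mu /\
  exists2 d, 0 < d & forall n, d <= mu n.
Proof.
pose K := A1_inv; pose e := eigen_vec dot K.
pose l n := rayleigh dot K (e n); pose mu n := (l n)^-1 - 1.
have eP n := eigen_vecP norm_dot A1_inv_lin A1_inv_sym A1_inv_pos A1_inv_contr
  A1_inv_inj A1_inv_compact A1_infinite_dim n.
have orth := eigen_orth norm_dot A1_inv_lin A1_inv_sym A1_inv_pos A1_inv_contr
  A1_inv_inj A1_inv_compact A1_infinite_dim.
have l0 n : 0 < l n by case: (eP n).
have Ke n : K (e n) = (l n)%:C *: e n by case: (eP n).
have Ae n : domA (e n) /\ A (e n) = (mu n)%:C *: e n.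
  have [dK eK] := A1_invP (e n).
  have [d1 e1] := domAZ (l n)^-1%:C dK.
  have ee : (l n)^-1%:C *: A1_inv (e n) = e n.
    by rewrite -/K Ke scalerA -rmorphM mulVf ?gt_eqF //= scale1r.
  rewrite ee in d1 e1; split=> //.
  rewrite e1 /mu rmorphB scalerBl /= scale1r -{3}ee -scalerBr; congr (_ *: _).
  by rewrite -{2}eK addrK.
have en1 n : hn (e n) = 1 by case: (eP n).
have mu0 n : 0 < mu n.
  have [dn An] := Ae n.
  have e0 : e n != 0.
    by apply/eqP => h; move: (en1 n); rewrite h hnorm0 => /eqP; rewrite eq_sym oner_eq0.
  have := A_positive dn e0; rewrite An dotZl (dot_self norm_dot) en1 expr1n mulr1.
  by rewrite ltcR.
exists e, mu; split.
  split => // u; apply: (eigen_complete norm_dot A1_inv_lin A1_inv_sym A1_inv_pos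
    A1_inv_contr A1_inv_inj A1_inv_compact A1_infinite_dim).
  move=> d d0; have [dns _] := A_self_adjoint.
  have [|x [ux dx]] := dns (ball u (d%:C : R[i])) _ (ball_open _ _).
    by exists u; apply: ballxx; rewrite ltcR.
  exists (A x + x); rewrite A1_invK //.
  by move: ux; rewrite -ball_normE /= norm_hnorm ltcR.
exists (mu 0%N) => // n; rewrite lerD2r lef_pV2 ?posrE //.
exact: (eigen_val_noninc norm_dot A1_inv_lin A1_inv_sym A1_inv_pos A1_inv_contr
  A1_inv_inj A1_inv_compact A1_infinite_dim).
Qed.

End Eigenbasis.

(** * Fractional powers in the coordinates of an eigenbasis *)

Section SpectralCalculus.
Variables (R : realType) (H : completeNormedModType R[i]).
Variable dot : {dot H for (@Num.conj R[i])}.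
Hypothesis norm_dot : forall u : H, `|u| ^+ 2 = dot u u.
Variables (domA : set H) (A : H -> H).
Hypothesis A_linear : linear_on domA A.
Hypothesis A_self_adjoint : self_adjoint dot domA A.
Hypothesis A_positive : positive_definite dot domA A.
Local Open Scope complex_scope.
Implicit Types u v w x : H.
Notation hn := (@hnorm R H).

Variables (e : nat -> H) (mu : nat -> R).
Hypothesis eb : eigenbasis dot domA A e mu.
Notation coef := (coef dot e).

Definition sqsum (c : nat -> R[i]) N : R := \sum_(i < N) cmod (c i) ^+ 2.

Definition l2 (c : nat -> R[i]) := exists M, forall N, sqsum c N <= M.

Let orth i j : dot (e i) (e j) = (i == j)%:R. Proof. by case: eb. Qed.
Let orthN N i j (_ : (i < N)%N) (_ : (j < N)%N) := orth i j.

Lemma sqsum_nondec c : {homo sqsum c : m n / (m <= n)%N >-> m <= n}.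
Proof.
apply/nondecreasing_seqP => n; rewrite /sqsum big_ord_recr /= lerDl.
exact: sqr_ge0.
Qed.

Lemma coef_lin a u v n : coef (a *: u + v) n = a * coef u n + coef v n.
Proof. by rewrite /coef dotDl dotZl. Qed.
Lemma coefZ a u n : coef (a *: u) n = a * coef u n.
Proof. by rewrite /coef dotZl. Qed.
Lemma coefD u v n : coef (u + v) n = coef u n + coef v n.
Proof. by rewrite /coef dotDl. Qed.
Lemma coefN u n : coef (- u) n = - coef u n.
Proof. by rewrite /coef dotNl. Qed.


Lemma psum_cvg u : psum dot e u @ \oo --> u.
Proof.
have [_ _ /(_ u)] := eb; suff -> : series (fun n => dot u (e n) *: e n) = psum dot e u by [].
by apply/funext => N; rewrite /series /= big_mkord.
Qed.

Lemma parseval u : sqsum (coef u) @ \oo --> hn u ^+ 2.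
Proof.
apply/cvgrPdist_lt => d d0.
have [N HN] := (cvg_hnorm _ _).1 (@psum_cvg u) (Num.min 1 d) ltac:(by rewrite lt_min ltr01).
exists N => // n /= /HN; rewrite hnorm_distC lt_min => /andP[h1 hd].
have := psum_pythagoras norm_dot (@orthN n) u; rewrite -/(sqsum _ _) => <-.
rewrite ger0_norm ?sqr_ge0 // (le_lt_trans _ hd) // expr2 ler_piMl ?hnorm_ge0 //.
exact: ltW.
Qed.

Lemma bessel u N : sqsum (coef u) N <= hn u ^+ 2.
Proof.
have /cvgP cu := @parseval u.
rewrite -(cvg_lim (@Rhausdorff R) (@parseval u)).
exact: (nondecreasing_cvgn_le (@sqsum_nondec _)).
Qed.

Lemma coef_l2 u : l2 (coef u).
Proof. by exists (hn u ^+ 2) => N; exact: bessel. Qed.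

Lemma coef_inj u v : (forall n, coef u n = coef v n) -> u = v.
Proof.
move=> uv; apply/eqP; rewrite -subr_eq0; apply/eqP/hnorm_eq0/eqP.
rewrite -sqrf_eq0 -(cvg_lim (@Rhausdorff R) (@parseval (u - v))).
rewrite (_ : sqsum _ = cst 0) ?lim_cst //.
apply/funext => N; rewrite /sqsum big1 //= => i _.
by rewrite coefD coefN uv subrr cmod0 expr0n.
Qed.

Lemma coef_cvg (f : nat -> H) w n : f @ \oo --> w -> forall d : R, 0 < d ->
  exists N, forall m, (N <= m)%N -> cmod (coef (f m) n - coef w n) < d.
Proof.
move=> fw d /(dot_cvgr norm_dot (e n) fw)[N HN]; exists N => m /HN.
by rewrite /coef (dotC _ (f m)) (dotC _ w) -rmorphB cmodJ.
Qed.

Lemma riesz_fischer c : l2 c -> exists w, forall n, coef w n = c n.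
Proof.
move=> [M cM]; pose f N := \sum_(i < N) c i *: e i.
have fS m n : (m <= n)%N -> hn (f n - f m) ^+ 2 = sqsum c n - sqsum c m.
  move=> mn; have -> : f m = psum dot e (f n) m.
    apply: eq_bigr => i _; rewrite (coef_sum (@orthN n)) //.
    exact: leq_trans (ltn_ord i) mn.
  rewrite (psum_pythagoras norm_dot (@orthN m)) (hnorm_sum_sq norm_dot (@orthN n)).
  congr (_ - _); apply: eq_bigr => i _; rewrite (coef_sum (@orthN n)) //.
  exact: leq_trans (ltn_ord i) mn.
have cc : cvgn (sqsum c).
  apply: (nondecreasing_is_cvgn (@sqsum_nondec c)).
  by exists M => _ [N _ <-].
have [w fw] : exists w : H, f @ \oo --> w.
  apply: hcomplete => d d0.
  have d20 : 0 < d ^+ 2 / 2 by rewrite divr_gt0 ?exprn_gt0.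
  have /cvgrPdist_lt/(_ _ d20)[N _ HN] := cc.
  have half m n : (N <= m)%N -> (m <= n)%N -> hn (f n - f m) < d.
    move=> Nm mn; rewrite -(@ltr_pXn2r _ 2) ?nnegrE ?hnorm_ge0 ?(ltW d0) // fS //.
    have /ltr_normlP[h1 h2] := HN m Nm.
    have /ltr_normlP[h3 h4] := HN n (leq_trans Nm mn).
    lra.
  exists N => m n Nm Nn; have [mn|/ltnW nm] := leqP m n.
    by rewrite hnorm_distC half.
  exact: half.
exists w => n; apply/eqP; rewrite -subr_eq0; apply/eqP/cmod_small_eq0 => d d0.
have [N HN] := coef_cvg n fw d0.
have := HN (maxn N n.+1) (leq_maxl _ _).
rewrite (coef_sum (@orthN (maxn N n.+1))) ?leq_maxr // => /ltW.
by rewrite -cmodN opprB.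
Qed.

Variable delta : R.
Hypothesis delta0 : 0 < delta.
Hypothesis mu_ge : forall n, delta <= mu n.

Lemma mu_gt0 n : 0 < mu n. Proof. exact: lt_le_trans (mu_ge n). Qed.

Lemma coef_A u n : domA u -> coef (A u) n = (mu n)%:C * coef u n.
Proof.
move=> du; have [_ /(_ n)[de Ae] _] := eb.
by rewrite /coef (A_sym A_self_adjoint du de) Ae dotZr conjCR.
Qed.

(** The graph allows any eigenbasis; this reduces it to the fixed one. Eigenvectors e'_k and e_m
    that are not orthogonal share their eigenvalue, so in coordinate m each mu'_k^s may be replaced
    by mu_m^s. *)
Lemma fpow_graphP s u w :
  fpow_graph dot domA A s u w <-> forall n, coef w n = (mu n `^ s)%:C * coef u n.
Proof.
split=> [[e' [mu' [eb' h]]] m|h]; last first.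
  exists e, mu; split => //.
  have [_ _ /(_ w)] := eb.
  suff -> : (fun n => dot w (e n) *: e n) =
            (fun n => ((mu n `^ s)%:C * dot u (e n)) *: e n) by [].
  by apply/funext => n; rewrite -/(coef w n) h.
have [_ ae' bas'] := eb'.
apply/eqP; rewrite -subr_eq0; apply/eqP/cmod_small_eq0 => d d0.
have t0 : 0 < 1 + mu m `^ s by rewrite ltr_pwDl ?powR_ge0.
have dt0 : 0 < d / (1 + mu m `^ s) by rewrite divr_gt0.
have [N1 H1] := coef_cvg m h dt0.
have [N2 H2] := coef_cvg m (bas' u) dt0.
have {}H1 := H1 (maxn N1 N2) (leq_maxl _ _).
have {}H2 := H2 (maxn N1 N2) (leq_maxr _ _).
move: H1 H2; rewrite /series /=; set n := maxn _ _.
have -> : coef (\sum_(0 <= k < n) ((mu' k `^ s)%:C * dot u (e' k)) *: e' k) m =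
   (mu m `^ s)%:C * coef (\sum_(0 <= k < n) dot u (e' k) *: e' k) m.
  rewrite /coef !dot_suml mulr_sumr; apply: eq_bigr => k _.
  rewrite !dotZl; have [de Ae] := ae' k.
  have [ek0|ek0] := eqVneq (dot (e' k) (e m)) 0; first by rewrite ek0 !mulr0.
  suff -> : mu' k = mu m by rewrite mulrA.
  apply: (@complexI R); apply: (mulIf ek0).
  by rewrite -(coef_A m de) /coef Ae dotZl.
move: (coef _ m) => z h1 h2.
have -> : coef w m - (mu m `^ s)%:C * coef u m =
  - ((mu m `^ s)%:C * z - coef w m) + (mu m `^ s)%:C * (z - coef u m) by ring.
rewrite (le_trans (cmodD _ _)) // cmodN cmodM cmodR ger0_norm ?powR_ge0 //.
have : mu m `^ s * cmod (z - coef u m) <= mu m `^ s * (d / (1 + mu m `^ s)).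
  by rewrite ler_wpM2l ?powR_ge0 // ltW.
have : d = d / (1 + mu m `^ s) + mu m `^ s * (d / (1 + mu m `^ s)).
  by field; rewrite gt_eqF.
move: (mu m `^ s * (d / (1 + mu m `^ s))) => y; lra.
Qed.

Lemma fpow_domP s u :
  fpow_dom dot domA A s u <-> l2 (fun n => (mu n `^ s)%:C * coef u n).
Proof.
split=> [[w /fpow_graphP h]|/riesz_fischer[w h]]; last by exists w; apply/fpow_graphP.
have [M HM] := coef_l2 w; exists M => N; apply: le_trans (HM N).
by apply: ler_sum => i _; rewrite h.
Qed.

Lemma coef_fpow s u n : fpow_dom dot domA A s u ->
  coef (fpow dot domA A s u) n = (mu n `^ s)%:C * coef u n.
Proof.
move=> [w hw]; rewrite /fpow; case: xgetP => [v _|/(_ w) //].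
by move/fpow_graphP.
Qed.

Lemma l2_le (c d : nat -> R[i]) (C : R) :
  (forall n, cmod (c n) <= C * cmod (d n)) -> l2 d -> l2 c.
Proof.
move=> cd [M HM]; exists (C ^+ 2 * M) => N.
apply: (@le_trans _ _ (C ^+ 2 * sqsum d N)); last by rewrite ler_wpM2l ?sqr_ge0.
rewrite mulr_sumr; apply: ler_sum => i _; rewrite -exprMn ler_pXn2r ?nnegrE ?cmod_ge0 //.
exact: le_trans (cmod_ge0 _) (cd i).
Qed.

Lemma l2D (c d : nat -> R[i]) : l2 c -> l2 d -> l2 (fun n => c n + d n).
Proof.
move=> [M HM] [M' HM']; exists (2 * M + 2 * M') => N.
apply: (@le_trans _ _ (2 * sqsum c N + 2 * sqsum d N)).
  rewrite !mulr_sumr -big_split /=; apply: ler_sum => i _.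
  have : cmod (c i + d i) ^+ 2 <= (cmod (c i) + cmod (d i)) ^+ 2.
    by rewrite ler_pXn2r ?nnegrE ?addr_ge0 ?cmod_ge0 // cmodD.
  have := sqr_ge0 (cmod (c i) - cmod (d i)); rewrite sqrrB sqrrD; lra.
by have := HM N; have := HM' N; lra.
Qed.

(** Monotonicity in the exponent, applied to mu / delta >= 1. The spectral gap thus makes higher
    powers dominate lower ones and negative powers bounded. *)
Lemma powR_dom_le s t n : t <= s -> mu n `^ t <= delta `^ (t - s) * mu n `^ s.
Proof.
move=> ts; have -> : mu n `^ t = mu n `^ (t - s) * mu n `^ s.
  by rewrite -powRD ?subrK //; apply/implyP => _; rewrite gt_eqF ?mu_gt0.
rewrite ler_wpM2r ?powR_ge0 //.
have st : 0 <= s - t by rewrite subr_ge0.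
rewrite -(opprB s t) !powRN lef_pV2 ?posrE ?powR_gt0 ?mu_gt0 //.
by rewrite ge0_ler_powR ?nnegrE ?(ltW delta0) ?(ltW (mu_gt0 n)).
Qed.

Lemma fpow_dom_le s t u : t <= s ->
  fpow_dom dot domA A s u -> fpow_dom dot domA A t u.
Proof.
move=> ts /fpow_domP us; apply/fpow_domP.
apply: (l2_le (C := delta `^ (t - s))) us => n.
rewrite !cmodM !cmodR !ger0_norm ?powR_ge0 // mulrA ler_wpM2r ?cmod_ge0 //.
exact: powR_dom_le.
Qed.

Lemma fpow_dom_np s u : s <= 0 -> fpow_dom dot domA A s u.
Proof.
move=> s0; apply: (fpow_dom_le s0); apply/fpow_domP.
apply: (l2_le (C := 1)) (coef_l2 u) => n.
by rewrite powRr0 cmodM cmodR normr1 !mul1r.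
Qed.

(** For the converse, A + I is onto: the preimage of A^1 u + u lies in [domA] and has the
    coefficients of [u], since both are multiplied by mu + 1. *)
Lemma domA_fpow u : domA u <-> fpow_dom dot domA A 1 u.
Proof.
have m0 n := mu_gt0 n.
split=> [du|du].
  by exists (A u); apply/fpow_graphP => n; rewrite coef_A // powRr1 ?ltW.
have [d1 e1] := A1_invP norm_dot A_linear A_self_adjoint A_positive
  (fpow dot domA A 1 u + u).
suff <- : A1_inv domA A (fpow dot domA A 1 u + u) = u by [].
apply: coef_inj => n; have := congr1 (fun z => coef z n) e1.
rewrite !coefD coef_A // coef_fpow // powRr1 ?ltW //.
rewrite -[X in _ + X = _]mul1r -[X in _ = _ + X]mul1r -!mulrDl.
apply: mulfI; rewrite -(rmorphD (real_complex R) _ 1) /= gt_eqF // ltcR.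
by rewrite addr_gt0.
Qed.

End SpectralCalculus.

(** * Gevrey class of smoothing semigroups *)

Section GevreyArithmetic.
Variable R : realType.

Lemma exprn_le_expR_fact (x : R) n : 0 <= x -> x ^+ n <= expR x * n`!%:R.
Proof.
move=> x0; case: n => [|n].
  by rewrite expr0 mulr1 (le_trans _ (expR_ge1Dx x)) // lerDl.
rewrite -ler_pdivrMr ?ltr0n ?fact_gt0 //.
by apply: le_trans (expR_ge1Dxn n x0); rewrite lerDr.
Qed.

(** (n + 1)^n <= e^(n+1) n! turns the left side into a geometric factor times (n!)^b, and the spare
    (n!)^(s-b) beats any geometric growth; this is where s > b is used and why [m] can be
    arbitrarily small. *)
Lemma gevrey_bound (b s B m : R) : 0 <= b -> b < s -> 0 < B -> 0 < m ->
  exists2 C, 0 < C & forall n : nat,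
    B ^+ n * ((n.+1%:R ^+ n) `^ b) <= C * m ^+ n * (n`!%:R `^ s).
Proof.
move=> b0 bs B0 m0; pose E : R := expR 1.
have E0 : 0 < E by rewrite expR_gt0.
(* All geometric factors, including 1/m, are collected in [Q]; [y] is the number with y^(s-b) = Q,
   so that Q^n = (y^n)^(s-b) <= (e^y n!)^(s-b). *)
pose Q := B * E `^ b / m.
have Q0 : 0 < Q by rewrite !(mulr_gt0, divr_gt0, invr_gt0, powR_gt0).
have sb0 : 0 < s - b by rewrite subr_gt0.
pose y := Q `^ (s - b)^-1.
exists (E `^ b * expR y `^ (s - b)).
  by rewrite mulr_gt0 ?powR_gt0 ?expR_gt0.
move=> n; have f0 : 0 < n`!%:R :> R by rewrite ltr0n fact_gt0.
have h1 : (n.+1%:R ^+ n) `^ b <= E `^ b * (E `^ b) ^+ n * (n`!%:R `^ b).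
  have -> : E `^ b * (E `^ b) ^+ n * n`!%:R `^ b = (expR n.+1%:R * n`!%:R) `^ b.
    have -> : expR n.+1%:R = E ^+ n.+1 by rewrite /E -expRM_natl mulr1.
    rewrite (powRM _ (exprn_ge0 _ (ltW E0)) (ltW f0)) -exprS; congr (_ * _).
    rewrite -(powR_mulrn n.+1 (powR_ge0 E b)) -(powR_mulrn n.+1 (ltW E0)).
    exact: powRAC.
  apply: (ge0_ler_powR b0); rewrite ?nnegrE.
  - by rewrite exprn_ge0.
  - by rewrite mulr_ge0 ?expR_ge0 ?(ltW f0).
  - by rewrite exprn_le_expR_fact.
have h2 : Q ^+ n <= expR y `^ (s - b) * n`!%:R `^ (s - b).
  have -> : Q = y `^ (s - b).
    by rewrite /y -powRrM mulVf ?gt_eqF // powRr1 ?(ltW Q0).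
  have y0 : 0 <= y by exact: powR_ge0.
  rewrite -(powR_mulrn n (powR_ge0 y _)) powRAC (powR_mulrn n y0).
  rewrite -(powRM _ (expR_ge0 y) (ltW f0)).
  apply: (ge0_ler_powR (ltW sb0)); rewrite ?nnegrE.
  - by rewrite exprn_ge0.
  - by rewrite mulr_ge0 ?expR_ge0 ?(ltW f0).
  - by rewrite exprn_le_expR_fact.
apply: (@le_trans _ _ (B ^+ n * (E `^ b * (E `^ b) ^+ n * (n`!%:R `^ b)))).
  by rewrite ler_wpM2l ?exprn_ge0 ?(ltW B0).
have -> : B ^+ n * (E `^ b * (E `^ b) ^+ n * n`!%:R `^ b) =
  E `^ b * m ^+ n * (n`!%:R `^ b) * Q ^+ n.
  rewrite /Q !exprMn exprVn; have : m ^+ n != 0 by rewrite expf_neq0 ?gt_eqF.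
  by move=> mn0; field.
have -> : E `^ b * expR y `^ (s - b) * m ^+ n * n`!%:R `^ s =
  E `^ b * m ^+ n * (n`!%:R `^ b) * (expR y `^ (s - b) * n`!%:R `^ (s - b)).
  have -> : n`!%:R `^ s = n`!%:R `^ b * n`!%:R `^ (s - b) :> R.
    by rewrite -powRD ?subrKC //; apply/implyP => _; rewrite gt_eqF.
  move: (E `^ b) (m ^+ n) (_ `^ b) (_ `^ _) (_ `^ _) => x1 x2 x3 x4 x5; ring.
apply: ler_wpM2l => //; apply: mulr_ge0; last exact: powR_ge0.
by apply: mulr_ge0; [exact: powR_ge0|exact/exprn_ge0/ltW].
Qed.

End GevreyArithmetic.

(** * Derivatives of a contraction semigroup that maps into the domain *)

Section Semigroup.
Variables (R : realType) (V : lmodType R[i]) (X : set V) (N : V -> R).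
Local Open Scope complex_scope.
Implicit Types u v w : V.

Hypothesis X0 : X 0.
Hypothesis X_lin : forall a u v, X u -> X v -> X (a *: u + v).
Hypothesis N_ge0 : forall u, 0 <= N u.
Hypothesis N_scale : forall a u, X u -> N (a *: u) <= cmod a * N u.
Hypothesis N_add : forall u v, X u -> X v -> N (u + v) <= N u + N v.

Lemma X_add u v : X u -> X v -> X (u + v).
Proof. by move=> Xu Xv; rewrite -[u]scale1r; exact: X_lin. Qed.
Lemma X_scale a u : X u -> X (a *: u).
Proof. by move=> Xu; rewrite -[_ *: _]addr0; exact: X_lin. Qed.
Lemma X_opp u : X u -> X (- u).
Proof. by move=> Xu; rewrite -scaleN1r; exact: X_scale. Qed.
Lemma X_sub u v : X u -> X v -> X (u - v).
Proof. by move=> Xu Xv; exact: X_add (X_opp Xv). Qed.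

Lemma N_opp u : X u -> N (- u) <= N u.
Proof.
by move=> Xu; rewrite -scaleN1r (le_trans (N_scale _ Xu)) // cmodN cmod1 mul1r.
Qed.

Lemma N_scaleR (t : R) u : 0 <= t -> X u -> N (t%:C *: u) <= t * N u.
Proof.
by move=> t0 Xu; rewrite (le_trans (N_scale _ Xu)) // cmodR ger0_norm.
Qed.
Lemma N_zero : N 0 = 0.
Proof.
apply/eqP; rewrite eq_le N_ge0 andbT -[0](scale0r (0 : V)).
by rewrite (le_trans (N_scale _ X0)) // cmod0 mul0r.
Qed.

Lemma opnorm_le (T : V -> V) (C : R) : 0 <= C ->
  (forall u, X u -> N (T u) <= C * N u) -> (opnorm X N T <= C%:E)%E.
Proof.
move=> C0 TC; apply: ge_ereal_sup => _ [u [Xu u1] <-]; rewrite lee_fin.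
by rewrite (le_trans (TC u Xu)) // ler_piMr.
Qed.

Variables (D : set V) (T : V -> V) (S : R -> V -> V).
Hypothesis S_semigroup : C0_semigroup X N S.
Hypothesis S_contr : contractive X N S.
Hypothesis S_gen : is_generator X N D T S.

Lemma S_le t u : 0 <= t -> X u -> N (S t u) <= N u.
Proof. by move: S_contr => h t0 Xu; apply: (h t u). Qed.
Lemma S_X t u : 0 <= t -> X u -> X (S t u).
Proof. by move=> t0 Xu; have [/(_ t t0)[h _ _] _ _ _] := S_semigroup; exact: h. Qed.
Lemma S_lin t a u v : 0 <= t -> X u -> X v -> S t (a *: u + v) = a *: S t u + S t v.
Proof.
move=> t0 Xu Xv; have [/(_ t t0)[_ [_ h] _] _ _ _] := S_semigroup.
by case: (h a u v Xu Xv).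
Qed.
Lemma S_zero u : X u -> S 0 u = u.
Proof. by have [_ h _ _] := S_semigroup; exact: h. Qed.
Lemma S_plus s t u : 0 <= s -> 0 <= t -> X u -> S (s + t) u = S s (S t u).
Proof. by have [_ _ h _] := S_semigroup; exact: h. Qed.
Lemma S_0 t : 0 <= t -> S t 0 = 0.
Proof.
move=> t0; have := S_lin (-1) t0 X0 X0.
by rewrite scaler0 addr0 scaleN1r addNr.
Qed.
Lemma S_scale t a u : 0 <= t -> X u -> S t (a *: u) = a *: S t u.
Proof. by move=> t0 Xu; rewrite -[a *: u]addr0 S_lin // S_0 // addr0. Qed.
Lemma S_sub t u v : 0 <= t -> X u -> X v -> S t (u - v) = S t u - S t v.
Proof.
by move=> t0 Xu Xv; rewrite -[- v]scaleN1r addrC S_lin // scaleN1r addrC.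
Qed.

Lemma D_X u : D u -> X u. Proof. by case: S_gen => + _ _; apply. Qed.
Lemma T_X u : D u -> X (T u). Proof. by case: S_gen => _ + _; apply. Qed.

Lemma cvg_right0P (f : R -> R) : (f h @[h --> 0^'+] --> (0 : R)) <->
  (forall eps, 0 < eps -> exists2 d, 0 < d & forall h, 0 < h -> h < d -> `|f h| < eps).
Proof.
split=> [fl eps e0|fl].
  have /cvgrPdist_lt/(_ _ e0)[d /= d0 Hd] := fl.
  exists d => // h h0 hd; have := Hd h; rewrite /= !sub0r !normrN gtr0_norm //.
  by apply.
apply/cvgrPdist_lt => eps /fl[d d0 Hd].
exists d => // h; rewrite /= !sub0r !normrN => hd h0; apply: Hd => //.
by move: hd; rewrite gtr0_norm.
Qed.

Definition quotient h u := (h^-1)%:C *: (S h u - u).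

Lemma X_quotient h u : 0 <= h -> X u -> X (quotient h u).
Proof. by move=> h0 Xu; apply: X_scale; apply: X_sub => //; exact: S_X. Qed.

Lemma generatorP u w : X u -> X w -> (D u /\ T u = w) <->
  (forall eps, 0 < eps -> exists2 d, 0 < d & forall h, 0 < h -> h < d ->
     N (quotient h u - w) < eps).
Proof.
move=> Xu Xw; have [_ _ /(_ u w Xu Xw) h] := S_gen.
split=> [/h /cvg_right0P hl eps /hl[d d0 Hd]|hl].
  by exists d => // k k0 /(Hd k k0); rewrite ger0_norm.
apply/h/cvg_right0P => eps /hl[d d0 Hd]; exists d => // k k0 kd.
by rewrite ger0_norm //; exact: Hd.
Qed.

Lemma T_linear a u v : D u -> D v -> D (a *: u + v) /\ T (a *: u + v) = a *: T u + T v.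
Proof.
move=> Du Dv; have [Xu Xv] := (D_X Du, D_X Dv); have [XTu XTv] := (T_X Du, T_X Dv).
apply/generatorP; [exact: X_lin|exact: X_lin|] => eps e0.
have c0 : 0 < cmod a + 1 by rewrite ltr_wpDl ?cmod_ge0.
have e10 : 0 < eps / 2 / (cmod a + 1) by rewrite !divr_gt0.
have e20 : 0 < eps / 2 by rewrite divr_gt0.
have [d1 d10 H1] := (generatorP Xu XTu).1 (conj Du erefl) _ e10.
have [d2 d20 H2] := (generatorP Xv XTv).1 (conj Dv erefl) _ e20.
exists (Num.min d1 d2); first by rewrite lt_min d10.
move=> h h0; rewrite lt_min => /andP[hd1 hd2].
have -> : quotient h (a *: u + v) - (a *: T u + T v) =
   a *: (quotient h u - T u) + (quotient h v - T v).
  rewrite /quotient S_lin ?ltW // opprD addrACA -scalerBr scalerDr.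
  by rewrite opprD addrACA scalerA mulrC -scalerA -!scalerBr.
have h0' := ltW h0.
have [Xq1 Xq2] : X (quotient h u - T u) /\ X (quotient h v - T v).
  by split; apply: X_sub => //; exact: X_quotient.
rewrite (le_lt_trans (N_add (X_scale a Xq1) Xq2)) //.
have h2 := H2 h h0 hd2; have := H1 h h0 hd1.
rewrite ltr_pdivlMr // mulrDr mulr1 => h1; have := N_scale a Xq1.
have := N_ge0 (quotient h u - T u); rewrite [cmod a * _]mulrC; lra.
Qed.

Lemma S_D t u : 0 <= t -> D u -> D (S t u) /\ T (S t u) = S t (T u).
Proof.
move=> t0 Du; have [Xu XTu] := (D_X Du, T_X Du).
apply/generatorP; [exact: S_X|exact: S_X|] => eps e0.
have [d d0 Hd] := (generatorP Xu XTu).1 (conj Du erefl) _ e0.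
exists d => // h h0 hd; apply: le_lt_trans (Hd h h0 hd).
have h0' := ltW h0; have Xq := X_quotient h0' Xu.
have -> : quotient h (S t u) - S t (T u) = S t (quotient h u - T u).
  have XS : X (S h u) by exact: S_X.
  rewrite S_sub // /quotient S_scale //; last exact: X_sub.
  rewrite S_sub //.
  by rewrite -!S_plus // (addrC h t).
by apply: S_le => //; exact: X_sub.
Qed.

(** No integral along the orbit is formed: [0, h] is cut into n equal steps so short that the
    difference quotient is close to T u, and contractivity lets the step errors add up. *)
Lemma S_lipschitz h u : 0 <= h -> D u -> N (S h u - u) <= h * N (T u).
Proof.
rewrite le_eqVlt => /predU1P[<- Du|h0 Du].
  by rewrite S_zero ?subrr ?N_zero ?mul0r //; exact: D_X.
have [Xu XTu] := (D_X Du, T_X Du).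
have sub (d : R) (n : nat) : 0 <= d -> N (S (n%:R * d) u - u) <= n%:R * N (S d u - u).
  move=> d0; elim: n => [|n IH]; first by rewrite !mul0r S_zero // subrr N_zero.
  have nd0 : 0 <= n%:R * d by rewrite mulr_ge0.
  have XSd : X (S d u) by exact: S_X.
  have -> : S (n.+1%:R * d) u - u = S (n%:R * d) (S d u - u) + (S (n%:R * d) u - u).
    by rewrite S_sub // -S_plus // -natr1 mulrDl mul1r addrA subrK.
  have Xd : X (S d u - u) by exact: X_sub.
  have X1 : X (S (n%:R * d) u - u) by apply: X_sub => //; exact: S_X.
  rewrite (le_trans (N_add (S_X nd0 Xd) X1)) //.
  by rewrite -natr1 mulrDl mul1r addrC lerD // S_le.
apply/ler_addgt0Pr => eps e0.
have [d d0 Hd] := (generatorP Xu XTu).1 (conj Du erefl) _ (divr_gt0 e0 h0).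
(* The successor makes the step h / n strictly shorter than d. *)
pose n := (Num.truncn (h / d)).+1.
have n0 : 0 < n%:R :> R by rewrite ltr0n.
have hn0 : 0 < h / n%:R by rewrite divr_gt0.
have hnd : h / n%:R < d.
  by rewrite ltr_pdivrMr // mulrC -ltr_pdivrMr // truncnS_gt.
have := sub (h / n%:R) n (ltW hn0).
rewrite [n%:R * _]mulrC divfK ?gt_eqF // => /le_trans; apply.
have Xq := X_quotient (ltW hn0) Xu.
have -> : S (h / n%:R) u - u = (h / n%:R)%:C *: ((quotient (h / n%:R) u - T u) + T u).
  by rewrite subrK /quotient scalerA -rmorphM mulfV ?gt_eqF //= scale1r.
have Xqt : X (quotient (h / n%:R) u - T u) by apply: X_sub.
have h1 := N_scaleR (ltW hn0) (X_add Xqt XTu).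
have h2 := N_add Xqt XTu.
have h3 := Hd _ hn0 hnd.
apply: (@le_trans _ _ (n%:R * (h / n%:R * (eps / h + N (T u))))).
  rewrite ler_wpM2l ?(ltW n0) // (le_trans h1) // ler_wpM2l ?(ltW hn0) //.
  by rewrite (le_trans h2) // lerD2r ltW.
by rewrite mulrA [n%:R * _]mulrC divfK ?gt_eqF // mulrDr [h * _]mulrC divfK ?gt_eqF // addrC.
Qed.

(** The same subdivision at second order: along the orbit the drift T u changes by at most h |T T
    u|, by [S_lipschitz]. The constant 1 in place of 1/2 is the price of freezing this bound on the
    whole interval. *)
Lemma S_taylor h u : 0 <= h -> D u -> D (T u) ->
  N (S h u - u - h%:C *: T u) <= h ^+ 2 * N (T (T u)).
Proof.
rewrite le_eqVlt => /predU1P[<- Du DTu|h0 Du DTu].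
  by rewrite S_zero ?subrr ?scale0r ?subr0 ?N_zero ?expr0n ?mul0r //; exact: D_X.
have [Xu XTu] := (D_X Du, T_X Du).
have sub (d : R) (n : nat) : 0 <= d -> n%:R * d <= h ->
    N (S (n%:R * d) u - u - (n%:R * d)%:C *: T u) <=
    n%:R * (N (S d u - u - d%:C *: T u) + d * (h * N (T (T u)))).
  move=> d0; elim: n => [|n IH] nd.
    by rewrite !mul0r S_zero // subrr scale0r subr0 N_zero.
  have nd0 : 0 <= n%:R * d by rewrite mulr_ge0.
  have XSd : X (S d u) by exact: S_X.
  have ndh : n%:R * d <= h.
    by rewrite (le_trans _ nd) // ler_wpM2r // ler_nat.
  have -> : S (n.+1%:R * d) u - u - (n.+1%:R * d)%:C *: T u =
     (S (n%:R * d) u - u - (n%:R * d)%:C *: T u) +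
     (S (n%:R * d) (S d u - u - d%:C *: T u) +
      d%:C *: (S (n%:R * d) (T u) - T u)).
    rewrite S_sub //; [|exact: X_sub|exact: X_scale].
    rewrite S_scale // scalerBr S_sub // -S_plus // -natr1 mulrDl mul1r.
    rewrite rmorphD scalerDl /= opprD [X in _ = _ + X]addrA subrK.
    by rewrite [in RHS]addrACA [X in _ = X + _]addrC [X in _ = X + _]addrA subrK.
  have Xd : X (S d u - u - d%:C *: T u).
    by apply: X_sub; [apply: X_sub => //; exact: S_X|exact: X_scale].
  have X1 : X (S (n%:R * d) (T u) - T u) by apply: X_sub => //; exact: S_X.
  have X2 : X (S (n%:R * d) u - u - (n%:R * d)%:C *: T u).
    by apply: X_sub; [apply: X_sub => //; exact: S_X|exact: X_scale].
  have X3 := X_scale d%:C X1; have X4 := S_X nd0 Xd.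
  rewrite (le_trans (N_add X2 (X_add X4 X3))) //.
  rewrite -natr1 mulrDl mul1r lerD ?IH // (le_trans (N_add X4 X3)) //.
  rewrite lerD ?S_le // (le_trans (N_scaleR d0 X1)) // ler_wpM2l //.
  by rewrite (le_trans (S_lipschitz nd0 DTu)) // ler_wpM2r.
apply/ler_addgt0Pr => eps e0.
have [d d0 Hd] := (generatorP Xu XTu).1 (conj Du erefl) _ (divr_gt0 e0 h0).
pose n := (Num.truncn (h / d)).+1.
have n0 : 0 < n%:R :> R by rewrite ltr0n.
have hn0 : 0 < h / n%:R by rewrite divr_gt0.
have hnd : h / n%:R < d.
  by rewrite ltr_pdivrMr // mulrC -ltr_pdivrMr // truncnS_gt.
have := sub (h / n%:R) n (ltW hn0).
rewrite [n%:R * (h / _)]mulrC divfK ?gt_eqF // => /(_ (lexx _))/le_trans; apply.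
have Xq := X_quotient (ltW hn0) Xu.
have -> : S (h / n%:R) u - u - (h / n%:R)%:C *: T u =
    (h / n%:R)%:C *: (quotient (h / n%:R) u - T u).
  by rewrite scalerBr /quotient scalerA -rmorphM mulfV ?gt_eqF //= scale1r.
have Xqt : X (quotient (h / n%:R) u - T u) by apply: X_sub.
have h1 := N_scaleR (ltW hn0) Xqt.
have h3 := Hd _ hn0 hnd.
apply: (@le_trans _ _ (n%:R * (h / n%:R * (eps / h) + h / n%:R * (h * N (T (T u)))))).
  by rewrite ler_wpM2l ?(ltW n0) // lerD2r (le_trans h1) // ler_wpM2l ?(ltW hn0) ?(ltW h3).
have -> : n%:R * (h / n%:R * (eps / h) + h / n%:R * (h * N (T (T u)))) =
  h ^+ 2 * N (T (T u)) + eps.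
  by field; rewrite !gt_eqF.
by [].
Qed.

(** For h < 0 the expansion is made forwards from the earlier time t + h >= 0. Replacing the
    derivative there by the one at t costs another h^2 |T T u|, whence the factor 2. *)
Lemma S_two_sided t h u : 0 < t -> `|h| <= t -> D u -> D (T u) ->
  N (S (t + h) u - S t u - h%:C *: T (S t u)) <= 2 * h ^+ 2 * N (T (T u)).
Proof.
move=> t0 ht Du DTu; have [Xu XTu] := (D_X Du, T_X Du); have XTTu := T_X DTu.
have [h0|h0] := leP 0 h.
  have XS : X (S h u) by exact: S_X.
  have Xw : X (S h u - u - h%:C *: T u).
    by apply: X_sub; [apply: X_sub => //; exact: S_X|exact: X_scale].
  have -> : S (t + h) u - S t u - h%:C *: T (S t u) = S t (S h u - u - h%:C *: T u).
    have t0' := ltW t0; have [_ ->] := S_D t0' Du.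
    rewrite [in RHS]S_sub //; [|exact: X_sub|exact: X_scale].
    by rewrite S_scale // [in RHS]S_sub // S_plus.
  rewrite (le_trans (S_le (ltW t0) Xw)) // (le_trans (S_taylor h0 Du DTu)) //.
  by rewrite -mulrA ler_peMl ?mulr_ge0 ?sqr_ge0 // ler1n.
pose k := - h; have k0 : 0 <= k by rewrite oppr_ge0 ltW.
have tk : 0 <= t - k by rewrite subr_ge0 /k -(ltr0_norm h0).
have hk : h = - k by rewrite opprK.
clearbody k; subst h; rewrite sqrrN.
pose w := S (t - k) u.
have [Dw Tw] := S_D tk Du; have [DTw TTw] := S_D tk DTu.
rewrite -Tw in DTw TTw; rewrite -/w in Dw DTw TTw Tw *.
have Xw := D_X Dw; have XTw := T_X Dw.
have Stw : S t u = S k w by rewrite /w -S_plus // subrKC.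
have [_ TSw] := S_D k0 Dw.
rewrite Stw TSw rmorphN scaleNr opprK.
have -> : w - S k w + k%:C *: S k (T w) =
  - (S k w - w - k%:C *: T w) + k%:C *: (S k (T w) - T w).
  by rewrite scalerBr !opprB [RHS]addrC [RHS]addrA subrK [RHS]addrC.
have X1 : X (S k w - w - k%:C *: T w).
  by apply: X_sub; [apply: X_sub => //; exact: S_X|exact: X_scale].
have X2 : X (S k (T w) - T w) by apply: X_sub => //; exact: S_X.
rewrite (le_trans (N_add (X_opp X1) (X_scale _ X2))) //.
have TTwu : N (T (T w)) <= N (T (T u)) by rewrite TTw; apply: S_le.
have h1 := le_trans (N_opp X1) (S_taylor k0 Dw DTw).
have h2 := le_trans (N_scaleR k0 X2) (ler_wpM2l k0 (S_lipschitz k0 DTw)).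
have h3 : k ^+ 2 * N (T (T w)) <= k ^+ 2 * N (T (T u)) by rewrite ler_wpM2l ?sqr_ge0.
rewrite mulrA -expr2 in h2; rewrite -mulrA; lra.
Qed.

Variables (C b : R).
Hypothesis C_gt0 : 0 < C.
Hypothesis b_ge0 : 0 <= b.
Hypothesis smoothing : forall t u, 0 < t -> t <= 1 -> X u ->
  D (S t u) /\ N (T (S t u)) <= C * t `^ (- b) * N u.

Lemma S_smooth t u : 0 < t -> X u -> D (S t u).
Proof.
move=> t0 Xu; have [t1|t1] := leP t 1; first by case: (smoothing t0 t1 Xu).
have t10 : 0 <= t - 1 by rewrite subr_ge0 ltW.
rewrite -(subrK 1 t) S_plus //; have [d _] := smoothing ltr01 (lexx _) Xu.
by case: (S_D t10 d).
Qed.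

(** The domain statement spends half of the time per application of T: T^(n+1) S(t) u is S(t/2)
    applied to a vector of X, and S(t/2) maps X into D. *)
Lemma iterT_S n r t u : 0 <= r -> 0 < t -> X u ->
  D (iter n T (S t u)) /\ iter n T (S (r + t) u) = S r (iter n T (S t u)).
Proof.
elim: n r t => [|n IH] r t r0 t0 Xu.
  by split; [exact: S_smooth|rewrite S_plus // ltW].
have [Dn e] := IH r t r0 t0 Xu; split; last first.
  by rewrite !iterS e; case: (S_D r0 Dn).
have t20 : 0 < t / 2 by rewrite divr_gt0.
have [Dh eh] := IH (t / 2) (t / 2) (ltW t20) t20 Xu.
rewrite -splitr in eh; rewrite iterS eh; have [_ ->] := S_D (ltW t20) Dh.
by apply: S_smooth => //; exact: T_X.
Qed.

(** Each T is paired with one factor S(d), and the remaining time t - n d >= 0 only contracts.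
    Leaving this slack lets one d serve a whole range of times. *)
Lemma iterT_bound n t d u : 0 < d -> d <= 1 -> n%:R * d <= t -> X u ->
  N (iter n T (S t u)) <= (C * d `^ (- b)) ^+ n * N u.
Proof.
move=> d0 d1; have c0 : 0 <= C * d `^ (- b) by rewrite mulr_ge0 ?powR_ge0 ?(ltW C_gt0).
elim: n t u => [|n IH] t u nt Xu.
  by rewrite mul0r in nt; rewrite expr0 mul1r; exact: S_le.
rewrite -natr1 mulrDl mul1r -lerBrDr in nt.
have nd : 0 <= n%:R * d by rewrite mulr_ge0 ?(ltW d0).
have t10 := le_trans nd nt; have [Du Nu] := smoothing d0 d1 Xu.
rewrite iterSr -(subrK d t) S_plus ?(ltW d0) //; have [_ ->] := S_D t10 Du.
rewrite (le_trans (IH _ _ nt (T_X Du))) // exprSr -mulrA ler_wpM2l //.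
exact: exprn_ge0.
Qed.

Lemma iterT_lin n t a u v : 0 < t -> X u -> X v ->
  iter n T (S t (a *: u + v)) = a *: iter n T (S t u) + iter n T (S t v).
Proof.
move=> t0 Xu Xv; elim: n => [|n IH]; first by rewrite S_lin // ltW.
have [Du _] := iterT_S n (lexx 0) t0 Xu; have [Dv _] := iterT_S n (lexx 0) t0 Xv.
by rewrite !iterS IH; case: (T_linear a Du Dv).
Qed.

Lemma iterT_bounded n t : 0 < t -> exists2 M, 0 <= M &
  forall u, X u -> N (iter n T (S t u)) <= M * N u.
Proof.
(* Dividing by n + 1 rather than n keeps the step meaningful for n = 0; the cap 1 is the range of
   [smoothing]. *)
move=> t0; pose d := Num.min 1 (t / n.+1%:R).
have d0 : 0 < d by rewrite lt_min ltr01 divr_gt0.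
exists ((C * d `^ (- b)) ^+ n).
  by rewrite exprn_ge0 // mulr_ge0 ?powR_ge0 ?(ltW C_gt0).
move=> u; apply: iterT_bound => //; first by rewrite ge_min lexx.
apply: (@le_trans _ _ (n.+1%:R * (t / n.+1%:R))).
  rewrite ler_pM ?ler_nat ?(ltW d0) //; by rewrite ge_min lexx orbT.
by rewrite mulrC divfK.
Qed.

(** The difference quotient is factored through time t / 2: S acts on w = T^n S(t/2) u, and the
    second-order remainder is governed by T T w, so the bounded operator T^(n+2) S(t/2) makes the
    convergence uniform in u. *)
Lemma iterT_derive n t : 0 < t ->
  is_op_derive X N (fun r u => iter n T (S r u)) t (fun u => iter n.+1 T (S t u)).
Proof.
move=> t0; have t20 : 0 < t / 2 by rewrite divr_gt0.
have [M M0 HM] := iterT_bounded n.+2 t20.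
pose q (h : R) u := (h^-1)%:C *: (iter n T (S (t + h) u) - iter n T (S t u))
  - iter n.+1 T (S t u).
have bound (h : R) : h != 0 -> `|h| <= t / 2 ->
    (opnorm X N (q h) <= (2 * `|h| * M)%:E)%E.
  move=> h0 ht; apply: opnorm_le => [|u Xu]; first by rewrite !mulr_ge0.
  pose w := iter n T (S (t / 2) u).
  have [Dw _] := iterT_S n (lexx 0) t20 Xu.
  have [DTw _] := iterT_S n.+1 (lexx 0) t20 Xu.
  have E r : 0 <= r -> iter n T (S (r + t / 2) u) = S r w.
    by move=> r0; have [_] := iterT_S n r0 t20 Xu.
  have th : 0 <= t / 2 + h by move: ht; rewrite ler_norml => /andP[]; lra.
  have := S_two_sided t20 ht Dw DTw.
  rewrite -(E _ th) -(E _ (ltW t20)) (addrAC (t / 2)) -!splitr.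
  rewrite -[T (iter n T (S t u))]/(iter n.+1 T (S t u)) => Hw.
  have Xt : X (iter n.+1 T (S t u)).
    by apply: D_X; case: (iterT_S n.+1 (lexx 0) t0 Xu).
  have Xt0 : X (iter n T (S t u)).
    by apply: D_X; case: (iterT_S n (lexx 0) t0 Xu).
  have Xth : X (iter n T (S (t + h) u)).
    by apply: D_X; case: (iterT_S n (lexx 0) (_ : 0 < t + h) Xu) => //; lra.
  have -> : q h u = (h^-1)%:C *: (iter n T (S (t + h) u) -
      iter n T (S t u) - h%:C *: iter n.+1 T (S t u)).
    by rewrite [in RHS]scalerBr scalerA -rmorphM mulVf //= scale1r.
  rewrite (le_trans (N_scale _ _)) //.
    by apply: X_sub; [exact: X_sub|exact: X_scale].
  rewrite cmodR normfV ler_pdivrMl ?normr_gt0 // (le_trans Hw) //.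
  have := HM u Xu; rewrite -/w -[iter n.+2 _ _]/(T (T w)) => h1.
  have -> : `|h| * (2 * `|h| * M * N u) = 2 * `|h| ^+ 2 * (M * N u) by ring.
  by rewrite real_normK ?num_real // ler_wpM2l // mulr_ge0 // sqr_ge0.
suff : opnorm X N (q h) @[h --> 0^'] --> 0%E by [].
apply: (@squeeze_cvge _ _ _ _ (cst 0%E) _ (fun h => (2 * `|h| * M)%:E)).
- near=> h; apply/andP; split; last first.
    apply: bound; first by near: h; exact: nbhs_dnbhs_neq.
    by rewrite ltW //; near: h; exact: dnbhs0_lt.
  apply: (@le_trans _ _ (N (q h 0))%:E); first by rewrite lee_fin.
  apply: ereal_sup_ubound; exists 0 => //=; split => //.
  by rewrite N_zero.
- exact: cvg_cst.
- apply: cvg_EFin; first by near=> h.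
  have : (fun h : R => 2 * `|h| * M) @ 0^' --> 2 * `|0 : R| * M.
    apply: cvgM; last exact: cvg_cst.
    apply: cvgM; first exact: cvg_cst.
    by apply: cvg_norm; exact: cvg_within.
  by rewrite normr0 mulr0 mul0r.
Unshelve. all: by end_near. Qed.

Theorem gevrey_of_smoothing s : b < s -> gevrey_class X N s 0 S.
Proof.
move=> bs; exists (fun n t u => iter n T (S t u)); split => //.
  move=> n t t0; split; last exact: iterT_derive.
  have [M M0 HM] := iterT_bounded n t0; split.
  - by move=> u /= Xu; apply: D_X; case: (iterT_S n (lexx 0) t0 Xu).
  - split=> // a u v Xu Xv; split; first exact: X_lin.
    exact: iterT_lin.
  - exact: le_lt_trans (opnorm_le M0 HM) (ltry _).
move=> K cK K0 m m0.
(* A positive lower bound of [K], capped at 1 because [smoothing] is available up to time 1 only.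
   The step t0 / (n + 1) then serves every t in [K]. *)
have [t0 t00 Kt0] : exists2 t0 : R, 0 < t0 <= 1 & forall t, K t -> t0 <= t.
  have [[x Kx]|/set0P/negP/negPn/eqP ->] := pselect (K !=set0); last first.
    by exists 1 => //; rewrite ltr01 lexx.
  have [||c /set_mem Kc cmin] := @compact_EVT_min R R id K _ cK.
  - by exists x.
  - by apply: continuous_subspaceT => y; exact: cvg_id.
  exists (Num.min c 1); first by rewrite lt_min (K0 _ Kc) ltr01 ge_min lexx orbT.
  by move=> t Kt; rewrite ge_min cmin ?inE.
have /andP[t0p t01] := t00.
have B0 : 0 < C * t0 `^ (- b) by rewrite mulr_gt0 ?powR_gt0.
have [c c0 Hc] := gevrey_bound b_ge0 bs B0 m0; exists c => // t n Kt.
apply: le_trans (_ : (((C * t0 `^ (- b)) ^+ n * (n.+1%:R ^+ n) `^ b)%:E <= _)%E); last first.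
  by rewrite lee_fin Hc.
have n10 : 0 < n.+1%:R :> R by rewrite ltr0n.
apply: opnorm_le => [|u Xu].
  by rewrite mulr_ge0 ?powR_ge0 // exprn_ge0 // ltW.
have d0 : 0 < t0 / n.+1%:R by rewrite divr_gt0.
have d1 : t0 / n.+1%:R <= 1.
  by rewrite ler_pdivrMr // mul1r (le_trans t01) // ler1n.
have nd : n%:R * (t0 / n.+1%:R) <= t.
  apply: le_trans (Kt0 t Kt); rewrite mulrCA ler_piMr ?(ltW t0p) //.
  by rewrite ler_pdivrMr // mul1r ler_nat.
rewrite (le_trans (iterT_bound d0 d1 nd Xu)) //.
have -> : (t0 / n.+1%:R) `^ (- b) = t0 `^ (- b) * n.+1%:R `^ b.
  rewrite powRM ?(ltW t0p) ?invr_ge0 ?ler0n //; congr (_ * _).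
  by rewrite -powR_inv1 ?ler0n // -powRrM mulN1r opprK.
rewrite mulrA exprMn; suff -> : (n.+1%:R `^ b) ^+ n = (n.+1%:R ^+ n) `^ b :> R by [].
by rewrite -(powR_mulrn n (powR_ge0 _ b)) -(powR_mulrn n (ltW n10)) powRAC.
Qed.

End Semigroup.

(** * Systems that decouple into 3 x 3 modes *)

Section RealCalculus.
Variable R : realType.

Lemma is_derive_quadratic (f : R -> R) (t l K d : R) : 0 < d ->
  (forall h, `|h| <= d -> `|f (t + h) - f t - h * l| <= K * h ^+ 2) ->
  is_derive t 1 f l.
Proof.
move=> d0 Hf; have K1 : 0 < `|K| + 1 by rewrite ltr_wpDl.
have lim : (fun h : R => h^-1 *: (f (h *: 1 + t) - f t)) @ 0^' --> l.
  apply/cvgrPdist_lt => eps e0; near=> h.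
  have h0 : h != 0 by near: h; exact: nbhs_dnbhs_neq.
  have hd : `|h| <= d by rewrite ltW //; near: h; exact: dnbhs0_lt.
  have he : `|h| < eps / (`|K| + 1).
    by near: h; apply: dnbhs0_lt; rewrite divr_gt0.
  rewrite -normrN opprB.
  have -> : h^-1 *: (f (h *: 1 + t) - f t) - l = h^-1 * (f (t + h) - f t - h * l).
    by rewrite /GRing.scale /= mulr1 [h + t]addrC; field.
  rewrite normrM normfV ltr_pdivrMl ?normr_gt0 //.
  rewrite (le_lt_trans (Hf h hd)) // -(real_normK (num_real h)) expr2 mulrCA.
  rewrite ltr_pM2l ?normr_gt0 //.
  rewrite ltr_pdivlMr // in he; apply: le_lt_trans he.
  rewrite mulrC ler_wpM2l //; apply: le_trans (ler_norm K) _.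
  by rewrite lerDl.
split; first by apply/cvg_ex; exists l.
exact/cvg_lim.
Unshelve. all: by end_near. Qed.

Lemma continuous_lipschitz (f : R -> R) (K : R) :
  (forall s t, `|f s - f t| <= K * `|s - t|) -> continuous f.
Proof.
move=> Hf x; have K1 : 0 < `|K| + 1 by rewrite ltr_wpDl.
apply/cvgrPdist_lt => eps e0.
near=> y; rewrite (le_lt_trans (Hf x y)) //.
have : `|x - y| < eps / (`|K| + 1).
  by near: y; apply: cvgr_dist_lt; [exact: cvg_id|rewrite divr_gt0].
rewrite ltr_pdivlMr // => h; apply: le_lt_trans h.
rewrite mulrC ler_wpM2l //; apply: le_trans (ler_norm K) _.
by rewrite lerDl.
Unshelve. all: by end_near. Qed.

(** Two limits in a fixed order: for fixed e the error d tends to 0, and only then e tends to 0. It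
    is applied with d a truncation error and e the parameter of Young's inequality. *)
Lemma real_le_limit (a K B : R) : 0 <= K -> 0 <= B ->
  (forall e d, 0 < e -> 0 < d -> a <= (1 + e) * K + (1 + e^-1) * (B * d)) -> a <= K.
Proof.
move=> K0 B0 H; apply/ler_addgt0Pr => d d0.
have K1 : 0 < 2 * (K + 1) by rewrite mulr_gt0 // ltr_wpDl.
pose e := d / (2 * (K + 1)).
have e0 : 0 < e by rewrite divr_gt0.
have e1 : 0 < 1 + e^-1 by rewrite addr_gt0 // invr_gt0.
have B1 : 0 < 2 * (B + 1) by rewrite mulr_gt0 // ltr_wpDl.
pose d' := d / ((1 + e^-1) * (2 * (B + 1))).
have d'0 : 0 < d' by rewrite divr_gt0 // mulr_gt0.
have := H e d' e0 d'0.
have h1 : e * K <= d / 2.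
  rewrite /e mulrAC ler_pdivrMr // (_ : d / 2 * _ = d * (K + 1)); last by field.
  by rewrite ler_pM2l // lerDl.
have h2 : (1 + e^-1) * (B * d') <= d / 2.
  have -> : (1 + e^-1) * (B * d') = d * B / (2 * (B + 1)).
    have B2 : 0 < B + 1 by rewrite ltr_wpDl.
    by rewrite /d'; move: (1 + e^-1) e1 => c c0; field; rewrite !gt_eqF.
  rewrite ler_pdivrMr // (_ : d / 2 * _ = d * (B + 1)); last by field.
  by rewrite ler_pM2l // lerDl.
by rewrite mulrDl mul1r; lra.
Qed.

End RealCalculus.

(** * The 3 x 3 matrix of one mode *)

Section Mode.
Variable R : realType.
Local Open Scope complex_scope.
Notation C3 := (R[i] * R[i] * R[i])%type.
Implicit Types x y : C3.

Definition nsq x : R := cmod x.1.1 ^+ 2 + cmod x.1.2 ^+ 2 + cmod x.2 ^+ 2.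

Definition mode (p q r : R) x : C3 :=
  (p%:C * x.1.2, q%:C * x.2 - p%:C * x.1.1, - (q%:C * x.1.2) - r%:C * x.2).

(** The squared norm of the image of a real vector (a, b, c). The matrix is real, so complex vectors
    split into real and imaginary parts. *)
Definition mode_sq (p q r a b c : R) : R :=
  (p * b) ^+ 2 + (q * c - p * a) ^+ 2 + (q * b + r * c) ^+ 2.

Lemma nsq_ge0 x : 0 <= nsq x.
Proof. by rewrite !addr_ge0 // sqr_ge0. Qed.

Lemma nsq0 : nsq 0 = 0.
Proof. by rewrite /nsq /= cmod0 expr0n !addr0. Qed.

Lemma nsq_eq0 x : nsq x <= 0 -> x = 0.
Proof.
case: x => [[a b] c]; rewrite /nsq /= => h.
move: (sqr_ge0 (cmod a)) (sqr_ge0 (cmod b)) (sqr_ge0 (cmod c)) => ha hb hc.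
suff: [/\ cmod a = 0, cmod b = 0 & cmod c = 0].
  by case=> /cmod_eq0 a0 /cmod_eq0 b0 /cmod_eq0 c0; rewrite a0 b0 c0.
by split; apply/eqP; rewrite -sqrf_eq0; apply/eqP; lra.
Qed.

Lemma nsqZ a x : nsq (a *: x) = cmod a ^+ 2 * nsq x.
Proof.
have e z : a *: z = a * z :> R[i] by [].
by rewrite /nsq /= !e !cmodM !exprMn -!mulrDr.
Qed.

Lemma cmodD_sq (z w : R[i]) e : 0 < e ->
  cmod (z + w) ^+ 2 <= (1 + e) * cmod z ^+ 2 + (1 + e^-1) * cmod w ^+ 2.
Proof.
move=> e0; have := cmodD z w; have := cmod_ge0 (z + w).
have := cmod_ge0 z; have := cmod_ge0 w.
move: (cmod z) (cmod w) (cmod (z + w)) => a b c b0 a0 c0 cab.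
have h1 : c ^+ 2 <= (a + b) ^+ 2.
  by rewrite !expr2; apply: ler_pM.
apply: le_trans h1 _; rewrite -subr_ge0.
have -> : (1 + e) * a ^+ 2 + (1 + e^-1) * b ^+ 2 - (a + b) ^+ 2 =
  (e * a - b) ^+ 2 / e by field; rewrite gt_eqF.
by rewrite divr_ge0 ?sqr_ge0 ?(ltW e0).
Qed.

Lemma nsqD x y e : 0 < e -> nsq (x + y) <= (1 + e) * nsq x + (1 + e^-1) * nsq y.
Proof.
move=> e0; have h1 := cmodD_sq x.1.1 y.1.1 e0.
have h2 := cmodD_sq x.1.2 y.1.2 e0; have h3 := cmodD_sq x.2 y.2 e0.
rewrite /nsq /= !mulrDr; lra.
Qed.

Lemma mode_lin p q r a x y : mode p q r (a *: x + y) = a *: mode p q r x + mode p q r y.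
Proof.
have e (z w : R[i]) : z *: w = z * w :> R[i] by [].
case: x => [[x1 x2] x3]; case: y => [[y1 y2] y3].
by rewrite /mode /=; congr (_, _, _); rewrite /= !e; ring.
Qed.

Lemma nsq_mode p q r x : nsq (mode p q r x) =
  mode_sq p q r (complex.Re x.1.1) (complex.Re x.1.2) (complex.Re x.2) +
  mode_sq p q r (complex.Im x.1.1) (complex.Im x.1.2) (complex.Im x.2).
Proof.
rewrite /nsq /mode_sq /= !cmod_sq !(ReD, ImD, ReN, ImN, ReZ, ImZ).
by ring.
Qed.

Lemma nsq_ReIm x : nsq x =
  (complex.Re x.1.1 ^+ 2 + complex.Re x.1.2 ^+ 2 + complex.Re x.2 ^+ 2) +
  (complex.Im x.1.1 ^+ 2 + complex.Im x.1.2 ^+ 2 + complex.Im x.2 ^+ 2).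
Proof. by rewrite /nsq !cmod_sq; ring. Qed.

Lemma mode_sq_le p q r a b c :
  mode_sq p q r a b c <= (2 * p ^+ 2 + 2 * q ^+ 2 + 2 * r ^+ 2 + p ^+ 2)
     * (a ^+ 2 + b ^+ 2 + c ^+ 2).
Proof.
rewrite /mode_sq; have := sqr_ge0 (q * c + p * a); have := sqr_ge0 (q * b - r * c).
have := mulr_ge0 (sqr_ge0 p) (sqr_ge0 a); have := mulr_ge0 (sqr_ge0 p) (sqr_ge0 b).
have := mulr_ge0 (sqr_ge0 p) (sqr_ge0 c); have := mulr_ge0 (sqr_ge0 q) (sqr_ge0 a).
have := mulr_ge0 (sqr_ge0 r) (sqr_ge0 a); have := mulr_ge0 (sqr_ge0 r) (sqr_ge0 b).
move=> *; lra.
Qed.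

Lemma nsq_mode_le p q r x : nsq (mode p q r x) <=
  (2 * p ^+ 2 + 2 * q ^+ 2 + 2 * r ^+ 2 + p ^+ 2) * nsq x.
Proof.
rewrite nsq_mode nsq_ReIm mulrDr; apply: lerD; exact: mode_sq_le.
Qed.

(** The determinant of z - M. The next definition is Cramer's rule, with the adjugate written
    out. *)
Definition mode_det (p q r : R) (z : R[i]) : R[i] :=
  z * (z * (z + r%:C) + q%:C ^+ 2) + p%:C ^+ 2 * (z + r%:C).

Definition mode_solve (p q r : R) (z : R[i]) (f : C3) : C3 :=
  let d := mode_det p q r z in
  let P := p%:C in let Q := q%:C in let s := z + r%:C in
  (((z * s + Q ^+ 2) * f.1.1 + P * s * f.1.2 + P * Q * f.2) / d,
   (- P * s * f.1.1 + z * s * f.1.2 + Q * z * f.2) / d,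
   (P * Q * f.1.1 - Q * z * f.1.2 + (z ^+ 2 + P ^+ 2) * f.2) / d).

Lemma mode_solveK p q r z f : mode_det p q r z != 0 ->
  z *: mode_solve p q r z f - mode p q r (mode_solve p q r z f) = f.
Proof.
have e (v w : R[i]) : v *: w = v * w :> R[i] by [].
case: f => [[f1 f2] f3] d0; rewrite /mode /mode_solve /=.
by congr (_, _, _); rewrite /= !e /mode_det; field; exact: d0.
Qed.

(** If the determinant vanished, (p s, z s, -q z) with s = z + r would be in the kernel of z - M,
    and its middle coordinate is not 0. *)
Lemma mode_det_neq0 p q r z : z != 0 -> z + r%:C != 0 ->
  (forall x, z *: x - mode p q r x = 0 -> x = 0) -> mode_det p q r z != 0.
Proof.
move=> z0 s0 inj; apply/eqP => d0.
have e (v w : R[i]) : v *: w = v * w :> R[i] by [].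
have /inj : z *: (p%:C * (z + r%:C), z * (z + r%:C), - q%:C * z) -
    mode p q r (p%:C * (z + r%:C), z * (z + r%:C), - q%:C * z) = 0.
  rewrite /mode /=; have -> : 0 = (0, 0, 0) :> C3 by [].
  congr (_, _, _); rewrite /= ?e; [ring| |ring].
  by rewrite -[RHS]d0 /mode_det; ring.
by case=> _ /eqP; rewrite mulf_eq0 (negPf z0) (negPf s0).
Qed.

End Mode.

(** Stated for arbitrary real solutions, continuous on the whole line but differentiable at positive
    times only: this is what the coordinates of an orbit, frozen at its initial value for t <= 0,
    provide. *)
Definition ode_estimate (R : realType) (p q r K b : R) :=
  forall y1 y2 y3 : R -> R,
  continuous y1 -> continuous y2 -> continuous y3 ->
  (forall t : R, 0 < t -> is_derive t 1 y1 (p * y2 t)) ->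
  (forall t : R, 0 < t -> is_derive t 1 y2 (q * y3 t - p * y1 t)) ->
  (forall t : R, 0 < t -> is_derive t 1 y3 (- (q * y2 t) - r * y3 t)) ->
  forall t : R, 0 < t -> t <= 1 ->
    mode_sq p q r (y1 t) (y2 t) (y3 t) <=
    (K * t `^ (- b)) ^+ 2 * (y1 0 ^+ 2 + y2 0 ^+ 2 + y3 0 ^+ 2).

(** * From uniform bounds on the modes to the whole system *)

Section ModalSystem.
Variables (R : realType) (V : lmodType R[i]) (X : set V) (N : V -> R).
Variables (D : set V) (T : V -> V).
Local Open Scope complex_scope.
Implicit Types u v w : V.
Notation C3 := (R[i] * R[i] * R[i])%type.

Variables (xc : nat -> V -> C3) (p q r : nat -> R).
Notation modal n := (mode (p n) (q n) (r n)).

Definition nsq_sum (x : nat -> C3) K : R := \sum_(i < K) nsq (x i).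
Definition nsq_summable (x : nat -> C3) := exists M, forall K, nsq_sum x K <= M.

Hypothesis X0 : X 0.
Hypothesis X_lin : forall a u v, X u -> X v -> X (a *: u + v).
Hypothesis N_ge0 : forall u, 0 <= N u.
Hypothesis xc_lin : forall n a u v, X u -> X v ->
  xc n (a *: u + v) = a *: xc n u + xc n v.
Hypothesis N_lim : forall u, X u -> nsq_sum (xc^~ u) @ \oo --> N u ^+ 2.
Hypothesis xc_surj : forall x, nsq_summable x -> exists2 u, X u & forall n, xc n u = x n.
Hypothesis xc_inj : forall u v, X u -> X v -> (forall n, xc n u = xc n v) -> u = v.
Hypothesis D_char : forall u, D u <-> X u /\ nsq_summable (fun n => modal n (xc n u)).
Hypothesis T_char : forall u, D u -> X (T u) /\ forall n, xc n (T u) = modal n (xc n u).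

Lemma nsq_sumS x k : nsq_sum x k.+1 = nsq_sum x k + nsq (x k).
Proof. by rewrite /nsq_sum big_ord_recr. Qed.

Lemma nsq_sum_nondec x : {homo nsq_sum x : m n / (m <= n)%N >-> m <= n}.
Proof.
apply/nondecreasing_seqP => n; rewrite /nsq_sum big_ord_recr /= lerDl.
exact: nsq_ge0.
Qed.

Lemma nsq_sum_le u K : X u -> nsq_sum (xc^~ u) K <= N u ^+ 2.
Proof.
move=> Xu; have cu := N_lim Xu; rewrite -(cvg_lim (@Rhausdorff R) cu).
by apply: (nondecreasing_cvgn_le (@nsq_sum_nondec _)); apply: cvgP cu.
Qed.

Lemma N_le u M : X u -> 0 <= M -> (forall K, nsq_sum (xc^~ u) K <= M ^+ 2) -> N u <= M.
Proof.
move=> Xu M0 h; rewrite -(@ler_pXn2r _ 2) ?nnegrE //.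
have cu := N_lim Xu; rewrite -(cvg_lim (@Rhausdorff R) cu).
by apply: limr_le; [apply: cvgP cu|near=> K; exact: h].
Unshelve. all: by end_near. Qed.

Lemma nsq_le u n : X u -> nsq (xc n u) <= N u ^+ 2.
Proof.
move=> Xu; apply: le_trans (nsq_sum_le n.+1 Xu).
by rewrite /nsq_sum big_ord_recr /= lerDr sumr_ge0 // => i _; exact: nsq_ge0.
Qed.

Lemma modal_X_scale a u : X u -> X (a *: u).
Proof. by move=> Xu; rewrite -[a *: u]addr0; exact: X_lin. Qed.
Lemma modal_X_add u v : X u -> X v -> X (u + v).
Proof. by move=> Xu Xv; rewrite -[u]scale1r; exact: X_lin. Qed.
Lemma modal_X_sub u v : X u -> X v -> X (u - v).
Proof.
by move=> Xu Xv; rewrite -scaleN1r addrC; exact: X_lin.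
Qed.

Lemma xc0 n : xc n 0 = 0.
Proof. by have := xc_lin n (-1) X0 X0; rewrite scaler0 addr0 scaleN1r addNr. Qed.
Lemma xcZ n a u : X u -> xc n (a *: u) = a *: xc n u.
Proof. by move=> Xu; have := xc_lin n a Xu X0; rewrite !addr0 xc0 addr0. Qed.
Lemma xcD n u v : X u -> X v -> xc n (u + v) = xc n u + xc n v.
Proof. by move=> Xu Xv; have := xc_lin n 1 Xu Xv; rewrite !scale1r. Qed.
Lemma xcB n u v : X u -> X v -> xc n (u - v) = xc n u - xc n v.
Proof.
by move=> Xu Xv; have := xc_lin n (-1) Xv Xu; rewrite !scaleN1r addrC => ->; rewrite addrC.
Qed.

Lemma modal_N_scale a u : X u -> N (a *: u) <= cmod a * N u.
Proof.
move=> Xu; apply: N_le; [exact: modal_X_scale|by rewrite mulr_ge0 ?cmod_ge0|] => K.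
rewrite exprMn; apply: le_trans (ler_wpM2l (sqr_ge0 _) (nsq_sum_le K Xu)).
by rewrite /nsq_sum mulr_sumr ler_sum // => i _; rewrite xcZ // nsqZ.
Qed.

(** Only a limit of modewise sums is known of the norm, so the triangle inequality comes from
    Young's inequality on each mode; the parameter b / a recombines the bounds exactly into (a +
    b)^2, and the e / 2 keeps a and b positive. *)
Lemma modal_N_add u v : X u -> X v -> N (u + v) <= N u + N v.
Proof.
move=> Xu Xv; apply/ler_addgt0Pr => e e0.
pose a := N u + e / 2; pose b := N v + e / 2.
have a0 : 0 < a by rewrite ltr_wpDl // divr_gt0.
have b0 : 0 < b by rewrite ltr_wpDl // divr_gt0.
have -> : N u + N v + e = a + b by rewrite /a /b addrACA -splitr.
apply: N_le; [exact: modal_X_add|by rewrite addr_ge0 ?(ltW a0) ?(ltW b0)|] => K.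
have t0 : 0 < b / a by rewrite divr_gt0.
apply: (@le_trans _ _ ((1 + b / a) * nsq_sum (xc^~ u) K
    + (1 + (b / a)^-1) * nsq_sum (xc^~ v) K)).
  rewrite /nsq_sum !mulr_sumr -big_split /= ler_sum // => i _; rewrite xcD //.
  exact: nsqD.
have h1 : nsq_sum (xc^~ u) K <= a ^+ 2.
  rewrite (le_trans (nsq_sum_le K Xu)) // ler_pXn2r ?nnegrE ?(ltW a0) //.
  by rewrite /a lerDl divr_ge0 // ltW.
have h2 : nsq_sum (xc^~ v) K <= b ^+ 2.
  rewrite (le_trans (nsq_sum_le K Xv)) // ler_pXn2r ?nnegrE ?(ltW b0) //.
  by rewrite /b lerDl divr_ge0 // ltW.
have -> : (a + b) ^+ 2 = (1 + b / a) * a ^+ 2 + (1 + (b / a)^-1) * b ^+ 2.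
  by field; rewrite !gt_eqF.
apply: lerD; apply: ler_wpM2l => //; rewrite addr_ge0 // ?invr_ge0 ltW //.
Qed.


Section Resolvent.
Variables (a C L : R).
Hypothesis C0 : 0 <= C.
Hypothesis L0 : 0 <= L.
Hypothesis r0 : forall n, 0 < r n.
Hypothesis mode_resolvent : forall n (l : R) x, L < `|l| ->
  (`|l| `^ a) ^+ 2 * nsq x <= C ^+ 2 * nsq (Complex 0 l *: x - modal n x).

(** The a priori bound yields everything: injectivity, hence a nonzero determinant in each mode,
    hence a solution by Cramer's rule, whose summability is again the bound. *)
Lemma modal_resolvent_limsup : (resolvent_limsup X N D T a < +oo)%E.
Proof.
rewrite /resolvent_limsup limf_esupE.
apply: (@le_lt_trans _ _ C%:E); last exact: ltry.
(* The upper limit is at most the supremum over the single neighbourhood |l| > L of infinity. *)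
apply: ereal_inf_le; eexists; first by exists [set l : R | L < `|l|]; [exists L|].
apply: ge_ereal_sup => _ [l /= Ll <-].
set z := Complex 0 l; pose f u := z *: u - T u.
have la0 : 0 < `|l| `^ a by rewrite powR_gt0 // (le_lt_trans L0).
have inj x n : z *: x - modal n x = 0 -> x = 0.
  move=> h; apply: nsq_eq0; have := mode_resolvent n x Ll; rewrite h nsq0 mulr0.
  by rewrite pmulr_rle0 // exprn_gt0.
have det n : mode_det (p n) (q n) (r n) z != 0.
  apply: mode_det_neq0; [| |by move=> x; exact: inj].
    rewrite eq_complex /= eqxx andTb -normr_gt0; exact: le_lt_trans Ll.
  by rewrite eq_complex /= add0r addr0 gt_eqF.
have fc u n : D u -> xc n (f u) = z *: xc n u - modal n (xc n u).
  move=> Du; have [Xu _] := (D_char u).1 Du; have [XT XTc] := T_char Du.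
  by rewrite xcB ?xcZ ?XTc //; exact: modal_X_scale.
have fX u : D u -> X (f u).
  move=> Du; have [Xu _] := (D_char u).1 Du; have [XT _] := T_char Du.
  by apply: modal_X_sub => //; exact: modal_X_scale.
have est u K : D u -> (`|l| `^ a) ^+ 2 * nsq_sum (xc^~ u) K <= C ^+ 2 * nsq_sum (xc^~ (f u)) K.
  move=> Du; rewrite /nsq_sum !mulr_sumr ler_sum // => i _; rewrite fc //.
  exact: mode_resolvent.
have bij : set_bij D X f.
  split.
  - by move=> u; exact: fX.
  - move=> u v /set_mem Du /set_mem Dv uv.
    have [Xu _] := (D_char u).1 Du; have [Xv _] := (D_char v).1 Dv.
    apply: xc_inj => // n; apply/eqP; rewrite -subr_eq0; apply/eqP/(inj _ n).
    have -> : modal n (xc n u - xc n v) = modal n (xc n u) - modal n (xc n v).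
      by rewrite -scaleN1r addrC mode_lin scaleN1r addrC.
    have -> : z *: (xc n u - xc n v) - (modal n (xc n u) - modal n (xc n v)) =
        xc n (f u) - xc n (f v).
      rewrite !fc // scalerBr !opprB addrACA [in RHS]addrACA; congr (_ + _).
      exact: addrC.
    by rewrite uv subrr.
  - move=> g Xg; pose x n := mode_solve (p n) (q n) (r n) z (xc n g).
    have xK n : z *: x n - modal n (x n) = xc n g by exact: mode_solveK.
    have xs : nsq_summable x.
      exists (C ^+ 2 * N g ^+ 2 / (`|l| `^ a) ^+ 2) => K.
      rewrite ler_pdivlMr ?exprn_gt0 // mulrC.
      apply: le_trans (ler_wpM2l (sqr_ge0 C) (nsq_sum_le K Xg)).
      rewrite /nsq_sum !mulr_sumr ler_sum // => i _; rewrite -xK.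
      exact: mode_resolvent.
    have [u Xu ux] := xc_surj xs.
    (* Membership in the domain needs no bound on the matrices: M x = z x - g is summable because x
       and g are. *)
    have Du : D u.
      apply/D_char; split => //; have [M HM] := xs.
      exists (2 * cmod z ^+ 2 * M + 2 * N g ^+ 2) => K.
      apply: (@le_trans _ _ (2 * cmod z ^+ 2 * nsq_sum x K + 2 * nsq_sum (xc^~ g) K)).
        rewrite /nsq_sum !mulr_sumr -big_split /= ler_sum // => i _; rewrite ux.
        have -> : modal i (x i) = z *: x i + (-1) *: xc i g.
          by rewrite -xK scaleN1r opprB addrC subrK.
        apply: le_trans (nsqD _ _ ltr01) _.
        by rewrite invr1 !nsqZ cmodN cmod1 expr1n mul1r mulrA.
      apply: lerD; last by rewrite ler_wpM2l ?nsq_sum_le.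
      by rewrite ler_wpM2l // mulr_ge0 // sqr_ge0.
    exists u => //; apply: xc_inj => //; first exact: fX.
    by move=> n; rewrite fc // ux xK.
have Rbound u : X u -> `|l| `^ a * N (resolvent D T z u) <= C * N u.
  move=> Xu; have [w Dw fw] := set_bij_surj bij Xu.
  have -> : resolvent D T z u = w.
    by rewrite -fw; exact: (@pinvKV _ _ (fun=> 0) _ _ (set_bij_inj bij) _ (mem_set Dw)).
  rewrite mulrC -ler_pdivlMr //.
  have [Xw _] := (D_char w).1 Dw.
  apply: N_le => // [|K]; first by rewrite divr_ge0 ?mulr_ge0 // ltW.
  rewrite expr_div_n ler_pdivlMr ?exprn_gt0 // mulrC.
  rewrite (le_trans (est w K Dw)) // exprMn ler_wpM2l ?sqr_ge0 // fw.
  exact: nsq_sum_le.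
have Rop : (opnorm X N (resolvent D T z) <= (C / `|l| `^ a)%:E)%E.
  apply: opnorm_le => [|u Xu]; first by rewrite divr_ge0 // ltW.
  by rewrite mulrAC ler_pdivlMr // mulrC; exact: Rbound.
rewrite /resolvent_norm asboolT; last first.
  by split => //; exact: le_lt_trans Rop (ltry _).
apply: (@le_trans _ _ ((`|l| `^ a)%:E * (C / `|l| `^ a)%:E)%E).
  by rewrite lee_wpmul2l // lee_fin ltW.
by rewrite -EFinM lee_fin mulrC divfK // gt_eqF.
Qed.

End Resolvent.

Section Smoothing.
Variable S : R -> V -> V.
Hypothesis S_semigroup : C0_semigroup X N S.
Hypothesis S_contr : contractive X N S.
Hypothesis S_gen : is_generator X N D T S.
Variables K b : R.
Hypothesis K0 : 0 <= K.
Hypothesis ode : forall n, ode_estimate (p n) (q n) (r n) K b.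

Let XB := modal_X_sub.
Let XZ := modal_X_scale.
Let DX u (Du : D u) : X u := ((D_char u).1 Du).1.

(** [phi] will be the real or imaginary part of a coordinate. The time Num.max t 0 extends the orbit
    continuously to negative times, where nothing is known of [S]; membership of [T u] in the domain
    supplies the quadratic remainder that gives the derivative. *)
Lemma modal_curve (phi : C3 -> R) n u :
  (forall x y, phi (x - y) = phi x - phi y) ->
  (forall (h : R) x, phi (h%:C *: x) = h * phi x) ->
  (forall x, phi x ^+ 2 <= nsq x) -> D u -> D (T u) ->
  continuous (fun t : R => phi (xc n (S (Num.max t 0) u))) /\
  forall t : R, 0 < t -> is_derive t 1 (fun t : R => phi (xc n (S (Num.max t 0) u)))
    (phi (modal n (xc n (S t u)))).
Proof.
move=> phiB phiZ phi_le Du DTu; have [XTu _] := T_char Du; have [XTTu _] := T_char DTu.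
have Xu := DX Du.
have phiN w : X w -> `|phi (xc n w)| <= N w.
  move=> Xw; rewrite -(@ler_pXn2r _ 2) ?nnegrE // real_normK ?num_real //.
  exact: le_trans (phi_le _) (nsq_le n Xw).
have lip s t : 0 <= s -> s <= t -> N (S t u - S s u) <= (t - s) * N (T u).
  move=> s0 st; have ts0 : 0 <= t - s by rewrite subr_ge0.
  have [Ds Ts] := S_D X0 X_lin N_ge0 S_semigroup S_contr S_gen s0 Du.
  have -> : S t u = S (t - s) (S s u).
    by rewrite -(S_plus S_semigroup) // subrK.
  apply: le_trans (S_lipschitz X0 X_lin N_ge0 modal_N_scale modal_N_add S_semigroup S_contr S_gen ts0 Ds) _.
  by rewrite Ts ler_wpM2l // (S_le S_contr).
split.
  apply: (@continuous_lipschitz _ _ (N (T u))) => s t.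
  wlog st : s t / s <= t.
    move=> H; have [st|/ltW ts] := leP s t; first exact: H.
    by rewrite distrC (distrC s); exact: H.
  have m0 (x : R) : 0 <= Num.max x 0 by rewrite le_max lexx orbT.
  have mm : Num.max s 0 <= Num.max t 0.
    by rewrite ge_max !le_max st lexx !orbT.
  have Xt (x : R) : X (S (Num.max x 0) u) by apply: (S_X S_semigroup).
  rewrite distrC -phiB -xcB //; apply: le_trans (phiN _ _) _; first exact: XB.
  apply: le_trans (lip _ _ (m0 s) mm) _; rewrite mulrC ler_wpM2l //.
  rewrite distrC ger0_norm ?subr_ge0 //.
  by move: mm; rewrite /Num.max; do 2 case: ltP => ?; lra.
move=> t t0; apply: (@is_derive_quadratic _ _ _ _ (2 * N (T (T u))) t t0) => h ht.
have th : 0 <= t + h by move: ht; rewrite ler_norml => /andP[]; lra.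
rewrite (max_l th) (max_l (ltW t0)).
have [Dt Tt] := S_D X0 X_lin N_ge0 S_semigroup S_contr S_gen (ltW t0) Du.
have [XTt xTt] := T_char Dt.
rewrite -xTt -phiZ -xcZ // -!phiB.
have X1 := S_X S_semigroup th Xu; have X2 := S_X S_semigroup (ltW t0) Xu.
rewrite -!xcB //; [|exact: XB|exact: XZ].
apply: le_trans (phiN _ _) _; first by apply: XB; [exact: XB|exact: XZ].
have := S_two_sided X0 X_lin N_ge0 modal_N_scale modal_N_add S_semigroup S_contr S_gen t0 ht Du DTu.
by rewrite mulrAC.
Qed.

Lemma modal_decay_regular n t u : 0 < t -> t <= 1 -> D u -> D (T u) ->
  nsq (modal n (xc n (S t u))) <= (K * t `^ (- b)) ^+ 2 * nsq (xc n u).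
Proof.
move=> t0 t1 Du DTu.
have Xu := DX Du; have S0u : S 0 u = u by rewrite (S_zero S_semigroup).
rewrite nsq_mode nsq_ReIm mulrDr.
have HR (g : R[i] -> R) : (forall z w : R[i], g (z - w) = g z - g w) ->
    (forall (h : R) (z : R[i]), g (h%:C * z) = h * g z) ->
    (forall z : R[i], g z ^+ 2 <= cmod z ^+ 2) ->
    mode_sq (p n) (q n) (r n) (g (xc n (S t u)).1.1) (g (xc n (S t u)).1.2)
       (g (xc n (S t u)).2) <= (K * t `^ (- b)) ^+ 2 *
    (g (xc n u).1.1 ^+ 2 + g (xc n u).1.2 ^+ 2 + g (xc n u).2 ^+ 2).
  move=> gB gZ gle.
  have gN (z : R[i]) : g (- z) = - g z.
    by have := gZ (-1) z; rewrite rmorphN1 !mulN1r.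
  have [c1 d1] := @modal_curve (fun x => g x.1.1) n u (fun x y => gB _ _)
    (fun h x => gZ _ _) ltac:(by move=> x; rewrite (le_trans (gle _)) // /nsq -addrA lerDl addr_ge0 // sqr_ge0) Du DTu.
  have [c2 d2] := @modal_curve (fun x => g x.1.2) n u (fun x y => gB _ _)
    (fun h x => gZ _ _) ltac:(by move=> x; rewrite (le_trans (gle _)) // /nsq addrAC lerDr addr_ge0 // sqr_ge0) Du DTu.
  have [c3 d3] := @modal_curve (fun x => g x.2) n u (fun x y => gB _ _)
    (fun h x => gZ _ _) ltac:(by move=> x; rewrite (le_trans (gle _)) // /nsq lerDr addr_ge0 // sqr_ge0) Du DTu.
  have := @ode n _ _ _ c1 c2 c3 _ _ _ t t0 t1.
  rewrite !maxxx S0u (max_l (ltW t0)); apply.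
  - by move=> s s0; rewrite (max_l (ltW s0)); have := d1 s s0; rewrite /mode /= gZ.
  - by move=> s s0; rewrite (max_l (ltW s0)); have := d2 s s0; rewrite /mode /= gB !gZ.
  - by move=> s s0; rewrite (max_l (ltW s0)); have := d3 s s0; rewrite /mode /= gB gN !gZ.
apply: lerD; apply: HR.
- by move=> z w; rewrite ReD ReN.
- by move=> h z; rewrite ReZ.
- by move=> z; rewrite cmod_sq lerDl sqr_ge0.
- by move=> z w; rewrite ImD ImN.
- by move=> h z; rewrite ImZ.
- by move=> z; rewrite cmod_sq lerDr sqr_ge0.
Qed.

Lemma finite_summable (x : nat -> C3) k : (forall i, (k <= i)%N -> x i = 0) -> nsq_summable x.
Proof.
move=> xk; exists (nsq_sum x k) => m.
have [mk|/ltnW km] := leqP m k; first exact: nsq_sum_nondec.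
rewrite -(subnKC km); elim: (m - k)%N => [|j IH]; first by rewrite addn0.
by rewrite addnS /nsq_sum big_ord_recr /= xk ?leq_addr // nsq0 addr0.
Qed.

Lemma mode0 n : modal n 0 = 0.
Proof. by have := mode_lin (p n) (q n) (r n) (-1) 0 0; rewrite scaler0 addr0 scaleN1r addNr. Qed.

(** Cutting off high modes lands in the domain of the squared generator, since a finite sum is
    summable under any matrices. The first [k0] modes are kept exactly, so that the bound obtained
    for [w] is already the one wanted for [u] in those modes. *)
Lemma truncation u (e : R) k0 : X u -> 0 < e -> exists w, [/\ D w, D (T w), X (u - w),
  N (u - w) ^+ 2 <= e & forall i, (i < k0)%N -> xc i w = xc i u].
Proof.
move=> Xu e0; have /cvgrPdist_lt/(_ _ e0)[k1 _ Hk1] := N_lim Xu.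
pose k := maxn k0 k1; pose x i := if (i < k)%N then xc i u else 0.
have x0 i : (k <= i)%N -> x i = 0 by rewrite /x ltnNge => ->.
have [w Xw wx] := xc_surj (finite_summable x0).
have Dw : D w.
  apply/D_char; split => //; apply: (@finite_summable _ k) => i ki.
  by rewrite wx x0 // mode0.
have DTw : D (T w).
  have [XTw Tx] := T_char Dw; apply/D_char; split => //.
  by apply: (@finite_summable _ k) => i ki; rewrite Tx wx x0 // !mode0.
have Xuw : X (u - w) by exact: XB.
exists w; split => //; last first.
  by move=> i ik; rewrite wx /x (leq_trans ik) // leq_maxl.
have tail : nsq_sum (xc^~ u) k + N (u - w) ^+ 2 <= N u ^+ 2.
  have cu := N_lim Xu; have cuw := N_lim Xuw.
  rewrite -lerBrDl -(cvg_lim (@Rhausdorff R) cuw).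
  apply: limr_le; first exact: cvgP cuw.
  near=> m; have km : (k <= m)%N by near: m; exact: nbhs_infty_ge.
  rewrite lerBrDl; apply: le_trans (nsq_sum_le m Xu).
  have E0 : nsq_sum (xc^~ (u - w)) k = 0.
    rewrite /nsq_sum big1 // => i _; rewrite xcB // wx /x ltn_ord subrr.
    exact: nsq0.
  rewrite -(subnKC km); elim: (m - k)%N => [|j IH]; first by rewrite addn0 E0 addr0.
  rewrite addnS !nsq_sumS addrA; apply: lerD IH _.
  by rewrite xcB // wx x0 ?leq_addr // subr0.
have := Hk1 k (leq_maxr _ _); rewrite /= ger0_norm ?subr_ge0 ?nsq_sum_le //.
by move: tail; lra.
Unshelve. all: by end_near. Qed.

(** Mode by mode, [u] is replaced by a truncation with the same n-th coordinate, and the error is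
    removed in the limit. Summing the bounds over n then proves membership in the domain and the
    norm estimate at once. *)
Lemma modal_smoothing t u : 0 < t -> t <= 1 -> X u ->
  D (S t u) /\ N (T (S t u)) <= K * t `^ (- b) * N u.
Proof.
move=> t0 t1 Xu.
have Kt0 : 0 <= K * t `^ (- b) by rewrite mulr_ge0 // powR_ge0.
have est n : nsq (modal n (xc n (S t u))) <= (K * t `^ (- b)) ^+ 2 * nsq (xc n u).
  (* This bound of the n-th matrix is not uniform in n, but n is fixed while the truncation error
     tends to 0. *)
  set B := 2 * p n ^+ 2 + 2 * q n ^+ 2 + 2 * r n ^+ 2 + p n ^+ 2.
  have B0 : 0 <= B.
    by have := sqr_ge0 (p n); have := sqr_ge0 (q n); have := sqr_ge0 (r n); rewrite /B; lra.
  apply: (real_le_limit _ B0); first by rewrite mulr_ge0 ?sqr_ge0 ?nsq_ge0.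
  move=> e d e0 d0; have [w [Dw DTw Xuw Nuw wx]] := truncation n.+1 Xu d0.
  have Xw := DX Dw.
  have -> : S t u = S t w + S t (u - w).
    have -> : S t (u - w) = S t u - S t w by rewrite (S_sub S_semigroup) // ltW.
    by rewrite addrC subrK.
  have X1 := S_X S_semigroup (ltW t0) Xw; have X2 := S_X S_semigroup (ltW t0) Xuw.
  rewrite xcD // -[X in modal n X]addrC -[xc n (S t (u - w))]scale1r mode_lin scale1r addrC.
  apply: le_trans (nsqD _ _ e0) _; apply: lerD.
    rewrite ler_wpM2l ?addr_ge0 ?(ltW e0) // -wx //.
    exact: modal_decay_regular.
  rewrite ler_wpM2l ?addr_ge0 ?invr_ge0 ?(ltW e0) //.
  apply: le_trans (nsq_mode_le _ _ _ _) _; rewrite -/B ler_wpM2l //.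
  apply: le_trans (nsq_le n X2) _; apply: le_trans Nuw.
  rewrite ler_pXn2r ?nnegrE //; apply: (S_le S_contr) => //; exact: ltW.
have XS := S_X S_semigroup (ltW t0) Xu.
have sum_est J : nsq_sum (fun n => modal n (xc n (S t u))) J <=
    (K * t `^ (- b)) ^+ 2 * N u ^+ 2.
  apply: le_trans (ler_wpM2l (sqr_ge0 _) (nsq_sum_le J Xu)).
  by rewrite /nsq_sum mulr_sumr ler_sum.
have DS : D (S t u).
  by apply/D_char; split => //; eexists; exact: sum_est.
split => //; have [XT Tx] := T_char DS.
apply: N_le => //; first by rewrite mulr_ge0.
move=> J; rewrite exprMn; apply: le_trans (sum_est J).
by rewrite /nsq_sum ler_sum // => i _; rewrite Tx.
Qed.

End Smoothing.

End ModalSystem.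

(** * Resolvent bounds for one mode *)

Section ModeResolvent.
Variable R : realType.
Local Open Scope complex_scope.
Notation C3 := (R[i] * R[i] * R[i])%type.

Definition abs_sum (x : C3) : R := cmod x.1.1 + cmod x.1.2 + cmod x.2.

Lemma abs_sum_ge0 x : 0 <= abs_sum x.
Proof. by rewrite !addr_ge0 ?cmod_ge0. Qed.

Lemma nsq_abs_sum (x : C3) : nsq x <= abs_sum x ^+ 2.
Proof.
rewrite /nsq /abs_sum.
have := cmod_ge0 x.1.1; have := cmod_ge0 x.1.2; have := cmod_ge0 x.2.
move: (cmod _) (cmod _) (cmod _) => a b c a0 b0 c0.
have := mulr_ge0 a0 b0; have := mulr_ge0 a0 c0; have := mulr_ge0 b0 c0.
by move=> *; lra.
Qed.

Lemma abs_sum_nsq (x : C3) : abs_sum x ^+ 2 <= 3 * nsq x.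
Proof.
rewrite /nsq /abs_sum.
move: (cmod x.1.1) (cmod x.1.2) (cmod x.2) => a b c.
have := sqr_ge0 (a - b); have := sqr_ge0 (a - c); have := sqr_ge0 (b - c).
by move=> *; lra.
Qed.

(** The factor 2 covers the sqrt 3 between the two norms on C^3. Estimates in the l^1 norm have the
    advantage of being linear in the moduli. *)
Lemma nsq_of_abs_sum (la C : R) x f : 0 <= la -> 0 <= C ->
  la * abs_sum x <= C * abs_sum f -> la ^+ 2 * nsq x <= (2 * C) ^+ 2 * nsq f.
Proof.
move=> la0 C0 h.
apply: le_trans (ler_wpM2l (sqr_ge0 _) (nsq_abs_sum x)) _.
rewrite -exprMn; apply: (@le_trans _ _ ((C * abs_sum f) ^+ 2)).
  by rewrite ler_pXn2r ?nnegrE ?mulr_ge0 ?abs_sum_ge0.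
rewrite !exprMn; apply: le_trans (ler_wpM2l (sqr_ge0 _) (abs_sum_nsq f)) _.
rewrite mulrA ler_wpM2r ?nsq_ge0 // mulrC ler_wpM2r ?sqr_ge0 //; lra.
Qed.

(* Here a, b, c are the moduli of the coordinates of x and f is the l^1 norm of
   (i l - M) x. *)
Record resolvent_bounds (p q r l a b c f : R) : Prop := ResolventBounds {
  rb_a : l * a <= p * b + f;
  rb_b : l * b <= p * a + q * c + f;
  rb_c : l * c <= q * b + f;
  rb_pa : p * a <= q * c + l * b + f;
  rb_qb : q * b <= (l + r) * c + f;
  rb_rc : r * c <= q * b + f;
  rb_diss : r * c ^+ 2 <= f * (a + b + c) }.

Lemma cmod_ge_Im (z : R[i]) : `|complex.Im z| <= cmod z.
Proof.
by rewrite cmodE -sqrtr_sqr ler_wsqrtr // lerDr sqr_ge0.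
Qed.
Lemma cmod_ge_Re (z : R[i]) : `|complex.Re z| <= cmod z.
Proof.
by rewrite cmodE -sqrtr_sqr ler_wsqrtr // lerDl sqr_ge0.
Qed.

(** The real part of <(i l - M) x, x>: the term i l and the skew-symmetric part of M contribute
    imaginary numbers only. *)
Lemma mode_dissipation (p q r l : R) (x1 x2 x3 : R[i]) :
  r * cmod x3 ^+ 2 =
  complex.Re ((Complex 0 l * x1 - p%:C * x2) * conjc x1) +
  complex.Re ((Complex 0 l * x2 - (q%:C * x3 - p%:C * x1)) * conjc x2) +
  complex.Re (((Complex 0 l + r%:C) * x3 + q%:C * x2) * conjc x3).
Proof.
by rewrite cmod_sq; case: x1 => a1 b1; case: x2 => a2 b2; case: x3 => a3 b3 /=; ring.
Qed.

Lemma mode_resolvent_bounds (p q r l : R) (x : C3) : 0 < p -> 0 < q -> 0 < r ->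
  resolvent_bounds p q r `|l| (cmod x.1.1) (cmod x.1.2) (cmod x.2)
    (abs_sum (Complex 0 l *: x - mode p q r x)).
Proof.
move=> p0 q0 r0; case: x => [[x1 x2] x3] /=.
set z := Complex 0 l; have e (v w : R[i]) : v *: w = v * w :> R[i] by [].
have zl : cmod z = `|l| by exact: cmod_iR.
set F1 := z * x1 - p%:C * x2; set F2 := z * x2 - (q%:C * x3 - p%:C * x1).
set F3 := (z + r%:C) * x3 + q%:C * x2.
have -> : abs_sum (z *: (x1, x2, x3) - mode p q r (x1, x2, x3)) =
    cmod F1 + cmod F2 + cmod F3.
  rewrite /abs_sum /mode /= !e; congr (_ + _ + cmod _).
  by rewrite /F3; ring.
have f1 := cmod_ge0 F1; have f2 := cmod_ge0 F2; have f3 := cmod_ge0 F3.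
have cR (s : R) w : 0 < s -> cmod (s%:C * w) = s * cmod w.
  by move=> s0; rewrite cmodM cmodR gtr0_norm.
have cz w : cmod (z * w) = `|l| * cmod w by rewrite cmodM zl.
have s1 : `|l| <= cmod (z + r%:C).
  by have := cmod_ge_Im (z + r%:C); rewrite /= addr0.
have s2 : r <= cmod (z + r%:C).
  by have := cmod_ge_Re (z + r%:C); rewrite /= add0r gtr0_norm.
have s3 : cmod (z + r%:C) <= `|l| + r.
  by apply: le_trans (cmodD _ _) _; rewrite zl cmodR (gtr0_norm r0).
have hc : cmod (z + r%:C) * cmod x3 <= q * cmod x2 + cmod F3.
  rewrite -cmodM -(cR q) //; have -> : (z + r%:C) * x3 = F3 - q%:C * x2 by rewrite addrK.
  by apply: le_trans (cmodB _ _) _; rewrite addrC lexx.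
split.
- rewrite -cz -cR //; have -> : z * x1 = p%:C * x2 + F1 by rewrite /F1 addrC subrK.
  by apply: le_trans (cmodD _ _) _; lra.
- rewrite -cz -(cR p) // -(cR q) //.
  have -> : z * x2 = q%:C * x3 + F2 - p%:C * x1 by rewrite /F2; ring.
  apply: le_trans (cmodB _ _) _; have := cmodD (q%:C * x3) F2; lra.
- have := ler_wpM2r (cmod_ge0 x3) s1; lra.
- rewrite -cz -(cR p) // -(cR q) //.
  have -> : p%:C * x1 = q%:C * x3 + F2 - z * x2 by rewrite /F2; ring.
  apply: le_trans (cmodB _ _) _; have := cmodD (q%:C * x3) F2; lra.
- rewrite -(cR q) //; have -> : q%:C * x2 = F3 - (z + r%:C) * x3 by rewrite /F3; ring.
  apply: le_trans (cmodB _ _) _; rewrite cmodM.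
  have := ler_wpM2r (cmod_ge0 x3) s3; lra.
- have := ler_wpM2r (cmod_ge0 x3) s2; lra.
have -> : r * cmod x3 ^+ 2 = complex.Re (F1 * conjc x1) + complex.Re (F2 * conjc x2) +
    complex.Re (F3 * conjc x3).
  exact: mode_dissipation.
have h (F w : R[i]) : complex.Re (F * conjc w) <= cmod F * cmod w.
  by apply: le_trans (Re_le_cmod _) _; rewrite cmodM cmodJ.
have h1 := h F1 x1; have h2 := h F2 x2; have h3 := h F3 x3.
have [a1 a2 a3] : [/\ 0 <= cmod x1, 0 <= cmod x2 & 0 <= cmod x3].
  by split; exact: cmod_ge0.
apply: (@le_trans _ _ (cmod F1 * cmod x1 + cmod F2 * cmod x2 + cmod F3 * cmod x3)).
  by rewrite !lerD.
rewrite -subr_ge0.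
have -> : (cmod F1 + cmod F2 + cmod F3) * (cmod x1 + cmod x2 + cmod x3) -
  (cmod F1 * cmod x1 + cmod F2 * cmod x2 + cmod F3 * cmod x3) =
  cmod F1 * cmod x2 + cmod F1 * cmod x3 + (cmod F2 * cmod x1 + cmod F2 * cmod x3)
  + (cmod F3 * cmod x1 + cmod F3 * cmod x2) by ring.
by rewrite !addr_ge0 ?mulr_ge0.
Qed.

(** Young's inequality in the form used to close the estimates: w is the dissipated quantity, y the
    full norm, and the term y / 2 can be absorbed. *)
Lemma amgm_sqrt (w y f c : R) : 0 <= w -> 0 <= y -> 0 <= f -> 0 <= c ->
  w ^+ 2 <= f * y -> c * w <= y / 2 + c ^+ 2 / 2 * f.
Proof.
move=> w0 y0 f0 c0 h.
have cf : 0 <= c ^+ 2 / 2 * f by rewrite !mulr_ge0 ?sqr_ge0 ?invr_ge0.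
rewrite -(@ler_pXn2r _ 2) ?nnegrE ?mulr_ge0 ?addr_ge0 ?divr_ge0 // exprMn.
apply: (@le_trans _ _ (c ^+ 2 * (f * y))); first by rewrite ler_wpM2l ?sqr_ge0.
by have := sqr_ge0 (y / 2 - c ^+ 2 / 2 * f); lra.
Qed.

(** With p, q <= l / 4 the sum of the three rows gives l (a + b + c) <= l (a + b + c) / 2 + 3 f. The
    size of r is harmless because |i l + r| >= |l|. *)
Lemma neumann_bound (B p q r l a b c f : R) : 0 <= a -> 0 <= b -> 0 <= c ->
  0 <= l -> p <= B -> q <= B -> 4 * B <= l ->
  resolvent_bounds p q r l a b c f -> l * (a + b + c) <= 6 * f.
Proof.
move=> a0 b0 c0 l0 pB qB Bl [ha hb hc _ _ _ _].
have h1 := ler_wpM2r b0 pB; have h2 := ler_wpM2r a0 pB.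
have h3 := ler_wpM2r c0 qB; have h4 := ler_wpM2r b0 qB.
have h5 := ler_wpM2r a0 Bl; have h6 := ler_wpM2r b0 Bl; have h7 := ler_wpM2r c0 Bl.
have h8 := mulr_ge0 l0 a0; have h9 := mulr_ge0 l0 b0; have h10 := mulr_ge0 l0 c0.
lra.
Qed.

(** Here q may exceed l. The heat row gives q c <= (q / r) (q b + f) <= p b + f, so the coupling
    acts on the second row like another term of size p. *)
Lemma high_freq_bound (p q r l a b c f : R) :
  0 < p -> 0 < q -> 0 < r -> q <= r -> q ^+ 2 <= r * p -> 4 * p <= l ->
  0 <= a -> 0 <= b -> 0 <= c -> 0 <= f ->
  resolvent_bounds p q r l a b c f -> l * (a + b + c) <= 12 * f.
Proof.
move=> p0 q0 r0 qr qrp pl a0 b0 c0 f0 [ha hb hc _ _ hr _].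
have h1 := ler_wpM2r b0 pl; have h2 := ler_wpM2r a0 pl.
have qc : q * c <= p * b + f.
  rewrite -(ler_pM2l r0); apply: (@le_trans _ _ (q * (q * b + f))).
    by rewrite mulrCA ler_wpM2l ?(ltW q0).
  have := ler_wpM2r b0 qrp; have := ler_wpM2r f0 qr.
  lra.
have lc : l * c <= l * b + f.
  have l0 : 0 < l by lra.
  have qb := ler_wpM2r b0 qr.
  have [lr|rl] := leP l r; last by have := ler_wpM2r b0 (ltW rl); lra.
  rewrite -(ler_pM2l r0); apply: (@le_trans _ _ (l * (r * b + f))).
    by rewrite mulrCA ler_wpM2l ?(ltW l0) //; lra.
  by have := ler_wpM2r f0 lr; lra.
lra.
Qed.

(** After multiplication by k = q^2 / r every coordinate is bounded by q c, and (q c)^2 = k r c^2 is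
    what the dissipation controls. *)
Lemma low_freq_bound (p q r l a b c f : R) :
  0 < p -> 0 < q -> 0 < r -> p <= r -> q <= r -> q ^+ 2 <= r * p -> 0 <= l -> l <= 4 * p ->
  0 <= a -> 0 <= b -> 0 <= c -> 0 <= f ->
  resolvent_bounds p q r l a b c f -> q ^+ 2 / r * (a + b + c) <= 741 * f.
Proof.
move=> p0 q0 r0 pr qr qrp l0 lp a0 b0 c0 f0 [_ _ _ hpa hqb _ hd].
set k := q ^+ 2 / r.
have k0 : 0 < k by rewrite divr_gt0 ?exprn_gt0.
have kq : k <= q by rewrite /k ler_pdivrMr // expr2 ler_pM2l.
have kp : k <= p by rewrite /k ler_pdivrMr // mulrC.
have hb : k * b <= 5 * (q * c) + f.
  have h : q * b <= 5 * r * c + f.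
    have : (l + r) * c <= 5 * r * c by rewrite ler_wpM2r //; lra.
    lra.
  have -> : k * b = q / r * (q * b) by rewrite /k; field; rewrite gt_eqF.
  apply: (@le_trans _ _ (q / r * (5 * r * c + f))).
    by rewrite ler_wpM2l // divr_ge0 // ltW.
  have -> : q / r * (5 * r * c + f) = 5 * (q * c) + q / r * f by field; rewrite gt_eqF.
  by rewrite lerD2l ler_piMl // ler_pdivrMr // mul1r.
have ha : k * a <= q * c + 4 * (k * b) + f.
  have -> : k * a = k / p * (p * a) by field; rewrite gt_eqF.
  have kp1 : k / p <= 1 by rewrite ler_pdivrMr // mul1r.
  have kp0 : 0 <= k / p by rewrite divr_ge0 // ltW.
  apply: le_trans (ler_wpM2l kp0 hpa) _; rewrite !mulrDr.
  have h1 : k / p * (q * c) <= q * c by rewrite ler_piMl // mulr_ge0 // ltW.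
  have h2 : k / p * f <= f by rewrite ler_piMl.
  have h3 : k / p * (l * b) <= 4 * (k * b).
    have -> : 4 * (k * b) = k / p * (4 * p * b) by field; rewrite gt_eqF.
    by rewrite ler_wpM2l // ler_wpM2r.
  lra.
have hc : k * c <= q * c by rewrite ler_wpM2r.
have qc0 : 0 <= q * c by rewrite mulr_ge0 // ltW.
have y0 : 0 <= k * (a + b + c) by rewrite mulr_ge0 ?(ltW k0) // !addr_ge0.
(* The bounds [hb], [ha] and [hc] add up to 27 q c + 6 f, so y = k (a + b + c) satisfies y <= y / 2
   + (27^2 / 2 + 6) f, which is y <= 741 f. *)
have := @amgm_sqrt (q * c) (k * (a + b + c)) f 27 qc0 y0 f0 (ler0n _ _).
have -> : (q * c) ^+ 2 = k * (r * c ^+ 2) by rewrite /k; field; rewrite gt_eqF.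
have h := ler_wpM2l (ltW k0) hd.
rewrite (mulrCA f k) => /(_ h) {}h; lra.
Qed.

(** In g x_1 + x_3 the terms p g x_2 of rows one and three cancel, leaving -p x_3. Row two rewrites
    p x_3 as k (g x_1 + x_3) plus g / (g^2 + 1) times (i l x_2 - F_2), with k = p / (g^2 + 1); so
    x_2 enters with a small factor. *)
Lemma slow_variable_bound (p g l : R) (x : C3) : 1 <= p -> 1 <= g ->
  `|l| * cmod (g%:C * x.1.1 + x.2) <= g * (`|l| * cmod x.1.2) / (g ^+ 2 + 1) +
    3 * (g * abs_sum (Complex 0 l *: x - mode p (p * g) p x)).
Proof.
move=> p1 g1; have p0 : 0 < p by lra.
have g0 : 0 < g by lra.
have h0 : 0 < g ^+ 2 + 1 by have := sqr_ge0 g; lra.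
case: x => [[x1 x2] x3] /=; set L := `|l|.
set z := Complex 0 l; have e (v w : R[i]) : v *: w = v * w :> R[i] by [].
have zl : cmod z = L by exact: cmod_iR.
rewrite /abs_sum /mode /= !e.
set F1 := z * x1 - p%:C * x2; set F2 := z * x2 - _; set F3 := z * x3 - _.
have f1 := cmod_ge0 F1; have f2 := cmod_ge0 F2; have f3 := cmod_ge0 F3.
pose k := p / (g ^+ 2 + 1); have k0 : 0 <= k by rewrite divr_ge0 // ltW.
have gh : g ^+ 2 + 1 != 0 by rewrite gt_eqF.
have ghC : (g%:C : R[i]) ^+ 2 + 1 != 0.
  by rewrite -rmorphXn -(rmorphD (real_complex R) _ 1) /= fmorph_eq0.
have key : (z + k%:C) * (g%:C * x1 + x3) =
    (g%:C * F1 + F3) - (g / (g ^+ 2 + 1))%:C * (z * x2 - F2).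
  rewrite /F1 /F2 /F3 /k !rmorphM !fmorphV rmorphD rmorphXn rmorph1 /=.
  by field.
have h1 : L * cmod (g%:C * x1 + x3) <= cmod (z + k%:C) * cmod (g%:C * x1 + x3).
  rewrite ler_wpM2r ?cmod_ge0 // /L.
  by have := cmod_ge_Im (z + k%:C); rewrite /= addr0.
apply: le_trans h1 _; rewrite -cmodM key.
have gq : 0 <= g / (g ^+ 2 + 1) by rewrite divr_ge0 // ltW.
have gq1 : g / (g ^+ 2 + 1) <= g.
  rewrite ler_pdivrMr // ler_peMr ?(ltW g0) //; have := sqr_ge0 g; lra.
apply: le_trans (cmodB _ _) _; rewrite [cmod (_%:C * (_ - _))]cmodM cmodR ger0_norm //.
have h2 := cmodB (z * x2) F2; rewrite cmodM zl in h2.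
have h3 := cmodD (g%:C * F1) F3; rewrite cmodM cmodR gtr0_norm // in h3.
have h4 := ler_wpM2l gq h2; rewrite mulrDr in h4.
have h5 := ler_wpM2r f2 gq1.
have h6 : cmod F3 <= g * cmod F3 by rewrite ler_peMl.
have h7 : g * (L * cmod x2) / (g ^+ 2 + 1) = g / (g ^+ 2 + 1) * (L * cmod x2).
  by rewrite mulrAC.
have h8 := mulr_ge0 (ltW g0) f1; have h9 := mulr_ge0 (ltW g0) f2.
have h10 := mulr_ge0 (ltW g0) f3.
by rewrite h7; lra.
Qed.

(** The first coordinate is recovered from the slow variable by dividing by g, which compensates the
    factor g in the bound of that variable; everything is then reduced to the dissipated coordinate
    c. *)
Lemma coupled_low_freq_bound (p g l : R) (x : C3) :
  1 <= p -> 1 <= g -> 0 < `|l| -> `|l| <= 4 * (p * g) ->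
  abs_sum x <= 100 * (abs_sum (Complex 0 l *: x - mode p (p * g) p x) / p) +
               18 * (abs_sum (Complex 0 l *: x - mode p (p * g) p x) / `|l|).
Proof.
move=> p1 g1 l0 lq; set f := abs_sum (_ - _); have p0 : 0 < p by lra.
have g0 : 0 < g by lra.
have q0 : 0 < p * g by rewrite mulr_gt0.
have [_ _ _ _ hqb _ hd] := mode_resolvent_bounds l x p0 q0 p0.
rewrite -/f in hqb hd; have f0 : 0 <= f by exact: abs_sum_ge0.
set a := cmod x.1.1 in hqb hd *; set b := cmod x.1.2 in hqb hd *.
set c := cmod x.2 in hqb hd *.
have [a0 b0 c0] : [/\ 0 <= a, 0 <= b & 0 <= c] by split; exact: cmod_ge0.
pose L := `|l|; rewrite -/L in hqb l0 lq *.
pose s := cmod (g%:C * x.1.1 + x.2).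
have s0 : 0 <= s by exact: cmod_ge0.
have pg : p <= p * g by rewrite ler_peMr // ltW.
have hb : L * b <= 5 * (L * c) + 4 * f.
  have h1 : (L + p) * c <= 5 * (p * g) * c by rewrite ler_wpM2r //; lra.
  have h2 : p * g * b <= p * g * (5 * c) + f by lra.
  have t0 : 0 <= L / (p * g) by rewrite divr_ge0 // ltW.
  have t4 : L / (p * g) <= 4 by rewrite ler_pdivrMr.
  have h3 := ler_wpM2l t0 h2; have h4 := ler_wpM2r f0 t4.
  have e1 : L / (p * g) * (p * g * b) = L * b by field; rewrite !gt_eqF.
  have e2 : L / (p * g) * (p * g * (5 * c) + f) = 5 * (L * c) + L / (p * g) * f.
    by field; rewrite !gt_eqF.
  by rewrite e1 e2 in h3; lra.
have hs : L * s <= g * (L * b) / (g ^+ 2 + 1) + 3 * (g * f).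
  exact: slow_variable_bound.
have ha : L * a <= L * b / 2 + 3 * f + L * c.
  have h1 : g * a <= s + c.
    rewrite -[g]gtr0_norm // -cmodR -cmodM.
    have -> : g%:C * x.1.1 = (g%:C * x.1.1 + x.2) - x.2 by rewrite addrK.
    exact: cmodB.
  have Lb0 : 0 <= L * b by rewrite mulr_ge0 // ltW.
  have Lc0 : 0 <= L * c by rewrite mulr_ge0 // ltW.
  have h2 : g * (L * b) / (g ^+ 2 + 1) <= g * (L * b / 2).
    rewrite -!mulrA ler_wpM2l ?(ltW g0) // !mulrA ler_wpM2l // lef_pV2 ?posrE //.
      by have : 1 <= g ^+ 2; [rewrite exprn_ege1|lra].
    by have := sqr_ge0 g; lra.
  rewrite -(ler_pM2l g0).
  have h3 := ler_wpM2l (ltW l0) h1.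
  have h4 : L * c <= g * (L * c) by rewrite ler_peMl.
  move: hs h2; set y := _ / (g ^+ 2 + 1) => hs h2.
  lra.
have hsum : a + b + c <= 10 * c + 9 * (f / L).
  rewrite -(ler_pM2l l0) !mulrDr.
  have -> : L * (9 * (f / L)) = 9 * f by field; rewrite gt_eqF.
  by have := mulr_ge0 (ltW l0) c0; lra.
have y0 : 0 <= a + b + c by rewrite !addr_ge0.
have fp0 : 0 <= f / p by rewrite divr_ge0 // ltW.
(* From a + b + c <= 10 c + 9 f / L, half of the left side being absorbed, come the constants 100 =
   10^2 and 18 = 2 * 9. *)
have := @amgm_sqrt c (a + b + c) (f / p) 10 c0 y0 fp0 (ler0n _ _).
rewrite mulrAC ler_pdivlMr // [c ^+ 2 * p]mulrC => /(_ hd).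
by rewrite /abs_sum -/a -/b -/c; lra.
Qed.

End ModeResolvent.

(** * Decay of one mode *)

Section ModeODE.
Variable R : realType.

Lemma cross_ge (c K x y : R) : - K <= c -> c <= K ->
  - (K / 2 * (x ^+ 2 + y ^+ 2)) <= c * x * y.
Proof.
move=> h1 h2; have k1 : 0 <= K + c by lra.
have k2 : 0 <= K - c by lra.
have := mulr_ge0 k1 (sqr_ge0 (x + y)); have := mulr_ge0 k2 (sqr_ge0 (x - y)).
by move=> *; lra.
Qed.

Lemma sqr_linear_le (a b x y : R) :
  (a * x + b * y) ^+ 2 <= (a ^+ 2 + b ^+ 2) * (x ^+ 2 + y ^+ 2).
Proof. by have := sqr_ge0 (a * y - b * x); lra. Qed.

Lemma le_at_0_of_derive_le0 (G dG : R -> R) : continuous G ->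
  (forall t : R, 0 < t -> is_derive t 1 G (dG t)) ->
  (forall t : R, 0 < t -> dG t <= 0) -> forall t : R, 0 <= t -> G t <= G 0.
Proof.
move=> Gc Gd dG0 t t0.
have d1 (x : R) : x \in `]0, t[%R -> derivable G x 1.
  by rewrite in_itv /= => /andP[x0 _]; have [] := Gd x x0.
have d2 (x : R) : x \in `]0, t[%R -> derive1 G x <= 0.
  rewrite in_itv /= => /andP[x0 _]; rewrite derive1E.
  by have [_ ->] := Gd x x0; exact: dG0.
have cG : {within `[0, t], continuous G} by exact: continuous_subspaceT.
have := ler0_derive1_le_cc d1 d2 cG; apply => //; by rewrite in_itv /= t0 lexx.
Qed.

(** Gronwall with an integrating factor: [G] is nonincreasing because b <= a / 2 gives (2 m / a) (a
    - b) >= m, so the subtracted exponential absorbs the source. *)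
Lemma ode_compare (f df : R -> R) (a m b : R) : continuous f ->
  (forall t : R, 0 < t -> is_derive t 1 f (df t)) ->
  0 < a -> 0 <= m -> 0 <= b -> b <= a / 2 ->
  (forall t, 0 < t -> df t <= - (a * f t) + m * expR (- (b * t))) ->
  forall t, 0 <= t ->
    f t <= f 0 * expR (- (a * t)) + 2 * m / a * expR (- (b * t)).
Proof.
move=> fc fd a0 m0 b0 ba h t t0.
pose G (t : R) := expR (a * t) * f t - 2 * m / a * expR ((a - b) * t).
pose dG (t : R) := expR (a * t) * (a * f t + df t)
  - 2 * m / a * (a - b) * expR ((a - b) * t).
have dexp (c s : R) : is_derive s 1 (fun t : R => expR (c * t)) (c * expR (c * s)).
  have d1 := is_deriveZ c (is_derive_id s (1 : R)).
  have d2 := @is_derive1_comp _ expR (fun t => c * t) s (expR (c * s)) (c *: 1)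
    (is_derive_expR _) d1.
  by apply: (is_derive_eq d2); rewrite /GRing.scale /= mulr1 mulrC.
have Gd (s : R) : 0 < s -> is_derive s 1 G (dG s).
  move=> s0; have d1 := fd s s0; have d2 := dexp a s; have d3 := dexp (a - b) s.
  have d4 := is_deriveM d2 d1; have d5 := is_deriveZ (2 * m / a) d3.
  have d6 := is_deriveB d4 d5.
  apply: (is_derive_eq d6).
  by rewrite /dG /GRing.scale /=; ring.
have Gc : continuous G.
  move=> s; apply: cvgB.
    apply: cvgM; last exact: fc.
    apply: continuous_comp; last exact: continuous_expR.
    by apply: cvgM; [exact: cvg_cst|exact: cvg_id].
  apply: cvgM; first exact: cvg_cst.
  apply: continuous_comp; last exact: continuous_expR.
  by apply: cvgM; [exact: cvg_cst|exact: cvg_id].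
have dG0 (s : R) : 0 < s -> dG s <= 0.
  move=> s0; rewrite /dG.
  have h1 : a * f s + df s <= m * expR (- (b * s)) by have := h s s0; lra.
  have h2 := ler_wpM2l (expR_ge0 (a * s)) h1.
  have e1 : expR (a * s) * (m * expR (- (b * s))) = m * expR ((a - b) * s).
    by rewrite mulrCA -expRD mulrBl.
  rewrite e1 in h2; have ep := expR_ge0 ((a - b) * s).
  have h3 : m * expR ((a - b) * s) <= 2 * m / a * (a - b) * expR ((a - b) * s).
    rewrite ler_wpM2r // mulrAC ler_pdivlMr // -mulrA [2 * _]mulrC -mulrA.
    by rewrite ler_wpM2l //; lra.
  lra.
have G0t : G t <= G 0 := le_at_0_of_derive_le0 Gc Gd dG0 t0.
have : expR (- (a * t)) * G t <= expR (- (a * t)) * G 0.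
  by rewrite ler_wpM2l ?expR_ge0.
rewrite /G !mulr0 expR0 mul1r mulr1 mulrBr mulrA -expRD addNr expR0 mul1r.
have -> : expR (- (a * t)) * (2 * m / a * expR ((a - b) * t)) =
    2 * m / a * expR (- (b * t)).
  by rewrite mulrCA -expRD; congr (_ * expR _); ring.
have : 0 <= 2 * m / a * expR (- (a * t)).
  by rewrite !mulr_ge0 ?expR_ge0 ?invr_ge0 ?(ltW a0).
rewrite mulrBr; lra.
Qed.

(** A general quadratic form in three variables; every Lyapunov function below is an instance, so
    continuity, derivative and comparison are settled once. *)
Definition quad (c1 c2 c3 c4 c5 c6 : R) (u v w : R) : R :=
  c1 * u ^+ 2 + c2 * v ^+ 2 + c3 * w ^+ 2 + c4 * (u * v) + c5 * (u * w) + c6 * (v * w).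

Lemma continuous_quad c1 c2 c3 c4 c5 c6 (u v w : R -> R) :
  continuous u -> continuous v -> continuous w ->
  continuous (fun t => quad c1 c2 c3 c4 c5 c6 (u t) (v t) (w t)).
Proof.
move=> uc vc wc t.
have M (f g : R -> R) : continuous f -> continuous g -> continuous (fun t => f t * g t).
  by move=> fc gc s; apply: cvgM; [exact: fc|exact: gc].
have D (f g : R -> R) : continuous f -> continuous g -> continuous (fun t => f t + g t).
  by move=> fc gc s; apply: cvgD; [exact: fc|exact: gc].
have C (c : R) : continuous (fun _ : R => c) by move=> s; exact: cvg_cst.
have Z (c : R) (f g : R -> R) : continuous f -> continuous g -> continuous (fun t : R => c * (f t * g t)).
  by move=> fc gc; exact: (M _ _ (C c) (M _ _ fc gc)).
exact: (D _ _ (D _ _ (D _ _ (D _ _ (D _ _ (Z c1 _ _ uc uc) (Z c2 _ _ vc vc))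
  (Z c3 _ _ wc wc)) (Z c4 _ _ uc vc)) (Z c5 _ _ uc wc)) (Z c6 _ _ vc wc) t).
Qed.

Lemma is_derive_quad c1 c2 c3 c4 c5 c6 (u v w : R -> R) (t du dv dw : R) :
  is_derive t 1 u du -> is_derive t 1 v dv -> is_derive t 1 w dw ->
  is_derive t 1 (fun t => quad c1 c2 c3 c4 c5 c6 (u t) (v t) (w t))
    (2 * c1 * (u t * du) + 2 * c2 * (v t * dv) + 2 * c3 * (w t * dw) +
     c4 * (u t * dv + v t * du) + c5 * (u t * dw + w t * du) +
     c6 * (v t * dw + w t * dv)).
Proof.
move=> hu hv hw.
have Z (c : R) (f g : R -> R) (df dg : R) : is_derive t 1 f df -> is_derive t 1 g dg ->
    is_derive t 1 (fun s : R => c * (f s * g s)) (c * (f t * dg + g t * df)).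
  move=> hf hg; have d1 := is_deriveZ c (is_deriveM hf hg).
  by apply: (is_derive_eq d1).
have d := is_deriveD (is_deriveD (is_deriveD (is_deriveD (is_deriveD
   (Z c1 _ _ _ _ hu hu) (Z c2 _ _ _ _ hv hv)) (Z c3 _ _ _ _ hw hw))
   (Z c4 _ _ _ _ hu hv)) (Z c5 _ _ _ _ hu hw)) (Z c6 _ _ _ _ hv hw).
apply: (is_derive_eq d).
by ring.
Qed.

Lemma quad_compare c1 c2 c3 c4 c5 c6 (u v w du dv dw : R -> R) (a m b : R) :
  continuous u -> continuous v -> continuous w ->
  (forall t : R, 0 < t -> is_derive t 1 u (du t)) ->
  (forall t : R, 0 < t -> is_derive t 1 v (dv t)) ->
  (forall t : R, 0 < t -> is_derive t 1 w (dw t)) ->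
  0 < a -> 0 <= m -> 0 <= b -> b <= a / 2 ->
  (forall t, 0 < t ->
     2 * c1 * (u t * du t) + 2 * c2 * (v t * dv t) + 2 * c3 * (w t * dw t) +
     c4 * (u t * dv t + v t * du t) + c5 * (u t * dw t + w t * du t) +
     c6 * (v t * dw t + w t * dv t) <=
     - (a * quad c1 c2 c3 c4 c5 c6 (u t) (v t) (w t)) + m * expR (- (b * t))) ->
  forall t, 0 <= t -> quad c1 c2 c3 c4 c5 c6 (u t) (v t) (w t) <=
    quad c1 c2 c3 c4 c5 c6 (u 0) (v 0) (w 0) * expR (- (a * t)) +
    2 * m / a * expR (- (b * t)).
Proof.
move=> uc vc wc hu hv hw a0 m0 b0 ba h t t0.
apply: (@ode_compare (fun t => quad c1 c2 c3 c4 c5 c6 (u t) (v t) (w t)) _ a m b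
  (continuous_quad uc vc wc) (fun s s0 => is_derive_quad _ _ _ _ _ _
    (hu s s0) (hv s s0) (hw s s0)) a0 m0 b0 ba h t t0).
Qed.

Section Weak.
Variables (p q r : R) (u v w : R -> R).
Hypotheses (uc : continuous u) (vc : continuous v) (wc : continuous w).
Hypothesis hu : forall t : R, 0 < t -> is_derive t 1 u (p * v t).
Hypothesis hv : forall t : R, 0 < t -> is_derive t 1 v (q * w t - p * u t).
Hypothesis hw : forall t : R, 0 < t -> is_derive t 1 w (- (q * v t) - r * w t).

Definition energy t := u t ^+ 2 + v t ^+ 2 + w t ^+ 2.

Lemma energy_ge0 t : 0 <= energy t.
Proof. by rewrite !addr_ge0 // sqr_ge0. Qed.

Lemma energy_noninc t : 0 <= r -> 0 <= t -> energy t <= energy 0.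
Proof.
move=> r0 t0; rewrite /energy.
have fE s : quad 1 1 1 0 0 0 (u s) (v s) (w s) = u s ^+ 2 + v s ^+ 2 + w s ^+ 2.
  by rewrite /quad; ring.
have fd (s : R) (s0 : 0 < s) := is_derive_quad 1 1 1 0 0 0 (hu s0) (hv s0) (hw s0).
rewrite -!fE.
have H := le_at_0_of_derive_le0 (continuous_quad uc vc wc) fd.
apply: H t0 => s _.
by have := mulr_ge0 r0 (sqr_ge0 (w s)); lra.
Qed.

Hypotheses (p0 : 0 < p) (q0 : 0 < q) (r0 : 0 < r).
Hypotheses (pr : p <= r) (qr : 2 * q <= r) (qrp : q ^+ 2 <= r * p).

Variable k : R.
Hypothesis kE : k = q ^+ 2 / r.

Let k0 : 0 < k. Proof. by rewrite kE divr_gt0 ?exprn_gt0. Qed.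
Let kr : 4 * k <= r.
Proof.
rewrite kE mulrA ler_pdivrMr // -expr2 (_ : 4 * q ^+ 2 = (2 * q) ^+ 2); last by ring.
by rewrite ler_pXn2r ?nnegrE ?mulr_ge0 ?(ltW q0) ?(ltW r0).
Qed.
Let kp : k <= p. Proof. by rewrite kE ler_pdivrMr // mulrC. Qed.

Lemma weak_energy_decay t : 0 <= t -> energy t <= 3 * energy 0 * expR (- (k / 24 * t)).
Proof.
have [K1 K2 K3 K4] : [/\ 0 < k, 4 * k <= r, k <= p & 2 * q <= r] by split.
have [K5 K6 K7] : [/\ 0 < p, 0 < q & 0 < r] by split.
(* The energy is dissipated through [w] only; the cross terms [c v w] and
   [d u v] carry the dissipation over to [v] and then to [u]. *)
move=> t0; pose c := q / (4 * r); pose d := k / (8 * p).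
have c0 : 0 <= c by rewrite divr_ge0 ?mulr_ge0 // ltW.
have c8 : c <= 1 / 8.
  have h : q <= 1 / 8 * (4 * r) by lra.
  by rewrite /c ler_pdivrMr ?mulr_gt0.
have d0 : 0 <= d by rewrite divr_ge0 ?mulr_ge0 // ltW.
have d8 : d <= 1 / 8.
  have h : k <= 1 / 8 * (8 * p) by lra.
  by rewrite /d ler_pdivrMr ?mulr_gt0.
have eqv s : energy s / 2 <= quad 1 1 1 d 0 c (u s) (v s) (w s) <= 3 / 2 * energy s.
  have h1 := @cross_ge c (1/8) (v s) (w s) ltac:(lra) c8.
  have h2 := @cross_ge d (1/8) (u s) (v s) ltac:(lra) d8.
  have h3 := @cross_ge (- c) (1/8) (v s) (w s) ltac:(lra) ltac:(lra).
  have h4 := @cross_ge (- d) (1/8) (u s) (v s) ltac:(lra) ltac:(lra).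
  have := sqr_ge0 (u s); have := sqr_ge0 (v s); have := sqr_ge0 (w s).
  by rewrite /energy /quad => *; apply/andP; split; lra.
(* The derivative is at most -(k / 16) times the energy and the form at most 3/2 times it, hence the
   rate k / 24; the prefactor 3 is the ratio of 3/2 to 1/2. *)
have := @quad_compare 1 1 1 d 0 c u v w _ _ _ (k / 24) 0 0 uc vc wc hu hv hw
  ltac:(by rewrite divr_gt0) (lexx _) (lexx _) ltac:(by rewrite !divr_ge0 // ltW) _ t t0.
rewrite mulr0 !mul0r addr0 => H.
have {H}H : quad 1 1 1 d 0 c (u t) (v t) (w t) <=
    quad 1 1 1 d 0 c (u 0) (v 0) (w 0) * expR (- (k / 24 * t)).
  apply: H => s s0; cbv beta.
  have /andP[_ e2] := eqv s.
  apply: (@le_trans _ _ (- (k / 16 * energy s))); last first.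
    have := ler_wpM2l (ltW k0) e2; lra.
  (* In this scaling r w^2 = k T^2, so that k factors out of the whole derivative and the ratios x
     and y stay bounded. *)
  pose T := r / q * w s.
  have wT : w s = q / r * T by rewrite /T; field; rewrite !gt_eqF.
  pose x := q / r; have x0 : 0 <= x by rewrite divr_ge0 // ltW.
  have x2 : x <= 1 / 2.
    have h : q <= 1 / 2 * r by lra.
    by rewrite /x ler_pdivrMr.
  pose y := p / r; have y0 : 0 <= y by rewrite divr_ge0 // ltW.
  have y1 : y <= 1 by rewrite /y ler_pdivrMr // mul1r.
  have -> : 2 * 1 * (u s * (p * v s)) + 2 * 1 * (v s * (q * w s - p * u s)) +
     2 * 1 * (w s * (- (q * v s) - r * w s)) +
     d * (u s * (q * w s - p * u s) + v s * (p * v s)) +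
     0 * (u s * (- (q * v s) - r * w s) + w s * (p * v s)) +
     c * (v s * (- (q * v s) - r * w s) + w s * (q * w s - p * u s)) =
     k * (- 2 * T ^+ 2 + 1 / 4 * x ^+ 2 * T ^+ 2 - u s ^+ 2 / 8 - v s ^+ 2 / 8
       - ((y / 4 - d) * u s * T) - (1 / 4) * v s * T).
    rewrite /d /c wT /x /y kE; field; rewrite !gt_eqF //.
  have -> : energy s = u s ^+ 2 + v s ^+ 2 + x ^+ 2 * T ^+ 2.
    by rewrite /energy wT -exprMn.
  have h1 := @cross_ge (y / 4 - d) (1/4) (u s / 2) (2 * T) ltac:(lra) ltac:(lra).
  have h2 := @cross_ge (1/4) (1/4) (v s / 2) (2 * T) ltac:(lra) (lexx _).
  have x4 : x ^+ 2 <= 1 / 4 by nra.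
  have h3 := ler_wpM2r (sqr_ge0 T) x4.
  have := sqr_ge0 (u s); have := sqr_ge0 (v s); have := sqr_ge0 T.
  move=> T0 v0 u0.
  set LHS := (X in k * X <= _); suff : LHS <= - (u s ^+ 2 + v s ^+ 2 + x ^+ 2 * T ^+ 2) / 16.
    by move=> h; have := ler_wpM2l (ltW k0) h; lra.
  rewrite /LHS; lra.
have /andP[e1 _] := eqv t; have /andP[_ e2] := eqv 0.
have := ler_wpM2r (expR_ge0 (- (k / 24 * t))) e2; lra.
Qed.

Lemma weak_mode_decay t : 0 <= t -> mode_sq p q r (u t) (v t) (w t) <=
  (39 * (p ^+ 2 * expR (- (k / 24 * t))) + 3 * (r ^+ 2 * expR (- (r / 2 * t)))) * energy 0.
Proof.
have [K1 K2 K3 K4] : [/\ 0 < k, 4 * k <= r, k <= p & 2 * q <= r] by split.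
have [K5 K6 K7] : [/\ 0 < p, 0 < q & 0 < r] by split.
move=> t0; have E0 := energy_ge0 0; set E := energy 0 in E0 *.
(* [q v + r w] is a fast variable: its square decays at the rate [r / 2], up to
   a source term of size [k p^2] times the energy. *)
pose m := 12 * k * p ^+ 2 * E.
have m0 : 0 <= m.
  apply: mulr_ge0 => //; apply: mulr_ge0; last exact: sqr_ge0.
  by apply: mulr_ge0 => //; exact: ltW.
have x2 : q / r <= 1 / 2.
  have h : q <= 1 / 2 * r by lra.
  by rewrite ler_pdivrMr.
have x0 : 0 <= q / r by rewrite divr_ge0 // ltW.
(* The variable w is eliminated through q w = (q / r) W - k v with W = q v + r w, where q / r <= 1/2
   and k <= p. *)
have slow s : (q * w s) ^+ 2 <= (q * v s + r * w s) ^+ 2 / 2 + 2 * (p * v s) ^+ 2.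
  have -> : q * w s = q / r * (q * v s + r * w s) + (- k) * v s.
    by rewrite kE; field; rewrite gt_eqF.
  have h1 : (q / r) ^+ 2 <= 1 / 4 by nra.
  have h2 : k ^+ 2 <= p ^+ 2 by rewrite ler_pXn2r ?nnegrE ?(ltW k0) ?(ltW p0).
  have := ler_wpM2r (sqr_ge0 (q * v s + r * w s)) h1.
  have := ler_wpM2r (sqr_ge0 (v s)) h2.
  by have := sqr_ge0 (q / r * (q * v s + r * w s) - (- k) * v s); lra.
have H := @quad_compare 0 (q ^+ 2) (r ^+ 2) 0 0 (2 * q * r) u v w _ _ _ (r / 2) m (k / 24)
  uc vc wc hu hv hw ltac:(by rewrite divr_gt0) m0 ltac:(by rewrite divr_ge0 // ltW)
  ltac:(lra) _ t t0.
have {}H : quad 0 (q ^+ 2) (r ^+ 2) 0 0 (2 * q * r) (u t) (v t) (w t) <=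
    quad 0 (q ^+ 2) (r ^+ 2) 0 0 (2 * q * r) (u 0) (v 0) (w 0) * expR (- (r / 2 * t)) +
    2 * m / (r / 2) * expR (- (k / 24 * t)).
  apply: H => s s0; cbv beta.
  have -> : quad 0 (q ^+ 2) (r ^+ 2) 0 0 (2 * q * r) (u s) (v s) (w s) =
     (q * v s + r * w s) ^+ 2 by rewrite /quad; ring.
  set W := q * v s + r * w s.
  set Z := q * w s - p * u s.
  have -> : 2 * 0 * (u s * (p * v s)) + 2 * q ^+ 2 * (v s * Z) +
     2 * r ^+ 2 * (w s * (- (q * v s) - r * w s)) + 0 * (u s * Z + v s * (p * v s)) +
     0 * (u s * (- (q * v s) - r * w s) + w s * (p * v s)) +
     2 * q * r * (v s * (- (q * v s) - r * w s) + w s * Z) =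
     2 * q * W * Z - 2 * r * W ^+ 2.
    by rewrite /W; ring.
  have Zle : Z ^+ 2 <= 2 * (p * u s) ^+ 2 + (W ^+ 2 + 4 * (p * v s) ^+ 2).
    by have := slow s; have := sqr_ge0 (q * w s + p * u s); rewrite /Z /W; lra.
  have := weak_energy_decay (ltW s0); rewrite -/E => dec.
  have ZE : Z ^+ 2 <= W ^+ 2 + 4 * (p ^+ 2 * energy s).
    have := mulr_ge0 (sqr_ge0 p) (sqr_ge0 (u s)); have := mulr_ge0 (sqr_ge0 p) (sqr_ge0 (w s)).
    by move: Zle; rewrite /energy !exprMn; lra.
  have kZ : k * Z ^+ 2 <= r / 2 * W ^+ 2 + 4 * (k * (p ^+ 2 * energy s)).
    have := ler_wpM2l (ltW k0) ZE; have := ler_wpM2r (sqr_ge0 W) kr.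
    have := mulr_ge0 (ltW r0) (sqr_ge0 W); lra.
  have am : 2 * q * W * Z <= r * W ^+ 2 + k * Z ^+ 2.
    have : 0 <= r * (W - q / r * Z) ^+ 2 by rewrite mulr_ge0 ?sqr_ge0 // ltW.
    have -> : r * (W - q / r * Z) ^+ 2 = r * W ^+ 2 - 2 * q * W * Z + k * Z ^+ 2.
      by rewrite kE; field; rewrite gt_eqF.
    lra.
  have kp2 : 0 <= 4 * (k * p ^+ 2).
    apply: mulr_ge0 => //; apply: mulr_ge0; [exact: ltW|exact: sqr_ge0].
  have := ler_wpM2l kp2 dec; rewrite /m; lra.
have mr : 2 * m / (r / 2) <= 12 * p ^+ 2 * E.
  have -> : 2 * m / (r / 2) = 48 * (k / r) * (p ^+ 2 * E) by rewrite /m; field; rewrite gt_eqF.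
  have : k / r <= 1 / 4.
    have h : k <= 1 / 4 * r by lra.
    by rewrite ler_pdivrMr.
  have pE : 0 <= p ^+ 2 * E by rewrite mulr_ge0 ?sqr_ge0.
  by move=> h; have := ler_wpM2r pE h; lra.
have W0 : quad 0 (q ^+ 2) (r ^+ 2) 0 0 (2 * q * r) (u 0) (v 0) (w 0) <= 3 / 2 * r ^+ 2 * E.
  have -> : quad 0 (q ^+ 2) (r ^+ 2) 0 0 (2 * q * r) (u 0) (v 0) (w 0) =
     (q * v 0 + r * w 0) ^+ 2 by rewrite /quad; ring.
  apply: le_trans (sqr_linear_le _ _ _ _) _; apply: ler_pM.
  - by rewrite addr_ge0 ?sqr_ge0.
  - by rewrite addr_ge0 ?sqr_ge0.
  - have : (2 * q) ^+ 2 <= r ^+ 2.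
      by rewrite ler_pXn2r ?nnegrE ?mulr_ge0 ?(ltW q0) ?(ltW r0).
    by have := sqr_ge0 r; lra.
  - by rewrite /E /energy; have := sqr_ge0 (u 0); lra.
have e1 := expR_ge0 (- (r / 2 * t)); have e2 := expR_ge0 (- (k / 24 * t)).
have b1 := ler_wpM2r e1 W0; have b2 := ler_wpM2r e2 mr.
have dec : p ^+ 2 * energy t <= p ^+ 2 * (3 * E * expR (- (k / 24 * t))).
  by apply: ler_wpM2l; [exact: sqr_ge0|exact: weak_energy_decay].
have sl := slow t.
have Wt : quad 0 (q ^+ 2) (r ^+ 2) 0 0 (2 * q * r) (u t) (v t) (w t) =
     (q * v t + r * w t) ^+ 2 by rewrite /quad; ring.
rewrite Wt in H; rewrite /mode_sq.
have Zt : (q * w t - p * u t) ^+ 2 <= 2 * (q * w t) ^+ 2 + 2 * (p * u t) ^+ 2.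
  by have := sqr_ge0 (q * w t + p * u t); lra.
have pw := mulr_ge0 (sqr_ge0 p) (sqr_ge0 (w t)).
have pu := mulr_ge0 (sqr_ge0 p) (sqr_ge0 (u t)).
(* The energy enters with 5 * 3 and the fast variable with 2 * 12, together 39; its initial value
   gives 2 * 3 / 2 = 3. *)
have : (p * v t) ^+ 2 + (q * w t - p * u t) ^+ 2 + (q * v t + r * w t) ^+ 2 <=
    5 * (p ^+ 2 * energy t) + 2 * (q * v t + r * w t) ^+ 2.
  by move: sl Zt; rewrite /energy !exprMn; lra.
move=> bnd; apply: le_trans bnd _; lra.
Qed.

End Weak.

End ModeODE.

(** * Decay of one mode under strong coupling *)

Section StrongCoupling.
Variable R : realType.
Variables (p g : R) (u v w : R -> R).
Hypotheses (uc : continuous u) (vc : continuous v) (wc : continuous w).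
Hypothesis hu : forall t : R, 0 < t -> is_derive t 1 u (p * v t).
Hypothesis hv : forall t : R, 0 < t -> is_derive t 1 v (p * g * w t - p * u t).
Hypothesis hw : forall t : R, 0 < t -> is_derive t 1 w (- (p * g * v t) - p * w t).
Hypotheses (p0 : 0 < p) (g3 : 3 <= g).

Let h := g ^+ 2 + 1.
Let m := h^-1.
Let y := g / h.

Let g0 : 0 < g. Proof. by move: g3; lra. Qed.
Let h10 : 10 <= h. Proof. by rewrite /h; move: g3; nra. Qed.
Let h0 : 0 < h. Proof. by move: h10; lra. Qed.
Let m0 : 0 < m. Proof. by rewrite invr_gt0. Qed.
Let m10 : m <= 1 / 10.
Proof. by rewrite /m div1r lef_pV2 ?posrE //. Qed.
Let y0 : 0 < y. Proof. by rewrite divr_gt0. Qed.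
Let ysq : y ^+ 2 = m * (1 - m).
Proof. by rewrite /y /m /h; field; rewrite gt_eqF. Qed.
Let y3 : y <= 1 / 3.
Proof.
rewrite -(@ler_pXn2r _ 2) ?nnegrE ?(ltW y0) ?divr_ge0 // ysq.
by move: m0 m10; nra.
Qed.

(* For large [g] the matrix has an eigenvalue close to [- p / h], whose left
   eigenvector is nearly (g, 0, 1), and a complex pair with real part of order
   [- p], whose left invariant plane is nearly that of [fast1] and [fast2]. *)
Definition slow t : R := (g * u t + w t) / h.
Definition fast1 t : R := v t + y * w t.
Definition fast2 t : R := w t - slow t.

Let sc : continuous slow.
Proof.
move=> t; apply: cvgM; last exact: cvg_cst.
by apply: cvgD; [apply: cvgM; [exact: cvg_cst|exact: uc]|exact: wc].
Qed.
Let xc : continuous fast1.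
Proof.
by move=> t; apply: cvgD; [exact: vc|apply: cvgM; [exact: cvg_cst|exact: wc]].
Qed.
Let ec : continuous fast2.
Proof. by move=> t; apply: cvgB; [exact: wc|exact: sc]. Qed.

Let hs (t : R) : 0 < t -> is_derive t 1 slow (- (p * m * (fast2 t + slow t))).
Proof.
move=> t0; have slowE : slow = m *: (g *: u + w).
  by apply/funext => s; rewrite /slow mulrC.
have d := is_deriveZ m (is_deriveD (is_deriveZ g (hu t0)) (hw t0)).
have {}d : is_derive t 1 slow (m *: (g *: (p * v t) + (- (p * g * v t) - p * w t))).
  by rewrite slowE.
apply: (is_derive_eq d).
by rewrite /fast2 /GRing.scale /=; ring.
Qed.
Let he (t : R) : 0 < t -> is_derive t 1 fast2 (- (p * g * fast1 t)).
Proof.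
move=> t0; have d := is_deriveB (hw t0) (hs t0).
apply: (is_derive_eq d); rewrite /fast1 /fast2 /y /m /h.
by field; rewrite gt_eqF.
Qed.
Let hx (t : R) : 0 < t -> is_derive t 1 fast1
  (p * (h / g * fast2 t - (1 - m) * fast1 t - y * m * (fast2 t + slow t))).
Proof.
move=> t0; have d := is_deriveD (hv t0) (is_deriveZ y (hw t0)).
apply: (is_derive_eq d); rewrite /fast1 /fast2 /slow /y /m /h /GRing.scale /=.
by field; rewrite !gt_eqF.
Qed.

(** In the derivative of x^2 + B e^2 - j x e, with x = [fast1] and e = [fast2], this [B] cancels the
    large cross term between h / g and g. The small cross coefficient [j] transfers dissipation from
    x, which has it, to e, which has none: j g = 1/2 and j h / g = B / 2. *)
Let B := h / g ^+ 2.
Let j := (2 * g)^-1.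
Let B1 : 1 <= B <= 10 / 9.
Proof.
have g2 : 9 <= g ^+ 2 by move: g3; nra.
have g20 : 0 < g ^+ 2 by lra.
by rewrite /B ler_pdivlMr // ler_pdivrMr // /h; apply/andP; split; lra.
Qed.
Let j0 : 0 < j. Proof. by rewrite invr_gt0 mulr_gt0. Qed.
Let j6 : j <= 1 / 6.
Proof. by rewrite /j div1r lef_pV2 ?posrE ?mulr_gt0 //; move: g3; lra. Qed.

Definition fast_quad t := quad 1 B 0 (- j) 0 0 (fast1 t) (fast2 t) (slow t).

Let fast_quad_ge t : 4 / 5 * (fast1 t ^+ 2 + fast2 t ^+ 2) <= fast_quad t.
Proof.
rewrite /fast_quad /quad; have /andP[b1 b2] := B1.
have j00 := j0; have j66 := j6.
have := @cross_ge _ (- j) (1/3) (fast1 t) (fast2 t) ltac:(lra) ltac:(lra).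
have := ler_wpM2r (sqr_ge0 (fast2 t)) b1.
have := sqr_ge0 (fast1 t); have := sqr_ge0 (fast2 t); move=> *; lra.
Qed.

Let fast_quad_le t : fast_quad t <= 5 / 4 * (fast1 t ^+ 2 + fast2 t ^+ 2).
Proof.
rewrite /fast_quad /quad; have /andP[b1 b2] := B1.
have j00 := j0; have j66 := j6.
have := @cross_ge _ j (1/6) (fast1 t) (fast2 t) ltac:(lra) ltac:(lra).
have := ler_wpM2r (sqr_ge0 (fast2 t)) b2.
have := sqr_ge0 (fast1 t); have := sqr_ge0 (fast2 t); move=> *; lra.
Qed.

(** The slow variable enters only through y m x s and m^2 e s. Completing squares, and using y^2 <=
    m, its cost is of order m^3 s^2. *)
Let fast_dissipation (x e s : R) :
  2 * (x * (h / g * e - (1 - m) * x - y * m * (e + s))) + 2 * B * (e * (- (g * x)))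
  - j * (x * (- (g * x)) + e * (h / g * e - (1 - m) * x - y * m * (e + s)))
  <= - (1 / 5 * quad 1 B 0 (- j) 0 0 x e s) + 11 * m ^+ 3 * s ^+ 2.
Proof.
have -> : 2 * (x * (h / g * e - (1 - m) * x - y * m * (e + s))) + 2 * B * (e * (- (g * x)))
  - j * (x * (- (g * x)) + e * (h / g * e - (1 - m) * x - y * m * (e + s))) =
  - (2 * (1 - m) - 1 / 2) * x ^+ 2 - (B / 2 - m ^+ 2 / 2) * e ^+ 2
  + (y / 2 - 2 * y * m) * x * e - 2 * y * m * (x * s) + m ^+ 2 / 2 * (e * s).
  have hn : g ^+ 2 + 1 != 0 by rewrite -/h gt_eqF.
  by rewrite /B /j /y /m /h; field; rewrite hn gt_eqF.
rewrite /quad; have /andP[b1 b2] := B1.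
have [m00 m11 y00 y33] : [/\ 0 < m, m <= 1 / 10, 0 < y & y <= 1 / 3] by split.
have [j00 j66] : 0 < j /\ j <= 1 / 6 by split.
have ym : 0 <= y * m <= 1 / 30 by apply/andP; split; nra.
have /andP[ym0 ym1] := ym.
have h1 := @cross_ge _ (- (y / 2 - 2 * y * m - j / 5)) (1/4) x e ltac:(lra) ltac:(lra).
have h2 := sqr_ge0 (x + 2 * y * m * s).
have h3 : y ^+ 2 * m ^+ 2 * s ^+ 2 <= m ^+ 3 * s ^+ 2.
  rewrite ysq ler_wpM2r ?sqr_ge0 //.
  have -> : m * (1 - m) * m ^+ 2 = (1 - m) * m ^+ 3 by ring.
  by rewrite ler_piMl ?exprn_ge0 ?(ltW m00) //; lra.
have h4 := sqr_ge0 (e / 4 - m ^+ 2 * s).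
have h5 : m ^+ 4 * s ^+ 2 <= m ^+ 3 * s ^+ 2.
  rewrite ler_wpM2r ?sqr_ge0 // [m ^+ 4]exprS ler_piMl ?exprn_ge0 ?(ltW m00) //; lra.
have h6 := mulr_ge0 (exprn_ge0 3 (ltW m00)) (sqr_ge0 s).
have h7 : m * x ^+ 2 <= 1 / 10 * x ^+ 2 by rewrite ler_wpM2r ?sqr_ge0.
have h8 : m ^+ 2 * e ^+ 2 <= 1 / 100 * e ^+ 2 by rewrite ler_wpM2r ?sqr_ge0 //; nra.
have h9 := ler_wpM2r (sqr_ge0 e) b1.
have xx := sqr_ge0 x; have ee := sqr_ge0 e.
lra.
Qed.

Let E := energy u v w 0.
Let E0 : 0 <= E. Proof. exact: energy_ge0. Qed.

(** The weight h matches the size h^(-1/2) that [slow] can have at time 0. The weight 10 pays for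
    the cross term 2 s e produced by the slow equation. *)
Let sP := fun t => h * slow t ^+ 2 + 10 * fast_quad t.

Let fast0 : fast_quad 0 <= 4 * E.
Proof.
apply: le_trans (fast_quad_le 0) _.
have f1 : fast1 0 ^+ 2 <= 10 / 9 * E.
  have -> : fast1 0 = 1 * v 0 + y * w 0 by rewrite /fast1 mul1r.
  apply: le_trans (sqr_linear_le _ _ _ _) _; apply: ler_pM.
  - by rewrite addr_ge0 ?sqr_ge0.
  - by rewrite addr_ge0 ?sqr_ge0.
  - by have := y0; have := y3; nra.
  - by rewrite /E /energy; have := sqr_ge0 (u 0); lra.
have f2 : fast2 0 ^+ 2 <= E.
  have -> : fast2 0 = (- y) * u 0 + (1 - m) * w 0.
    by rewrite /fast2 /slow /y /m; field; rewrite gt_eqF.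
  apply: le_trans (sqr_linear_le _ _ _ _) _; rewrite -[E]mul1r; apply: ler_pM.
  - by rewrite addr_ge0 ?sqr_ge0.
  - by rewrite addr_ge0 ?sqr_ge0.
  - by rewrite sqrrN ysq; have := m0; have := m10; nra.
  - by rewrite /E /energy; have := sqr_ge0 (v 0); lra.
by have := E0; lra.
Qed.

(** y^2 + m^2 = m = 1 / h makes the weighted slow part at most E, and the fast part is at most 10 *
    4 E. *)
Let sP0 : sP 0 <= 41 * E.
Proof.
rewrite /sP; have f := fast0.
suff : h * slow 0 ^+ 2 <= E by lra.
have -> : h * slow 0 ^+ 2 = (y * u 0 + m * w 0) ^+ 2 * h.
  by rewrite /slow /y /m; field; rewrite gt_eqF.
have := sqr_linear_le y m (u 0) (w 0).
have -> : y ^+ 2 + m ^+ 2 = m by rewrite ysq; ring.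
move=> /(ler_wpM2r (ltW h0)) /le_trans; apply.
have -> : m * (u 0 ^+ 2 + w 0 ^+ 2) * h = u 0 ^+ 2 + w 0 ^+ 2.
  by rewrite /m; field; rewrite gt_eqF.
by rewrite /E /energy; have := sqr_ge0 (v 0); lra.
Qed.

Let sP_decay t : 0 <= t -> sP t <= 41 * E * expR (- (p * m / 2 * t)).
Proof.
move=> t0.
have pm0 : 0 < p * m by rewrite mulr_gt0.
have sPE s : sP s = quad 10 (10 * B) h (- (10 * j)) 0 0 (fast1 s) (fast2 s) (slow s).
  by rewrite /sP /fast_quad /quad; ring.
have := @quad_compare _ 10 (10 * B) h (- (10 * j)) 0 0 fast1 fast2 slow _ _ _ (p * m / 2) 0 0
  xc ec sc hx he hs ltac:(by rewrite divr_gt0) (lexx _) (lexx _)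
  ltac:(by rewrite !divr_ge0 // ltW) _ t t0.
rewrite mulr0 !mul0r addr0 -!sPE => H.
apply: le_trans (H _) _; last by rewrite ler_wpM2r ?expR_ge0.
move=> s s0; cbv beta; rewrite -sPE.
have fd := fast_dissipation (fast1 s) (fast2 s) (slow s).
have fge := fast_quad_ge s.
rewrite -/(fast_quad s) in fd; rewrite /sP.
move: (fast1 s) (fast2 s) (slow s) (fast_quad s) fd fge => x e z G.
set FD := (X in X <= _) => fd fge.
have -> : 2 * 10 * (x * (p * (h / g * e - (1 - m) * x - y * m * (e + z)))) +
    2 * (10 * B) * (e * (- (p * g * x))) + 2 * h * (z * (- (p * m * (e + z)))) +
    - (10 * j) * (x * (- (p * g * x)) + e * (p * (h / g * e - (1 - m) * x - y * m * (e + z)))) +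
    0 * (x * (- (p * m * (e + z))) + z * (p * (h / g * e - (1 - m) * x - y * m * (e + z)))) +
    0 * (e * (- (p * m * (e + z))) + z * (- (p * g * x))) =
    p * (10 * FD - 2 * z * (e + z)).
  have hm : h * m = 1 by rewrite mulfV ?gt_eqF.
  have -> : 2 * h * (z * (- (p * m * (e + z)))) = - (2 * (h * m) * p * z * (e + z)) by ring.
  by rewrite hm /FD; ring.
rewrite mul0r addr0.
have -> : - (p * m / 2 * (h * z ^+ 2 + 10 * G)) = p * (- (z ^+ 2 / 2) - 5 * m * G).
  have -> : - (p * m / 2 * (h * z ^+ 2 + 10 * G)) =
      p * (- (h * m * z ^+ 2 / 2) - 5 * m * G) by field.
  by rewrite mulfV ?gt_eqF // mul1r.
rewrite ler_wpM2l ?(ltW p0) //.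
have [mp m1] : 0 < m /\ m <= 1 / 10 by split.
have G0 : 0 <= G by have := sqr_ge0 x; have := sqr_ge0 e; lra.
have h1 := ler_wpM2r G0 m1.
have h2 := sqr_ge0 (e + z); have h3 := sqr_ge0 x.
have m3 : m ^+ 3 <= 1 / 1000.
  have -> : 1 / 1000 = (1 / 10) ^+ 3 :> R by field.
  by rewrite ler_pXn2r ?nnegrE ?(ltW mp) ?divr_ge0.
have h4 := ler_wpM2r (sqr_ge0 z) m3; have h5 := sqr_ge0 z.
lra.
Qed.

(** Bootstrap: the decay of [sP] gives s^2 <= 41 m E exp(- p m t / 2), and inserting this in the
    source 11 m^3 s^2 shows that the slowly decaying part of the fast variables is only of order
    m^4. Here 451 = 11 * 41 and 4510 = 10 * 451. *)
Let fast_decay t : 0 <= t -> fast_quad t <= 4 * E * expR (- (p / 5 * t)) +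
  4510 * m ^+ 4 * E * expR (- (p * m / 2 * t)).
Proof.
move=> t0; have [mp m1] : 0 < m /\ m <= 1 / 10 by split.
have [pp E00] : 0 < p /\ 0 <= E by split.
pose M := 451 * p * m ^+ 4 * E.
have M0 : 0 <= M.
  apply: mulr_ge0 (E00); apply: mulr_ge0; last exact: exprn_ge0 (ltW mp).
  by apply: mulr_ge0; [exact: ler0n|exact: ltW].
have pm : p * m <= p * (1 / 10) by rewrite ler_wpM2l // ltW.
have := @quad_compare _ 1 B 0 (- j) 0 0 fast1 fast2 slow _ _ _ (p / 5) M (p * m / 2)
  xc ec sc hx he hs ltac:(by rewrite divr_gt0) M0
  ltac:(by apply: divr_ge0 => //; apply: mulr_ge0; exact: ltW) ltac:(lra) _ t t0.
rewrite -!/(fast_quad _).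
have -> : 2 * M / (p / 5) = 4510 * m ^+ 4 * E by rewrite /M; field; rewrite gt_eqF.
move=> H; apply: le_trans (H _) _; last first.
  by rewrite lerD2r ler_wpM2r ?expR_ge0.
move=> s s0; cbv beta; have fd := fast_dissipation (fast1 s) (fast2 s) (slow s).
have fge := fast_quad_ge s; have := sP_decay (ltW s0).
rewrite -/(fast_quad s) in fd *; rewrite /sP.
move: (fast1 s) (fast2 s) (slow s) (fast_quad s) (expR _) fd fge => x e z G ex.
set FD := (X in X <= _) => fd fge sd.
have -> : 2 * 1 * (x * (p * (h / g * e - (1 - m) * x - y * m * (e + z)))) +
    2 * B * (e * (- (p * g * x))) + 2 * 0 * (z * (- (p * m * (e + z)))) +
    - j * (x * (- (p * g * x)) + e * (p * (h / g * e - (1 - m) * x - y * m * (e + z)))) +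
    0 * (x * (- (p * m * (e + z))) + z * (p * (h / g * e - (1 - m) * x - y * m * (e + z)))) +
    0 * (e * (- (p * m * (e + z))) + z * (- (p * g * x))) = p * FD.
  by rewrite /FD; ring.
have G0 : 0 <= G by have := sqr_ge0 x; have := sqr_ge0 e; lra.
have zle : z ^+ 2 <= m * (41 * E * ex).
  have := ler_wpM2l (ltW mp) sd; have -> : m * (h * z ^+ 2 + 10 * G) = h * m * z ^+ 2 + 10 * (m * G).
    by ring.
  rewrite mulfV ?gt_eqF // mul1r; have := mulr_ge0 (ltW mp) G0; lra.
have m30 : 0 <= 11 * m ^+ 3 by apply: mulr_ge0 => //; rewrite exprn_ge0 // ltW.
have h1 := ler_wpM2l m30 zle.
have -> : - (p / 5 * G) + M * ex = p * (- (1 / 5 * G) + 11 * m ^+ 3 * (m * (41 * E * ex))).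
  by rewrite /M; field.
by rewrite ler_wpM2l ?(ltW p0) //; lra.
Qed.

(** In the fast and slow variables the three rows of M / p are x - y w, (h / g) e and g x + m w,
    with w = e + s. The slow variable therefore contributes m s^2, of order m^2, which is the square
    of the small eigenvalue in units of p. *)
Lemma strong_mode_decay t : 0 <= t -> mode_sq p (p * g) p (u t) (v t) (w t) <=
  (16 * (p ^+ 2 * (g ^+ 2 + 1) * expR (- (p / 5 * t))) +
   2200 * ((p / (g ^+ 2 + 1)) ^+ 2 * expR (- (p / (g ^+ 2 + 1) / 2 * t)))) *
  energy u v w 0.
Proof.
move=> t0; have fd := fast_decay t0; have sd := sP_decay t0.
have [mp m1] : 0 < m /\ m <= 1 / 10 by split.
have [hp E00 gp] : [/\ 10 <= h, 0 <= E & 0 < g] by split.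
rewrite -/h -/m -/E.
set e1 := expR (- (p / 5 * t)) in fd *; set e2 := expR (- (p * m / 2 * t)) in fd sd *.
have fge := fast_quad_ge t; rewrite /sP in sd.
have hn : g ^+ 2 + 1 != 0 by rewrite -/h gt_eqF.
have ws : fast2 t + slow t = w t by rewrite /fast2 subrK.
have vE : v t = fast1 t - y * (fast2 t + slow t) by rewrite ws /fast1 addrK.
have uE : g * w t - u t = h / g * fast2 t.
  by rewrite /fast2 /slow /h; field; rewrite hn gt_eqF.
have wE : g * v t + w t = g * fast1 t + m * (fast2 t + slow t).
  by rewrite ws /fast1 /y /m /h; field; rewrite hn.
have -> : mode_sq p (p * g) p (u t) (v t) (w t) =
    p ^+ 2 * (v t ^+ 2 + (g * w t - u t) ^+ 2 + (g * v t + w t) ^+ 2).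
  by rewrite /mode_sq; ring.
rewrite uE wE vE; move: (fast1 t) (fast2 t) (slow t) (fast_quad t) fd sd fge => x e z G fd sd fge.
have G0 : 0 <= G by have := sqr_ge0 x; have := sqr_ge0 e; lra.
have /andP[_ B2] := B1.
have a1 : (x - y * (e + z)) ^+ 2 <= 2 * x ^+ 2 + 2 * (m * (2 * e ^+ 2 + 2 * z ^+ 2)).
  have y2 : y ^+ 2 <= m by rewrite ysq; have := sqr_ge0 m; lra.
  have := ler_wpM2r (sqr_ge0 (e + z)) y2; have := sqr_ge0 (x + y * (e + z)).
  by have := mulr_ge0 (ltW mp) (sqr_ge0 (e - z)); lra.
have a2 : (h / g * e) ^+ 2 <= 10 / 9 * (h * e ^+ 2).
  have -> : (h / g * e) ^+ 2 = B * (h * e ^+ 2) by rewrite /B; field; rewrite gt_eqF.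
  by rewrite ler_wpM2r // mulr_ge0 ?sqr_ge0 //; lra.
have a3 : (g * x + m * (e + z)) ^+ 2 <= 2 * (h * x ^+ 2) + 2 * (m * (2 * e ^+ 2 + 2 * z ^+ 2)).
  have gh : g ^+ 2 <= h by rewrite /h lerDl.
  have mm : m ^+ 2 <= m by rewrite expr2 ler_piMr ?(ltW mp) //; lra.
  have := ler_wpM2r (sqr_ge0 x) gh; have := ler_wpM2r (sqr_ge0 (e + z)) mm.
  have := mulr_ge0 (ltW mp) (sqr_ge0 (e - z)).
  by have := sqr_ge0 (g * x - m * (e + z)); lra.
have zle : z ^+ 2 <= m * (41 * E * e2).
  have := ler_wpM2l (ltW mp) sd; have -> : m * (h * z ^+ 2 + 10 * G) = h * m * z ^+ 2 + 10 * (m * G).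
    by ring.
  rewrite mulfV ?gt_eqF // mul1r; have := mulr_ge0 (ltW mp) G0; lra.
have a4 : (x - y * (e + z)) ^+ 2 + (h / g * e) ^+ 2 + (g * x + m * (e + z)) ^+ 2 <=
    4 * (h * G) + 8 * (m * z ^+ 2).
  have x1 := ler_wpM2r (sqr_ge0 x) hp; have e10 := ler_wpM2r (sqr_ge0 e) hp.
  have em := ler_wpM2r (sqr_ge0 e) m1.
  have := ler_wpM2l (ltW h0) fge; have := sqr_ge0 x; have := sqr_ge0 e.
  lra.
have a5 := ler_wpM2l (ltW mp) zle; have a6 := ler_wpM2l (ltW h0) fd.
have e20 : 0 <= e2 by exact: expR_ge0.
have mE : 0 <= m ^+ 2 * (E * e2) by apply: mulr_ge0; [exact: sqr_ge0|exact: mulr_ge0].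
have a7 : h * (4510 * m ^+ 4 * E * e2) <= 451 * (m ^+ 2 * (E * e2)).
  have -> : h * (4510 * m ^+ 4 * E * e2) = h * m * (4510 * m) * (m ^+ 2 * (E * e2)) by ring.
  by rewrite mulfV ?gt_eqF // mul1r ler_wpM2r //; lra.
(* The fast part costs 4 * 4 = 16; the slow part 4 * 451 + 8 * 41 = 2132, rounded up to 2200. *)
have -> : (16 * (p ^+ 2 * h * e1) + 2200 * ((p * m) ^+ 2 * e2)) * E =
    p ^+ 2 * (16 * (h * (e1 * E)) + 2200 * (m ^+ 2 * (E * e2))) by ring.
rewrite ler_wpM2l ?sqr_ge0 //; apply: le_trans a4 _; lra.
Qed.

End StrongCoupling.

(** * From exponential decay to powers of t *)

Section ModeSmoothing.
Variable R : realType.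
Implicit Types p q r g b t : R.

(** y <= exp y at y = c x t / b, raised to the power b; the constant (b / c)^b comes from the
    substitution. *)
Lemma expR_decay (b c : R) : 0 < b -> 0 < c -> exists2 C, 0 <= C &
  forall x t, 0 <= x -> 0 < t -> x `^ b * expR (- (c * x * t)) <= C * t `^ (- b).
Proof.
move=> b0 c0; exists ((b / c) `^ b); first exact: powR_ge0.
move=> x t x0 t0.
have xE : x = (c * x * t / b) * ((b / c) * t^-1) by field; rewrite !gt_eqF.
have y0 : 0 <= c * x * t / b by rewrite !mulr_ge0 ?invr_ge0 // ltW.
have bc0 : 0 <= b / c by rewrite divr_ge0 // ltW.
have ti0 : 0 <= t^-1 by rewrite invr_ge0 ltW.
have -> : x `^ b = (c * x * t / b) `^ b * ((b / c) `^ b * t^-1 `^ b).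
  by rewrite -(powRM b bc0 ti0) -(powRM b y0 (mulr_ge0 bc0 ti0)) -xE.
have -> : t^-1 `^ b = t `^ (- b).
  by rewrite -powR_inv1 ?(ltW t0) // -powRrM mulN1r.
rewrite mulrAC ler_piMl ?mulr_ge0 ?powR_ge0 //.
rewrite expRN ler_pdivrMr ?expR_gt0 // mul1r.
have -> : expR (c * x * t) = expR (c * x * t / b) `^ b.
  by rewrite -expRM; congr expR; field; rewrite gt_eqF.
rewrite ge0_ler_powR ?nnegrE ?expR_ge0 ?(ltW b0) //.
by have := expR_ge1Dx (c * x * t / b); lra.
Qed.

Lemma powRN_le_powRN t b c : 0 < t -> t <= 1 -> b <= c -> t `^ (- b) <= t `^ (- c).
Proof.
by move=> t0 t1 bc; rewrite ger_powR ?t0 ?t1 // lerN2.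
Qed.

(** For t <= 1 the exponent may be enlarged from b to d; fast terms, which only cost 1/t, are
    thereby brought to the common rate. *)
Lemma expR_decay_sq (d b c : R) : 0 < b -> b <= d -> 0 < c -> exists2 C, 0 <= C &
  forall x t, 0 <= x -> 0 < t -> t <= 1 ->
    (x `^ b) ^+ 2 * expR (- (c * x * t)) <= C * (t `^ (- d)) ^+ 2.
Proof.
move=> b0 bd c0; have [C C0 HC] := @expR_decay (b * 2) c (mulr_gt0 b0 (ltr0n _ 2)) c0.
exists C => // x t x0 t0 t1.
rewrite -powR_mulrn ?powR_ge0 // -powRrM (le_trans (HC _ _ x0 t0)) // ler_wpM2l //.
rewrite -powR_mulrn ?powR_ge0 // -powRrM mulNr powRN_le_powRN // ler_wpM2r //.
Qed.

Lemma ode_estimate_le p q r (K K' b : R) : 0 <= K -> K <= K' ->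
  ode_estimate p q r K b -> ode_estimate p q r K' b.
Proof.
move=> K0 KK h y1 y2 y3 c1 c2 c3 d1 d2 d3 t t0 t1.
apply: le_trans (h _ _ _ c1 c2 c3 d1 d2 d3 t t0 t1) _.
apply: ler_wpM2r; first by rewrite !addr_ge0 ?sqr_ge0.
have K'0 := le_trans K0 KK.
by rewrite ler_pXn2r ?nnegrE ?mulr_ge0 ?powR_ge0 // ler_wpM2r ?powR_ge0.
Qed.

Lemma ode_estimate_of_sq p q r (C b : R) : 0 <= C ->
  (forall y1 y2 y3 : R -> R,
  continuous y1 -> continuous y2 -> continuous y3 ->
  (forall t : R, 0 < t -> is_derive t 1 y1 (p * y2 t)) ->
  (forall t : R, 0 < t -> is_derive t 1 y2 (q * y3 t - p * y1 t)) ->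
  (forall t : R, 0 < t -> is_derive t 1 y3 (- (q * y2 t) - r * y3 t)) ->
  forall t : R, 0 < t -> t <= 1 ->
    mode_sq p q r (y1 t) (y2 t) (y3 t) <= C * (t `^ (- b)) ^+ 2 * energy y1 y2 y3 0) ->
  ode_estimate p q r (Num.sqrt C) b.
Proof.
move=> C0 h y1 y2 y3 c1 c2 c3 d1 d2 d3 t t0 t1.
by rewrite exprMn sqr_sqrtr //; exact: h.
Qed.

Lemma bounded_ode_estimate (B b : R) : 0 <= B -> 0 <= b -> exists2 K, 0 <= K &
  forall p q r, 0 <= p -> 0 <= q -> 0 <= r -> p <= B -> q <= B -> r <= B ->
  ode_estimate p q r K b.
Proof.
move=> B0 b0; exists (Num.sqrt (7 * B ^+ 2)); first exact: sqrtr_ge0.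
move=> p q r p0 q0 r0 pB qB rB; apply: ode_estimate_of_sq; first by rewrite mulr_ge0 ?sqr_ge0.
move=> y1 y2 y3 c1 c2 c3 d1 d2 d3 t t0 t1.
have E0 := energy_ge0 y1 y2 y3.
apply: le_trans (mode_sq_le _ _ _ _ _ _) _.
have en := energy_noninc c1 c2 c3 d1 d2 d3 r0 (ltW t0).
have sq x : 0 <= x -> x <= B -> x ^+ 2 <= B ^+ 2 by move=> x0 xB; rewrite ler_pXn2r ?nnegrE.
have c : 2 * p ^+ 2 + 2 * q ^+ 2 + 2 * r ^+ 2 + p ^+ 2 <= 7 * B ^+ 2.
  by have := sq _ p0 pB; have := sq _ q0 qB; have := sq _ r0 rB; lra.
have c0 : 0 <= 2 * p ^+ 2 + 2 * q ^+ 2 + 2 * r ^+ 2 + p ^+ 2.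
  by have := sqr_ge0 p; have := sqr_ge0 q; have := sqr_ge0 r; lra.
have tb : 1 <= (t `^ (- b)) ^+ 2.
  rewrite expr_ge1 ?powR_ge0 //; have := @powRN_le_powRN t 0 b t0 t1 b0.
  by rewrite oppr0 powRr0.
apply: le_trans (ler_wpM2l c0 en) _; apply: ler_wpM2r => //; apply: le_trans c _.
by rewrite ler_peMr // mulr_ge0 ?sqr_ge0.
Qed.

(** The slow part p^2 exp(- k t / 24) is of order t^(-2b) because p is at most of order k^b; the
    fast part r^2 exp(- r t / 2) is of order t^(-2) whatever the size of r. *)
Lemma weak_ode_estimate (C1 b : R) : 0 <= C1 -> 1 <= b -> exists2 K, 0 <= K &
  forall p q r, 0 < p -> 0 < q -> 0 < r -> p <= r -> 2 * q <= r -> q ^+ 2 <= r * p ->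
  p <= C1 * (q ^+ 2 / r) `^ b -> ode_estimate p q r K b.
Proof.
move=> C10 b1; have b0 : 0 < b by exact: lt_le_trans b1.
have [Ca Ca0 HCa] := @expR_decay_sq b b (24^-1) b0 (lexx _) ltac:(by rewrite invr_gt0).
have [Cb Cb0 HCb] := @expR_decay_sq b 1 (2^-1) ltr01 b1 ltac:(by rewrite invr_gt0).
have C0 : 0 <= 39 * (C1 ^+ 2 * Ca) + 3 * Cb.
  by apply: addr_ge0; rewrite !mulr_ge0 ?sqr_ge0.
exists (Num.sqrt (39 * (C1 ^+ 2 * Ca) + 3 * Cb)); first exact: sqrtr_ge0.
move=> p q r p0 q0 r0 pr qr qrp pk; apply: ode_estimate_of_sq => //.
move=> y1 y2 y3 c1 c2 c3 d1 d2 d3 t t0 t1.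
have E0 := energy_ge0 y1 y2 y3.
set k := q ^+ 2 / r in pk; have k0 : 0 <= k by rewrite divr_ge0 ?sqr_ge0 // ltW.
apply: le_trans (weak_mode_decay c1 c2 c3 d1 d2 d3 p0 q0 r0 pr qr qrp (erefl k) (ltW t0)) _.
apply: ler_wpM2r => //.
have h1 : p ^+ 2 * expR (- (k / 24 * t)) <= C1 ^+ 2 * Ca * (t `^ (- b)) ^+ 2.
  have := ler_wpM2l (sqr_ge0 C1) (HCa _ _ k0 t0 t1).
  rewrite (mulrC _ k) [leRHS]mulrA => hC; apply: (le_trans _ hC).
  rewrite mulrA -exprMn; apply: ler_wpM2r; first exact: expR_ge0.
  by rewrite ler_pXn2r ?nnegrE ?mulr_ge0 ?powR_ge0 // ltW.
have h2 : r ^+ 2 * expR (- (r / 2 * t)) <= Cb * (t `^ (- b)) ^+ 2.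
  by have := HCb _ _ (ltW r0) t0 t1; rewrite powRr1 ?(ltW r0) // (mulrC _ r).
by move: h1 h2; move: (expR _) (expR _) (t `^ _) => e1 e2 x; lra.
Qed.

(** The fast part has amplitude p^2 (g^2 + 1) <= 2 (p g)^2 = 2 p^(2b) and rate p / 5; the slow part
    has amplitude k^2 and rate k / 2, hence order t^(-2). *)
Lemma strong_ode_estimate (b : R) : 1 <= b -> exists2 K, 0 <= K &
  forall p g, 0 < p -> 3 <= g -> p * g = p `^ b -> ode_estimate p (p * g) p K b.
Proof.
move=> b1; have b0 : 0 < b by exact: lt_le_trans b1.
have [Ca Ca0 HCa] := @expR_decay_sq b b (5^-1) b0 (lexx _) ltac:(by rewrite invr_gt0).
have [Cb Cb0 HCb] := @expR_decay_sq b 1 (2^-1) ltr01 b1 ltac:(by rewrite invr_gt0).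
have C0 : 0 <= 32 * Ca + 2200 * Cb by lra.
exists (Num.sqrt (32 * Ca + 2200 * Cb)); first exact: sqrtr_ge0.
move=> p g p0 g3 pg; apply: ode_estimate_of_sq => //.
move=> y1 y2 y3 c1 c2 c3 d1 d2 d3 t t0 t1.
have E0 := energy_ge0 y1 y2 y3.
have g0 : 0 < g by lra.
have h0 : 0 < g ^+ 2 + 1 by rewrite ltr_wpDl ?sqr_ge0.
set k := p / (g ^+ 2 + 1); have k0 : 0 <= k by rewrite divr_ge0 ?ltW.
apply: le_trans (strong_mode_decay c1 c2 c3 d1 d2 d3 p0 g3 (ltW t0)) _.
apply: ler_wpM2r => //; rewrite -/k.
have h1 : p ^+ 2 * (g ^+ 2 + 1) * expR (- (p / 5 * t)) <= 2 * (Ca * (t `^ (- b)) ^+ 2).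
  apply: (@le_trans _ _ (2 * ((p `^ b) ^+ 2 * expR (- (5^-1 * p * t))))); last first.
    by rewrite ler_pM2l //; exact: (HCa _ _ (ltW p0) t0 t1).
  rewrite -pg mulrA (mulrC _ p); apply: ler_wpM2r; first exact: expR_ge0.
  have g1 : 1 <= g ^+ 2 by rewrite expr_ge1 //; lra.
  by rewrite exprMn; have := ler_wpM2l (sqr_ge0 p) g1; lra.
have h2 : k ^+ 2 * expR (- (k / 2 * t)) <= Cb * (t `^ (- b)) ^+ 2.
  by have := HCb _ _ k0 t0 t1; rewrite powRr1 // (mulrC _ k).
by move: h1 h2; move: (expR (- (p / 5 * t))) (expR _) (t `^ _) => e1 e2 x; lra.
Qed.

End ModeSmoothing.

(** * Bounds uniform in the eigenvalue, for the three parameter ranges *)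

Section ModeBounds.
Variable R : realType.
Local Open Scope complex_scope.
Notation C3 := (R[i] * R[i] * R[i])%type.

(** The same [M] is frequency threshold, resolvent constant and smoothing constant, so that
    different regimes are merged by a maximum. *)
Definition mode_bounds (a b M p q r : R) : Prop :=
  [/\ 0 <= M,
      forall (l : R) (x : C3), M < `|l| ->
        (`|l| `^ a) ^+ 2 * nsq x <= M ^+ 2 * nsq (Complex 0 l *: x - mode p q r x) &
      ode_estimate p q r M b].

Lemma mode_bounds_le a b M M' p q r : M <= M' ->
  mode_bounds a b M p q r -> mode_bounds a b M' p q r.
Proof.
move=> MM [M0 h1 h2]; have M'0 := le_trans M0 MM; split=> //.
  move=> l x /(le_lt_trans MM)/h1; move=> h; apply: (le_trans (h _)).
  by apply: ler_wpM2r; [exact: nsq_ge0|rewrite ler_pXn2r ?nnegrE].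
exact: ode_estimate_le MM h2.
Qed.

Lemma mode_bounds_of a b K C L p q r : 0 <= K -> 0 <= C -> 1 <= L ->
  (forall (l : R) (x : C3), L < `|l| ->
     `|l| `^ a * abs_sum x <= C * abs_sum (Complex 0 l *: x - mode p q r x)) ->
  ode_estimate p q r K b -> mode_bounds a b (2 * C + L + K) p q r.
Proof.
move=> K0 C0 L1 h1 h2; split; first by lra.
  move=> l x Ll; have /h1 h : L < `|l| by lra.
  apply: le_trans (nsq_of_abs_sum (powR_ge0 _ _) C0 (h x)) _.
  apply: ler_wpM2r; first exact: nsq_ge0.
  by rewrite ler_pXn2r ?nnegrE //; lra.
by apply: ode_estimate_le h2 => //; lra.
Qed.

Lemma powR_large (c s : R) : 0 <= c -> 0 < s -> exists2 L : R, 1 <= L &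
  forall m, L <= m -> c <= m `^ s.
Proof.
move=> c0 s0; exists (Num.max 1 (c `^ s^-1)); first by rewrite le_max lexx.
move=> m; rewrite ge_max => /andP[m1 cm].
have -> : c = (c `^ s^-1) `^ s by rewrite -powRrM mulVf ?powRr1 // gt_eqF.
by rewrite ge0_ler_powR ?nnegrE ?powR_ge0 ?(ltW s0) // (le_trans ler01).
Qed.

Lemma bounded_mode_bounds (B a b : R) : 0 <= B -> a <= 1 -> 0 <= b ->
  exists M, forall p q r, 0 < p -> 0 < q -> 0 < r -> p <= B -> q <= B -> r <= B ->
  mode_bounds a b M p q r.
Proof.
move=> B0 a1 b0; have [K K0 HK] := bounded_ode_estimate B0 b0.
exists (2 * 6 + (4 * B + 1) + K) => p q r p0 q0 r0 pB qB rB.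
apply: mode_bounds_of => //; first by lra.
  move=> l x Ll; have l1 : 1 <= `|l| by lra.
  have rb := mode_resolvent_bounds l x p0 q0 r0.
  have h := neumann_bound (cmod_ge0 _) (cmod_ge0 _) (cmod_ge0 _) (normr_ge0 l) pB qB
    (ltac:(lra) : 4 * B <= `|l|) rb.
  apply: le_trans h; apply: ler_wpM2r; first exact: abs_sum_ge0.
  exact: ler1_powR.
by apply: HK; rewrite // ltW.
Qed.

(** The hypothesis on (4 p)^a serves twice: |l|^a <= C1 k for |l| <= 4 p, and p <= (C1 k)^(1/a). For
    |l| > 4 p the resolvent is of order 1 / |l|. *)
Lemma weak_mode_bounds (C1 a : R) : 0 <= C1 -> 0 < a -> a <= 1 ->
  exists M, forall p q r, 0 < p -> 0 < q -> 0 < r -> p <= r -> 2 * q <= r ->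
  q ^+ 2 <= r * p -> (4 * p) `^ a <= C1 * (q ^+ 2 / r) -> mode_bounds a (1 / a) M p q r.
Proof.
move=> C10 a0 a1; have b1 : 1 <= 1 / a by rewrite ler_pdivlMr ?mul1r.
have [K K0 HK] := weak_ode_estimate (powR_ge0 C1 (1 / a)) b1.
(* The constant of [low_freq_bound]; the 12 below is that of [high_freq_bound]. *)
have [c cE] : exists c : R, c = 741 by exists 741.
have c0 : 0 <= c by rewrite cE; exact: ler0n.
exists (2 * (12 + C1 * c) + 1 + K) => p q r p0 q0 r0 pr qr qrp pk.
have k0 : 0 <= q ^+ 2 / r by rewrite divr_ge0 ?sqr_ge0 // ltW.
have qr' : q <= r by lra.
have C0 : 0 <= C1 * c by exact: mulr_ge0.
apply: mode_bounds_of => //; first by rewrite addr_ge0.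
  move=> l x /ltW l1; have rb := mode_resolvent_bounds l x p0 q0 r0.
  have F0 := abs_sum_ge0 (Complex 0 l *: x - mode p q r x).
  have [pl|/ltW lp] := leP (4 * p) `|l|.
    have h := high_freq_bound p0 q0 r0 qr' qrp pl (cmod_ge0 _) (cmod_ge0 _) (cmod_ge0 _) F0 rb.
    apply: (@le_trans _ _ (`|l| * abs_sum x)).
      by apply: ler_wpM2r; [exact: abs_sum_ge0|exact: ler1_powR].
    apply: le_trans h _; apply: ler_wpM2r => //.
    by rewrite lerDl.
  have h := low_freq_bound p0 q0 r0 pr qr' qrp (normr_ge0 l) lp
    (cmod_ge0 _) (cmod_ge0 _) (cmod_ge0 _) F0 rb.
  rewrite -cE in h.
  have lk : `|l| `^ a <= C1 * (q ^+ 2 / r).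
    by apply: le_trans pk; rewrite ge0_ler_powR ?nnegrE ?(ltW a0) ?mulr_ge0 ?(ltW p0).
  apply: le_trans (ler_wpM2r (abs_sum_ge0 x) lk) _.
  rewrite -[leLHS]mulrA mulrDl -[X in _ <= _ + X]mulrA; apply: ler_wpDl; first by rewrite mulr_ge0.
  exact: ler_wpM2l.
apply: HK => //; rewrite -powRM //.
have -> : p = (p `^ a) `^ (1 / a).
  by rewrite -powRrM mulrCA mulfV ?gt_eqF // mulr1 powRr1 // ltW.
have C1k : 0 <= C1 * (q ^+ 2 / r) by exact: mulr_ge0.
rewrite ge0_ler_powR ?nnegrE ?powR_ge0 ?divr_ge0 ?(ltW a0) //; apply: (le_trans _ pk).
by rewrite ge0_ler_powR ?nnegrE ?(ltW a0) ?mulr_ge0 ?(ltW p0) //; lra.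
Qed.

(** Since p g = p^b, the range |l| <= 4 p g means |l|^(1/b) <= 4 p, so the term f / p of the
    resolvent bound gives the order |l|^(-1/b); beyond this range the bound 1 / |l| applies. *)
Lemma strong_mode_bounds (b : R) : 1 <= b -> exists M, forall p g, 1 <= p -> 3 <= g ->
  p * g = p `^ b -> mode_bounds (1 / b) b M p (p * g) p.
Proof.
move=> b1; have b0 : 0 < b by exact: lt_le_trans b1.
have [K K0 HK] := strong_ode_estimate b1.
(* 418 = 4 * 100 + 18, from the two terms of [coupled_low_freq_bound]. *)
have [c cE] : exists c : R, c = 418 by exists 418.
have c0 : 6 <= c by rewrite cE ler_nat.
exists (2 * c + 1 + K) => p g p1 g3 pg.
have p0 : 0 < p by exact: lt_le_trans p1.
have g0 : 0 < g by lra.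
have pg0 : 0 < p * g by exact: mulr_gt0.
have a1 : 1 / b <= 1 by rewrite ler_pdivrMr ?mul1r.
have a0 : 0 <= 1 / b by rewrite divr_ge0 // ltW.
apply: mode_bounds_of => //; [by lra| |exact: HK].
move=> l x l1; have l0 : 0 < `|l| by apply: lt_trans l1.
have lal : `|l| `^ (1 / b) <= `|l| by apply: ler1_powR => //; exact: ltW.
have rb := mode_resolvent_bounds l x p0 pg0 p0.
have F0 := abs_sum_ge0 (Complex 0 l *: x - mode p (p * g) p x).
have S0 := abs_sum_ge0 x.
have [pl|/ltW lp] := leP (4 * (p * g)) `|l|.
  have ppg : p <= p * g by rewrite ler_peMr ?(ltW p0) //; lra.
  have h := neumann_bound (cmod_ge0 _) (cmod_ge0 _) (cmod_ge0 _) (normr_ge0 l) ppg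
    (lexx _) pl rb.
  apply: le_trans (ler_wpM2r S0 lal) _; apply: le_trans h _.
  by apply: ler_wpM2r => //; lra.
have h := coupled_low_freq_bound x p1 (ltac:(lra) : 1 <= g) l0 lp.
have l4 : `|l| `^ (1 / b) <= 4 * p.
  have b44 : 4 `^ (1 / b) <= 4 :> R by apply: ler1_powR => //; lra.
  have e : (4 * (p * g)) `^ (1 / b) = 4 `^ (1 / b) * p.
    rewrite pg powRM ?powR_ge0 // -powRrM mulrCA mulfV ?gt_eqF // mulr1 powRr1 //.
    exact: ltW.
  apply: (@le_trans _ _ (4 `^ (1 / b) * p)); last by rewrite ler_pM2r.
  by rewrite -e ge0_ler_powR ?nnegrE // mulr_ge0 // ltW.
set F := abs_sum (_ - _) in h F0 *.
apply: le_trans (ler_wpM2l (powR_ge0 _ _) h) _.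
have h1 : `|l| `^ (1 / b) * (F / p) <= 4 * F.
  apply: le_trans (ler_wpM2r (divr_ge0 F0 (ltW p0)) l4) _.
  by have -> : 4 * p * (F / p) = 4 * F by field; rewrite gt_eqF.
have h2 : `|l| `^ (1 / b) * (F / `|l|) <= F.
  apply: le_trans (ler_wpM2r (divr_ge0 F0 (normr_ge0 l)) lal) _.
  by rewrite mulrC divfK ?gt_eqF.
rewrite mulrDr [X in X + _]mulrCA [X in _ + X]mulrCA cE.
by move: h1 h2; move: (_ * (F / p)) (_ * (F / `|l|)) => x1 x2; lra.
Qed.

Definition plate_mode_bounds (omega sigma a b M m : R) : Prop :=
  mode_bounds a b M (m / Num.sqrt (1 + omega * m)) (m `^ sigma / Num.sqrt (1 + omega * m)) m.

(** Below the threshold [L] the three entries are bounded by L + L^sigma, because dividing by sqrt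
    (1 + omega m) >= 1 does not increase them; one constant covers all these modes. *)
Lemma plate_mode_bounds_all (omega sigma a b L M0 : R) : 0 <= omega -> 0 <= sigma ->
  a <= 1 -> 0 <= b -> 0 <= L ->
  (forall m, L <= m -> plate_mode_bounds omega sigma a b M0 m) ->
  exists M, forall m, 0 < m -> plate_mode_bounds omega sigma a b M m.
Proof.
move=> o0 s0 a1 b0 L0 hM0.
have B0 : 0 <= L + L `^ sigma by rewrite addr_ge0 ?powR_ge0.
have [M1 hM1] := bounded_mode_bounds B0 a1 b0.
exists (Num.max M0 M1) => m m0; have [Lm|mL] := leP L m.
  by apply: mode_bounds_le (hM0 m Lm); rewrite le_max lexx.
have r1 : 1 <= Num.sqrt (1 + omega * m).
  by rewrite -[leLHS]sqrtr1 ler_wsqrtr // lerDl mulr_ge0 // ltW.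
have r0 : 0 < Num.sqrt (1 + omega * m) by exact: lt_le_trans r1.
have dle x : 0 <= x -> x / Num.sqrt (1 + omega * m) <= x.
  by move=> x0; rewrite ler_pdivrMr // ler_peMr.
have Ls : m `^ sigma <= L `^ sigma by rewrite ge0_ler_powR ?nnegrE ?(ltW m0) ?(ltW mL).
have [P1 P2 P3] : [/\ 0 <= m `^ sigma, 0 <= L `^ sigma & 0 < m] by split; rewrite ?powR_ge0.
apply: (@mode_bounds_le _ _ M1); first by rewrite le_max lexx orbT.
apply: hM1; rewrite ?divr_gt0 ?powR_gt0 //.
- by apply: le_trans (dle _ (ltW m0)) _; lra.
- by apply: le_trans (dle _ P1) _; lra.
- by lra.
Qed.

(** Here p = r = m and q^2 / r = m^(2 sigma - 1) = p^a exactly; 2 q <= r holds as soon as m^(1 -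
    sigma) >= 2. *)
Lemma kirchhoff_bounds_low (sigma : R) : 1 / 2 < sigma < 1 -> exists M, forall m, 0 < m ->
  plate_mode_bounds 0 sigma (2 * sigma - 1) (1 / (2 * sigma - 1)) M m.
Proof.
move=> /andP[s1 s2]; have a0 : 0 < 2 * sigma - 1 by lra.
have a1 : 2 * sigma - 1 <= 1 by lra.
have [M hM] := weak_mode_bounds (ler0n R 4) a0 a1.
have [L L1 hL] := @powR_large 2 (1 - sigma) (ler0n _ _) (ltac:(lra)).
apply: (@plate_mode_bounds_all _ _ _ _ L M) => //; try lra; first by rewrite divr_ge0 // ltW.
move=> m Lm; have m1 := le_trans L1 Lm; have m0 : 0 < m by exact: lt_le_trans m1.
rewrite /plate_mode_bounds mul0r addr0 sqrtr1 !divr1.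
have addE (x y : R) : m `^ (x + y) = m `^ x * m `^ y.
  by rewrite powRD //; apply/implyP => _; rewrite gt_eqF.
have h := hL m Lm; have q0 : 0 < m `^ sigma by rewrite powR_gt0.
have mE : m = m `^ (1 - sigma) * m `^ sigma by rewrite -addE subrK powRr1 // ltW.
have q2 : 2 * m `^ sigma <= m by rewrite [leRHS]mE ler_pM2r.
apply: hM => //.
- by rewrite -expr2 ler_pXn2r ?nnegrE ?(ltW q0) ?(ltW m0) //; lra.
- have -> : m `^ sigma ^+ 2 / m = m `^ (2 * sigma - 1).
    by rewrite addE powR_inv1 ?(ltW m0) // powRrM powRAC powR_mulrn // powR_ge0.
  rewrite powRM ?(ltW m0) // ler_wpM2r ?powR_ge0 //; apply: ler1_powR => //; lra.
Qed.

(** Here g = m^(sigma - 1), which exceeds 3 for large m, and p g = p^sigma. *)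
Lemma kirchhoff_bounds_high (sigma : R) : 1 < sigma -> exists M, forall m, 0 < m ->
  plate_mode_bounds 0 sigma (1 / sigma) sigma M m.
Proof.
move=> s1; have s0 : 0 < sigma by lra.
have [M hM] := strong_mode_bounds (ltW s1).
have [L L1 hL] := @powR_large 3 (sigma - 1) (ler0n _ _) (ltac:(lra)).
apply: (@plate_mode_bounds_all _ _ _ _ L M) => //; try lra.
  by rewrite ler_pdivrMr // mul1r ltW.
move=> m Lm; have m1 := le_trans L1 Lm; have m0 : 0 < m by exact: lt_le_trans m1.
rewrite /plate_mode_bounds mul0r addr0 sqrtr1 !divr1.
have mE : m * m `^ (sigma - 1) = m `^ sigma.
  rewrite -{1}(powRr1 (ltW m0)) -powRD; last by apply/implyP => _; rewrite gt_eqF.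
  by rewrite addrC subrK.
by rewrite -mE; apply: hM => //; exact: hL.
Qed.

(** For large m, p is of order m^(1/2) and q^2 / r of order m^(2 sigma - 2), that is p^a. The
    inequality q^2 <= r p compares m^(2 sigma) with m^(5/2) and explains the range sigma < 5/4. *)
Lemma inertial_bounds (omega sigma : R) : 0 < omega -> 1 < sigma < 5 / 4 ->
  exists M, forall m, 0 < m ->
  plate_mode_bounds omega sigma (4 * (sigma - 1)) (1 / (4 * (sigma - 1))) M m.
Proof.
move=> o0 /andP[s1 s2]; have a0 : 0 < 4 * (sigma - 1) by lra.
have a1 : 4 * (sigma - 1) <= 1 by lra.
(* The first factor comes from 16 p^2 <= (16 / omega) m, the second from m / (1 + omega m) >= 1 / (1
   + omega) for m >= 1. *)
pose C1 := (16 / omega) `^ (2 * sigma - 2) * (1 + omega).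
have o10 : 0 < 1 + omega by lra.
have C10 : 0 <= C1 by rewrite mulr_ge0 ?powR_ge0 // ltW.
have [M hM] := weak_mode_bounds C10 a0 a1.
have d4 : 0 <= 4 / omega by rewrite divr_ge0 // ltW.
have d1 : 0 <= 1 / omega by rewrite divr_ge0 // ltW.
(* This threshold yields 4 q^2 <= r^2, and the next one q^2 <= r p after squaring. *)
have [L1 L11 hL1] := @powR_large (4 / omega) (3 - 2 * sigma) d4 (ltac:(lra)).
have [L2 L21 hL2] := @powR_large (1 / omega) (5 - 4 * sigma) d1 (ltac:(lra)).
apply: (@plate_mode_bounds_all _ _ _ _ (Num.max L1 L2) M); try lra.
- by rewrite divr_ge0 // ltW.
- by rewrite le_max (le_trans ler01 L11).
move=> m; rewrite ge_max => /andP[Lm1 Lm2].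
have m1 := le_trans L11 Lm1; have m0 : 0 < m by exact: lt_le_trans m1.
have {hL1 Lm1} h1 := hL1 m Lm1; have {hL2 Lm2} h2 := hL2 m Lm2.
rewrite /plate_mode_bounds; set rho := Num.sqrt _.
have om : 0 < omega * m by exact: mulr_gt0.
have r2 : rho ^+ 2 = 1 + omega * m by rewrite sqr_sqrtr //; lra.
have r0 : 0 < rho by rewrite sqrtr_gt0; lra.
have rn : rho != 0 by rewrite gt_eqF.
have mn : m != 0 by rewrite gt_eqF.
have r1 : 1 <= rho by rewrite -[leLHS]sqrtr1 ler_wsqrtr //; lra.
have addE (x y : R) : m `^ (x + y) = m `^ x * m `^ y.
  by rewrite powRD //; apply/implyP => _; rewrite gt_eqF.
have q0 : 0 < m `^ sigma by rewrite powR_gt0.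
have mu2 : (m `^ sigma) ^+ 2 = m `^ (2 * sigma).
  by rewrite -powR_mulrn ?powR_ge0 // -powRrM mulrC.
have m3 : m ^+ 3 = m `^ (2 * sigma) * m `^ (3 - 2 * sigma).
  by rewrite -addE addrC subrK powR_mulrn // ltW.
have m5 : m ^+ 5 = m `^ (2 * sigma) ^+ 2 * m `^ (5 - 4 * sigma).
  rewrite -(powR_mulrn 2) ?powR_ge0 // -powRrM -addE -powR_mulrn ?(ltW m0) //.
  by congr (_ `^ _); ring.
have z0 : 0 < m `^ (2 * sigma) by rewrite powR_gt0.
apply: hM; rewrite ?divr_gt0 //.
- by rewrite ler_pdivrMr // ler_peMr // ltW.
- rewrite mulrA ler_pdivrMr // -(@ler_pXn2r _ 2) ?nnegrE ?mulr_ge0 ?(ltW q0) ?(ltW m0) ?(ltW r0) //.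
  rewrite exprMn mu2 exprMn r2.
  have : 4 / omega * (omega * m `^ (2 * sigma)) <= omega * m ^+ 3.
    rewrite m3 [leRHS]mulrCA [leLHS]mulrC [leRHS]mulrCA mulrA.
    by rewrite ler_pM2l // mulr_gt0.
  have -> : 4 / omega * (omega * m `^ (2 * sigma)) = 4 * m `^ (2 * sigma).
    by field; rewrite gt_eqF.
  by have := sqr_ge0 m; lra.
- rewrite expr_div_n mu2 ler_pdivrMr ?exprn_gt0 //.
  have -> : m * (m / rho) * rho ^+ 2 = m ^+ 2 * rho by field.
  rewrite -(@ler_pXn2r _ 2) ?nnegrE ?mulr_ge0 ?(ltW m0) ?(ltW z0) ?(ltW r0) //.
  rewrite exprMn r2 -exprM.
  have : 1 / omega * (omega * m `^ (2 * sigma) ^+ 2) <= omega * m ^+ 5.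
    rewrite m5 [leRHS]mulrCA [leLHS]mulrC [leRHS]mulrCA mulrA.
    by rewrite ler_pM2l // mulr_gt0 ?exprn_gt0.
  have -> : 1 / omega * (omega * m `^ (2 * sigma) ^+ 2) = m `^ (2 * sigma) ^+ 2.
    by field; rewrite gt_eqF.
  by have := sqr_ge0 (m ^+ 2); lra.
- have -> : (4 * (m / rho)) `^ (4 * (sigma - 1)) = (16 * (m ^+ 2 / rho ^+ 2)) `^ (2 * sigma - 2).
    have -> : 4 * (sigma - 1) = 2 * (2 * sigma - 2) by ring.
    have d0 : 0 <= 4 * (m / rho) by rewrite mulr_ge0 // divr_ge0 // ltW.
    rewrite powRrM powR_mulrn //.
    by congr (_ `^ _); field.
  have le1 : 16 * (m ^+ 2 / rho ^+ 2) <= 16 / omega * m.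
    rewrite mulrA ler_pdivrMr ?exprn_gt0 // r2.
    have -> : 16 / omega * m * (1 + omega * m) = 16 / omega * m + 16 * m ^+ 2.
      by field; rewrite gt_eqF.
    by rewrite lerDr mulr_ge0 ?divr_ge0 ?(ltW m0) ?(ltW o0).
  apply: (@le_trans _ _ ((16 / omega * m) `^ (2 * sigma - 2))).
    have m20 : 0 <= m ^+ 2 / rho ^+ 2 by rewrite divr_ge0 ?sqr_ge0.
    have x0 : 0 <= 16 * (m ^+ 2 / rho ^+ 2) by exact: mulr_ge0.
    have y0 : 0 <= 16 / omega * m by exact: le_trans le1.
    by rewrite ge0_ler_powR ?nnegrE //; lra.
  rewrite powRM ?divr_ge0 ?(ltW m0) ?(ltW o0) // /C1 -mulrA ler_wpM2l ?powR_ge0 //.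
  rewrite expr_div_n mu2 r2.
  have -> : m `^ (2 * sigma) = m `^ (2 * sigma - 2) * m ^+ 2.
    by rewrite -powR_mulrn ?(ltW m0) // -addE subrK.
  have -> : m `^ (2 * sigma - 2) * m ^+ 2 / (1 + omega * m) / m = m `^ (2 * sigma - 2) * (m / (1 + omega * m)).
    by field; rewrite mn gt_eqF //; lra.
  rewrite mulrCA ler_peMr ?powR_ge0 // mulrA ler_pdivlMr; last by lra.
  by rewrite mul1r; lra.
Qed.

End ModeBounds.

(** * Modal coordinates of the phase space *)

Section PhaseSpace.
Variables (R : realType) (H : completeNormedModType R[i]).
Variable dot : {dot H for (@Num.conj R[i])}.
Hypothesis norm_dot : forall u : H, `|u| ^+ 2 = dot u u.
Variables (domA : set H) (A : H -> H).
Hypothesis A_linear : linear_on domA A.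
Hypothesis A_self_adjoint : self_adjoint dot domA A.
Hypothesis A_positive : positive_definite dot domA A.
Local Open Scope complex_scope.
Implicit Types u v w x : H.
Notation C3 := (R[i] * R[i] * R[i])%type.

Variables (e : nat -> H) (mu : nat -> R).
Hypothesis eb : eigenbasis dot domA A e mu.
Notation coef := (coef dot e).
Variable delta : R.
Hypothesis delta0 : 0 < delta.
Hypothesis mu_ge : forall n, delta <= mu n.
Variables omega sigma : R.
Hypothesis omega0 : 0 <= omega.
Hypothesis sigma2 : sigma <= 2.

Notation pow := (fpow dot domA A).
Notation dom := (fpow_dom dot domA A).
Let m0 := mu_gt0 delta0 mu_ge.
Let domP s u : dom s u <-> l2 (fun n => (mu n `^ s)%:C * coef u n).
Proof. exact: fpow_domP. Qed.
Let coefP s u n : dom s u -> coef (pow s u) n = (mu n `^ s)%:C * coef u n.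
Proof. exact: coef_fpow. Qed.

Definition rho n : R := Num.sqrt (1 + omega * mu n).

Definition phase_coef n (U : H * H * H) : C3 :=
  ((mu n)%:C * coef U.1.1 n, (rho n)%:C * coef U.1.2 n, coef U.2 n).

Notation pn n := (mu n / rho n).
Notation qn n := (mu n `^ sigma / rho n).
Notation modal n := (mode (pn n) (qn n) (mu n)).
Notation X := (phase dot domA A omega).
Notation N := (phase_norm dot domA A omega).
Notation D := (sys_dom dot domA A omega sigma).
Notation T := (sys_op dot domA A omega sigma).

Let rho_sq n : rho n ^+ 2 = 1 + omega * mu n.
Proof. by rewrite sqr_sqrtr // addr_ge0 // mulr_ge0 // ltW. Qed.
Let rho_gt0 n : 0 < rho n.
Proof. by rewrite sqrtr_gt0 ltr_pwDl // mulr_ge0 // ltW. Qed.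
Let rho_ge1 n : 1 <= rho n.
Proof. by rewrite -[leLHS]sqrtr1 ler_wsqrtr // lerDl mulr_ge0 // ltW. Qed.

Lemma l2_weight (w1 w2 : nat -> R) (c : nat -> R[i]) (C : R) :
  (forall n, 0 <= w1 n) -> (forall n, 0 <= w2 n) -> (forall n, w1 n <= C * w2 n) ->
  l2 (fun n => (w2 n)%:C * c n) -> l2 (fun n => (w1 n)%:C * c n).
Proof.
move=> w10 w20 h; apply: (l2_le (C := C)) => n.
by rewrite !cmodM !cmodR !ger0_norm // mulrA ler_wpM2r ?cmod_ge0.
Qed.

Let le_of_sq (x y C : R) : 0 <= x -> 0 <= y -> 0 <= C -> x ^+ 2 <= C * y ^+ 2 ->
  x <= Num.sqrt C * y.
Proof.
move=> x0 y0 C0 h; rewrite -(@ler_pXn2r _ 2) ?nnegrE ?mulr_ge0 ?sqrtr_ge0 //.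
by rewrite exprMn sqr_sqrtr.
Qed.

Let half_sq n : (mu n `^ (1 / 2)) ^+ 2 = mu n.
Proof. by rewrite -powR_mulrn ?powR_ge0 // -powRrM mulfVK // powRr1 // ltW. Qed.

(** With mu >= delta, rho^2 = 1 + omega mu is at most (1/delta + omega) mu; together with [half_le]
    this is the equivalence of the two norms of H^1. *)
Let rho_le n : rho n <= Num.sqrt (delta^-1 + omega) * mu n `^ (1 / 2).
Proof.
apply: le_of_sq; rewrite ?powR_ge0 ?(ltW (rho_gt0 n)) ?addr_ge0 ?invr_ge0 ?(ltW delta0) //.
rewrite rho_sq half_sq mulrDl lerD2r -(mulVf (lt0r_neq0 delta0)).
by rewrite ler_pM2l ?invr_gt0.
Qed.

Let half_le n : 0 < omega -> mu n `^ (1 / 2) <= Num.sqrt omega^-1 * rho n.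
Proof.
move=> o0; apply: le_of_sq; rewrite ?powR_ge0 ?invr_ge0 ?(ltW (rho_gt0 n)) //.
by rewrite rho_sq half_sq mulrDr mulr1 mulKf ?gt_eqF // lerDr invr_ge0.
Qed.

Let hs1 v : 0 < omega -> hs dot domA A 1 v <-> l2 (fun n => (rho n)%:C * coef v n).
Proof.
move=> o0; rewrite /hs; split=> [/domP|] h; [|apply/domP]; apply: l2_weight h.
- by move=> n; exact: ltW.
- by move=> n; exact: powR_ge0.
- exact: rho_le.
- by move=> n; exact: powR_ge0.
- by move=> n; exact: ltW.
- by move=> n; exact: half_le.
Qed.

Let rho_omega0 n : omega = 0 -> rho n = 1.
Proof. by move=> o; rewrite /rho o mul0r addr0 sqrtr1. Qed.

Let hs2 u : hs dot domA A 2 u <-> l2 (fun n => (mu n)%:C * coef u n).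
Proof.
rewrite /hs divff //; split=> [/domP|] h; [|apply/domP]; apply: (l2_weight (C := 1)) h;
  by move=> n; rewrite ?mul1r ?powRr1 // ltW.
Qed.

(** One description for both definitions of the space: for omega = 0 the weight rho is 1 and the
    condition on the velocity holds for every vector. *)
Let phaseP (U : H * H * H) : X U <->
  l2 (fun n => (mu n)%:C * coef U.1.1 n) /\ l2 (fun n => (rho n)%:C * coef U.1.2 n).
Proof.
rewrite /phase /=; split=> -[/hs2 h1 h2]; split=> //.
  move: h2; have [w0 _ | w0 h] := eqVneq omega 0; last by apply/hs1 => //; rewrite lt_neqAle eq_sym w0.
  apply: (l2_weight (w2 := fun=> 1) (C := 1)) => [n|n|n|].
  - exact: ltW.
  - exact: ler01.
  - by rewrite rho_omega0 // mulr1.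
  - apply: (l2_le (C := 1)) (coef_l2 norm_dot eb U.1.2) => n.
    by rewrite !mul1r.
have [// | w0] := eqVneq omega 0; apply/hs1 => //; by rewrite lt_neqAle eq_sym w0.
Qed.

Lemma phase0 : X 0.
Proof.
apply/phaseP; split; exists 0 => k; rewrite /sqsum big1 // => i _ /=;
  by rewrite /coef dot0l mulr0 cmod0 expr0n.
Qed.

Let l2_lin (a : R[i]) (w : nat -> R) u v : l2 (fun n => (w n)%:C * coef u n) ->
  l2 (fun n => (w n)%:C * coef v n) -> l2 (fun n => (w n)%:C * coef (a *: u + v) n).
Proof.
move=> h1 h2; apply: (l2_le (C := 1) (d := fun n => a * ((w n)%:C * coef u n) + (w n)%:C * coef v n)).
  by move=> n; rewrite coef_lin mulrDr mulrCA mul1r.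
apply: l2D => //; apply: (l2_le (C := cmod a)) h1 => n; by rewrite cmodM.
Qed.

Lemma phase_lin a (U V : H * H * H) : X U -> X V -> X (a *: U + V).
Proof.
by move=> /phaseP[u1 u2] /phaseP[v1 v2]; apply/phaseP; split; exact: l2_lin.
Qed.

Lemma phase_norm_ge0 U : 0 <= N U. Proof. exact: sqrtr_ge0. Qed.

Lemma phase_coef_lin n a U V :
  phase_coef n (a *: U + V) = a *: phase_coef n U + phase_coef n V.
Proof.
case: U V => [[u v] w] [[u' v'] w']; rewrite /phase_coef /= !coef_lin !mulrDr.
congr (_, _, _); congr (_ + _) => //; exact: mulrCA.
Qed.

Lemma phase_coef_surj (x : nat -> C3) : nsq_summable x ->
  exists2 U, X U & forall n, phase_coef n U = x n.
Proof.
move=> [M HM].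
have comp (g : C3 -> R[i]) : (forall y, cmod (g y) ^+ 2 <= nsq y) -> l2 (fun n => g (x n)).
  move=> hg; exists M => k; apply: le_trans (HM k); exact: ler_sum.
have sq3 (a b c : R) : a ^+ 2 <= a ^+ 2 + b ^+ 2 + c ^+ 2 /\
    b ^+ 2 <= a ^+ 2 + b ^+ 2 + c ^+ 2 /\ c ^+ 2 <= a ^+ 2 + b ^+ 2 + c ^+ 2.
  by have := sqr_ge0 a; have := sqr_ge0 b; have := sqr_ge0 c; lra.
have c1 := comp (fun y => y.1.1) (fun y => (sq3 _ _ _).1).
have c2 := comp (fun y => y.1.2) (fun y => (sq3 _ _ _).2.1).
have c3 := comp (fun y => y.2) (fun y => (sq3 _ _ _).2.2).
have inv (w : nat -> R) (c : nat -> R[i]) (d : R) : 0 < d -> (forall n, d <= w n) -> l2 c ->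
    exists u, forall n, (w n)%:C * coef u n = c n.
  move=> d0 dw lc; have w0 n : 0 < w n := lt_le_trans d0 (dw n).
  have [|u hu] := @riesz_fischer _ _ _ norm_dot _ _ _ _ eb (fun n => (w n)^-1%:C * c n).
    apply: (l2_le (C := d^-1)) lc => n; rewrite cmodM cmodR ler_wpM2r ?cmod_ge0 //.
    by rewrite ger0_norm ?invr_ge0 ?(ltW (w0 n)) // lef_pV2 ?posrE.
  by exists u => n; rewrite hu mulrA -rmorphM /= mulfV ?gt_eqF // mul1r.
have [u hu] := inv mu _ _ delta0 mu_ge c1.
have [v hv] := inv rho _ _ ltr01 rho_ge1 c2.
have [w hw] := riesz_fischer norm_dot eb c3.
have hE n : phase_coef n (u, v, w) = x n.
  by rewrite /phase_coef /= hu hv hw; case: (x n) => [[]].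
exists (u, v, w) => //; apply/phaseP; split => /=.
  by apply: (l2_le (C := 1)) c1 => n; rewrite hu mul1r.
by apply: (l2_le (C := 1)) c2 => n; rewrite hv mul1r.
Qed.

Lemma phase_coef_inj U V : (forall n, phase_coef n U = phase_coef n V) -> U = V.
Proof.
case: U V => [[u v] w] [[u' v'] w'] h.
have inj (a : R) : 0 < a -> injective (fun z : R[i] => a%:C * z).
  by move=> a0; apply: mulfI; rewrite eq_complex /= eqxx andbT gt_eqF.
have hn n : [/\ coef u n = coef u' n, coef v n = coef v' n & coef w n = coef w' n].
  by have [/(inj _ (m0 n)) h1 /(inj _ (rho_gt0 n)) h2 h3] := h n.
congr (_, _, _); apply: (coef_inj norm_dot eb) => n; by have [] := hn n.
Qed.

Lemma phase_norm_lim U : X U -> nsq_sum (phase_coef^~ U) @ \oo --> N U ^+ 2.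
Proof.
case: U => [[u v] w] XU; have [l1 l2'] := (phaseP _).1 XU.
have par s x : dom s x ->
    (fun k => \sum_(i < k) cmod ((mu i `^ s)%:C * coef x i) ^+ 2) @ \oo --> hnorm (pow s x) ^+ 2.
  move=> dx; have := @parseval _ _ _ norm_dot _ _ _ _ eb (pow s x).
  apply: cvg_trans; apply: near_eq_cvg; near=> k.
  by apply: eq_bigr => i _; rewrite coefP.
rewrite /phase_norm sqr_sqrtr; last first.
  by rewrite !addr_ge0 ?sqr_ge0 // mulr_ge0 ?sqr_ge0.
have E : nsq_sum (phase_coef^~ (u, v, w)) = fun k =>
    \sum_(i < k) cmod ((mu i `^ (2 / 2))%:C * coef u i) ^+ 2 +
    (sqsum (coef v) k + omega * \sum_(i < k) cmod ((mu i `^ (1 / 2))%:C * coef v i) ^+ 2) +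
    sqsum (coef w) k.
  apply/funext => k; rewrite /nsq_sum /sqsum mulr_sumr -!big_split /=.
  apply: eq_bigr => i _; rewrite /nsq /= !cmodM !cmodR !exprMn !real_normK ?num_real //.
  rewrite divff // powRr1 ?(ltW (m0 i)) // half_sq rho_sq; ring.
rewrite E /=; apply: cvgD; last exact: (parseval norm_dot eb).
apply: cvgD; first by apply: par; exact: XU.1.
apply: cvgD; first exact: (parseval norm_dot eb).
have [w0 | w0] := eqVneq omega 0.
  by rewrite w0 mul0r; under eq_fun do rewrite mul0r; exact: cvg_cst.
apply: cvgMr; apply: par; have := XU.2; by rewrite /= (negPf w0).
Unshelve. all: by end_near. Qed.

Lemma dot_coef_cvg u v (d : R) : 0 < d -> exists k0, forall k, (k0 <= k)%N ->
  cmod (\sum_(i < k) coef u i * (coef v i)^* - dot u v) < d.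
Proof.
move=> /(dot_cvgr norm_dot u (@psum_cvg _ _ _ _ _ _ _ eb v))[k0 hk]; exists k0 => k /hk.
congr (cmod (_ - _) < _); rewrite dotC /psum dot_suml rmorph_sum; apply: eq_bigr => i _ /=.
by rewrite dotZl rmorphM /= -(dotC dot u); exact: mulrC.
Qed.

(** Polarised Parseval: an identity between coefficients implies the identity between inner
    products. It verifies the weak equation that defines the inverse of I + omega A. *)
Lemma dot_lin_eq (k : R[i]) u1 v1 u2 v2 u3 v3 :
  (forall n, coef u1 n * (coef v1 n)^* + k * (coef u2 n * (coef v2 n)^*) =
             coef u3 n * (coef v3 n)^*) ->
  dot u1 v1 + k * dot u2 v2 = dot u3 v3.
Proof.
move=> h; apply/eqP; rewrite -subr_eq0; apply/eqP/cmod_small_eq0 => d d0.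
have c0 := cmod_ge0 k; have c1 : 0 < 2 + cmod k by lra.
have d1 : 0 < d / (2 + cmod k) by rewrite divr_gt0.
have [k1 h1] := dot_coef_cvg u1 v1 d1; have [k2 h2] := dot_coef_cvg u2 v2 d1.
have [k3 h3] := dot_coef_cvg u3 v3 d1.
pose K := maxn k1 (maxn k2 k3).
have {}h1 := h1 K (leq_maxl _ _).
have {}h2 := h2 K ltac:(by rewrite /K !leq_max leqnn orbT).
have {}h3 := h3 K ltac:(by rewrite /K !leq_max leqnn !orbT).
have {}h : \sum_(i < K) coef u1 i * (coef v1 i)^* + k * \sum_(i < K) coef u2 i * (coef v2 i)^* =
    \sum_(i < K) coef u3 i * (coef v3 i)^*.
  by rewrite mulr_sumr -big_split; apply: eq_bigr => i _; rewrite /= h.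
move: h h1 h2 h3; move: (\sum_(i < K) _) (\sum_(i < K) _) (\sum_(i < K) _) => c b a abc h1 h2 h3.
have -> : dot u1 v1 + k * dot u2 v2 - dot u3 v3 =
   - (a - dot u1 v1) + - (k * (b - dot u2 v2)) + (c - dot u3 v3) by rewrite -abc; ring.
apply: le_trans (cmodD _ _) _; apply: le_trans (lerD (cmodD _ _) (lexx _)) _.
rewrite !cmodN cmodM.
have h4 := ler_wpM2l c0 (ltW h2).
have -> : d = d / (2 + cmod k) + cmod k * (d / (2 + cmod k)) + d / (2 + cmod k).
  by field; rewrite gt_eqF.
by apply: lerD; [apply: lerD|]; rewrite // ltW.
Qed.

Let e_coef n k : coef (e n) k = (n == k)%:R.
Proof. by have [h _ _] := eb; exact: h. Qed.

Let pow_e s n : dom s (e n) /\ pow s (e n) = (mu n `^ s)%:C *: e n.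
Proof.
have g : fpow_graph dot domA A s (e n) ((mu n `^ s)%:C *: e n).
  apply/(fpow_graphP norm_dot A_self_adjoint eb) => k; rewrite coefZ e_coef.
  by have [-> // | _] := eqVneq n k; rewrite !mulr0.
have de : dom s (e n) by exists ((mu n `^ s)%:C *: e n).
split=> //; apply: (coef_inj norm_dot eb) => k; rewrite coefP // coefZ e_coef.
by have [-> // | _] := eqVneq n k; rewrite !mulr0.
Qed.

(** The vector with coefficients (mu / rho)^2 <w, e_n> solves the weak equation, so the choice in
    [IomegaA_inv] is not vacuous; testing any solution against the e_n determines its
    coefficients. *)
Lemma IomegaA_inv_coef w : 0 < omega -> hs dot domA A 3 w ->
  hs dot domA A 1 (IomegaA_inv dot domA A omega (fpow_dual dot domA A 3 2 w)) /\
  forall n, (rho n)%:C * coef (IomegaA_inv dot domA A omega (fpow_dual dot domA A 3 2 w)) n =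
    (mu n ^+ 2 / rho n)%:C * coef w n.
Proof.
move=> o0 hw; set f := fpow_dual _ _ _ _ _ w.
have rn n : rho n != 0 by rewrite gt_eqF.
have pE n : mu n `^ (3 / 2) * mu n `^ (2 - 3 / 2) = mu n ^+ 2.
  rewrite -powRD; last by apply/implyP => _; rewrite gt_eqF.
  by rewrite addrC subrK powR_mulrn // ltW.
have pH n : mu n `^ (3 / 2) = mu n * mu n `^ (1 / 2).
  rewrite -{2}(powRr1 (ltW (m0 n))) -powRD; last by apply/implyP => _; rewrite gt_eqF.
  by congr (_ `^ _); field.
have dz z : hs dot domA A 1 z -> dom (2 - 3 / 2) z.
  by rewrite /hs; have -> : 1 / 2 = 2 - 3 / 2 :> R by field.
have lw : l2 (fun n => (mu n ^+ 2 / rho n ^+ 2)%:C * coef w n).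
  move/domP: hw; apply: (l2_weight (C := Num.sqrt omega^-1)).
  - by move=> n; rewrite divr_ge0 ?sqr_ge0.
  - by move=> n; exact: powR_ge0.
  - move=> n; rewrite pH.
    have -> : mu n ^+ 2 / rho n ^+ 2 = mu n * (mu n / rho n ^+ 2) by field.
    rewrite [leRHS]mulrCA ler_pM2l // -{1}half_sq ler_pdivrMr ?exprn_gt0 //.
    have h := half_le n o0; have := powR_ge0 (mu n) (1 / 2); have r1 := rho_ge1 n.
    have s0 := sqrtr_ge0 omega^-1; move: (mu n `^ _) (Num.sqrt _) h s0 => a b h s0 a0.
    have := ler_wpM2l a0 h; have r2 : rho n <= rho n ^+ 2 by rewrite expr2 ler_peMl // ltW.
    have := ler_wpM2l (mulr_ge0 a0 s0) r2; lra.
have [y hy] := riesz_fischer norm_dot eb lw.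
have Hy : hs dot domA A 1 y.
  apply/hs1 => //; move/domP: hw; apply: (l2_le (C := Num.sqrt omega^-1)) => n.
  rewrite hy mulrA -rmorphM /= !cmodM !cmodR mulrA ler_wpM2r ?cmod_ge0 //.
  rewrite !ger0_norm ?powR_ge0 ?mulr_ge0 ?invr_ge0 ?sqr_ge0 ?(ltW (rho_gt0 n)) ?(ltW (m0 n)) //.
  have -> : rho n * (mu n ^+ 2 / rho n ^+ 2) = mu n * (mu n / rho n) by field.
  rewrite pH [leRHS]mulrCA ler_pM2l // ler_pdivrMr // -{1}half_sq.
  have h := half_le n o0; have a0 := powR_ge0 (mu n) (1 / 2).
  by have := ler_wpM2l a0 h; move: (mu n `^ _) (Num.sqrt _) => a b; lra.
have Ey z : hs dot domA A 1 z -> IomegaA dot domA A omega y z = f z.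
  move=> hz; apply: dot_lin_eq => n.
  rewrite (@coefP (1 / 2) y n Hy) (@coefP (1 / 2) z n hz) (@coefP (3 / 2) w n hw).
  rewrite (@coefP (2 - 3 / 2) z n (dz z hz)).
  rewrite hy !(rmorphM Num.conj) /= !conjCR.
  have k : mu n ^+ 2 / rho n ^+ 2 * (1 + omega * (mu n `^ (1 / 2)) ^+ 2) = mu n ^+ 2.
    by rewrite half_sq -rho_sq divfK // sqrf_eq0.
  rewrite [RHS]mulrACA -rmorphM /= pE -{3}k.
  move: (mu n ^+ 2 / rho n ^+ 2) (mu n `^ _) => a b.
  by rewrite !(rmorphM, rmorphD, rmorphXn, rmorph1) /=; ring.
have uniq y' : hs dot domA A 1 y' -> (forall z, hs dot domA A 1 z -> IomegaA dot domA A omega y' z = f z) ->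
    forall n, (rho n)%:C * coef y' n = (mu n ^+ 2 / rho n)%:C * coef w n.
  move=> hy' Ey' n; have [de pe] := pow_e (1 / 2) n; have [de2 pe2] := pow_e (2 - 3 / 2) n.
  have := Ey' (e n) de; rewrite /IomegaA /f /fpow_dual pe pe2 !(dotZr dot _ _ (e n)) !conjCR.
  rewrite -!/(coef _ _) (@coefP (1 / 2) y' n hy') (@coefP (3 / 2) w n hw) => E.
  have E2 : (rho n ^+ 2)%:C * coef y' n = (mu n ^+ 2)%:C * coef w n.
    rewrite -pE (mulrC (mu n `^ (3 / 2))) [X in _ = X * _]rmorphM /= -[RHS]mulrA -E rho_sq -{1}(half_sq n); move: (mu n `^ _) => b.
    by rewrite !(rmorphM, rmorphD, rmorphXn, rmorph1) /=; ring.
  have r1 : rho n = (rho n)^-1 * rho n ^+ 2 by field.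
  by rewrite [X in X%:C * _ = _]r1 rmorphM /= -mulrA E2 mulrA -rmorphM /= [_^-1 * _]mulrC.
rewrite /IomegaA_inv; case: (xgetP 0) => [y' _ [hy' Ey'] | /(_ y)[]]; last by split.
by split=> //; exact: uniq.
Qed.


Let tpos n : 0 <= mu n ^+ 2 / rho n.
Proof. by rewrite divr_ge0 ?sqr_ge0 ?(ltW (rho_gt0 n)). Qed.

(** The weight mu^2 / rho is mu^2 for omega = 0 and comparable to mu^(3/2) for omega > 0, which
    accounts for the two regularity indices in the domain. *)
Let hs34 w : hs dot domA A (if omega == 0 then 4 else 3) w <->
  l2 (fun n => (mu n ^+ 2 / rho n)%:C * coef w n).
Proof.
have [w0 | w0] := eqVneq omega 0.
  rewrite /hs; have -> : 4 / 2 = 2 :> R by field.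
  have E : (fun n => (mu n `^ 2)%:C * coef w n) = fun n => (mu n ^+ 2 / rho n)%:C * coef w n.
    by apply/funext => n; rewrite rho_omega0 // divr1 powR_mulrn // ltW.
  by rewrite -E; exact: domP.
have {}w0 : 0 < omega by rewrite lt_neqAle eq_sym w0.
have hm n : mu n ^+ 2 = mu n `^ (3 / 2) * mu n `^ (1 / 2).
  rewrite -powRD; last by apply/implyP => _; rewrite gt_eqF.
  by have -> : 3 / 2 + 1 / 2 = 2 :> R by [field]; rewrite powR_mulrn // ltW.
have hp n : 0 < mu n `^ (1 / 2) by rewrite powR_gt0.
rewrite /hs; split=> [/domP|] h; [|apply/domP]; apply: l2_weight h.
- by [].
- by move=> n; exact: powR_ge0.
- move=> n; rewrite hm ler_pdivrMr //; rewrite -[leRHS]mulrA [leRHS]mulrCA.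
  by rewrite ler_pM2l ?powR_gt0 //; exact: half_le.
- by move=> n; exact: powR_ge0.
- by [].
- move=> n; rewrite mulrA ler_pdivlMr // hm [leRHS]mulrCA.
  by rewrite ler_pM2l ?powR_gt0 //; exact: rho_le.
Qed.

Let triple_summable (x y z : nat -> R[i]) :
  nsq_summable (fun n => (x n, y n, z n)) <-> [/\ l2 x, l2 y & l2 z].
Proof.
split=> [[M h]|[[Mx hx] [My hy] [Mz hz]]]; last first.
  exists (Mx + My + Mz) => k; rewrite /nsq_sum !big_split /=.
  by apply: lerD; [apply: lerD; [exact: hx|exact: hy]|exact: hz].
have sq (g : nat -> R[i]) : (forall n, cmod (g n) ^+ 2 <= nsq (x n, y n, z n)) -> l2 g.
  by move=> hg; exists M => k; apply: le_trans (h k); exact: ler_sum.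
by split; apply: sq => n; rewrite /nsq /=; have := sqr_ge0 (cmod (x n));
  have := sqr_ge0 (cmod (y n)); have := sqr_ge0 (cmod (z n)); lra.
Qed.

(** Coordinatewise the force -A^2 u + A^sigma theta may be read with or without the common factor
    A^2; sigma <= 2 makes the inner power bounded, so the factored form makes sense for every
    theta. *)
Let coef_force u w n : (qn n)%:C * coef w n - (pn n)%:C * ((mu n)%:C * coef u n) =
  (mu n ^+ 2 / rho n)%:C * coef (- u + pow (sigma - 2) w) n.
Proof.
rewrite coefD coefN coefP; last by apply: (fpow_dom_np norm_dot A_self_adjoint eb delta0 mu_ge); have := sigma2; lra.
have -> : mu n `^ sigma = mu n ^+ 2 * mu n `^ (sigma - 2).
  rewrite -powR_mulrn ?(ltW (m0 n)) // -powRD; last by apply/implyP => _; rewrite gt_eqF.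
  by rewrite addrC subrK.
by rewrite !(rmorphM, rmorphXn) /=; ring.
Qed.

Let coef_heat v w n : dom 1 v -> - ((qn n)%:C * ((rho n)%:C * coef v n)) - (mu n)%:C * coef w n =
  (mu n)%:C * coef (- w - pow (sigma - 1) v) n.
Proof.
move=> dv; rewrite coefD !coefN coefP; last first.
  by apply: (fpow_dom_le norm_dot A_self_adjoint eb delta0 mu_ge) dv; have := sigma2; lra.
have -> : mu n `^ sigma = mu n * mu n `^ (sigma - 1).
  rewrite -{2}(powRr1 (ltW (m0 n))) -powRD; last by apply/implyP => _; rewrite gt_eqF.
  by rewrite addrC subrK.
rewrite mulrA -rmorphM /= divfK ?gt_eqF // !rmorphM /=; ring.
Qed.

Let coef_vel v n : (pn n)%:C * ((rho n)%:C * coef v n) = (mu n)%:C * coef v n.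
Proof. by rewrite mulrA -rmorphM /= divfK ?gt_eqF. Qed.

Let hs2_dom1 v : hs dot domA A 2 v -> dom 1 v.
Proof. by rewrite /hs divff. Qed.

(** Each regularity condition of the domain is the square summability of one row of the modal
    image. *)
Lemma sys_domP U : D U <-> X U /\ nsq_summable (fun n => modal n (phase_coef n U)).
Proof.
case: U => [[u v] w]; rewrite /sys_dom /phase_coef /mode /=.
split=> [[XU hv hw hu]|[XU /triple_summable[hv hu hw]]].
  split=> //; apply/triple_summable; split.
  - by move/hs2: hv; apply: (l2_le (C := 1)) => n; rewrite coef_vel mul1r.
  - by move/hs34: hu; apply: (l2_le (C := 1)) => n; rewrite coef_force mul1r.
  - move/hs2: hw; apply: (l2_le (C := 1)) => n; rewrite coef_heat ?mul1r //.
    exact: hs2_dom1.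
(* The regularity of v comes before the other conditions: the coefficients of A^(sigma - 1) v in the
   heat row are meaningful only then. *)
have hv' : hs dot domA A 2 v.
  by apply/hs2; apply: (l2_le (C := 1)) hv => n; rewrite coef_vel mul1r.
split=> //.
- apply/hs2; apply: (l2_le (C := 1)) hw => n; rewrite coef_heat ?mul1r //.
  exact: hs2_dom1.
- by apply/hs34; apply: (l2_le (C := 1)) hu => n; rewrite coef_force mul1r.
Qed.

Lemma sys_op_coef U : D U ->
  X (T U) /\ forall n, phase_coef n (T U) = modal n (phase_coef n U).
Proof.
case: U => [[u v] w] DU; have [XU hv hw hu] := DU.
set y := - u + pow (sigma - 2) w in hu.
have dA : domA (- w - pow (sigma - 1) v).
  by apply/(domA_fpow norm_dot A_linear A_self_adjoint A_positive eb delta0 mu_ge); exact: hs2_dom1.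
pose z := if omega == 0 then pow 2 y else IomegaA_inv dot domA A omega (fpow_dual dot domA A 3 2 y).
have hz n : (rho n)%:C * coef z n = (mu n ^+ 2 / rho n)%:C * coef y n.
  move: hu; rewrite /z; have [w0 | w0] := eqVneq omega 0 => hu.
    rewrite rho_omega0 // mul1r divr1 coefP ?powR_mulrn ?(ltW (m0 n)) //.
    by move: hu; rewrite /hs; have -> : 4 / 2 = 2 :> R by [field].
  by apply: (IomegaA_inv_coef _ hu).2; rewrite lt_neqAle eq_sym w0.
split.
  apply/phaseP; split; first exact/hs2.
  by apply: (l2_le (C := 1)) ((hs34 y).1 hu) => n; rewrite mul1r -hz; exact: lexx.
move=> n; rewrite /phase_coef /mode /= coef_vel coef_force (coef_heat _ _ (hs2_dom1 hv)).
by congr (_, _, _); [exact: hz|exact: (coef_A A_self_adjoint eb n dA)].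
Qed.

End PhaseSpace.

(** * Assembly of the resolvent estimate and the Gevrey regularity *)

Lemma sys_regularity (R : realType) (H : completeNormedModType R[i])
    (dot : {dot H for (@Num.conj R[i])})
    (norm_dot : forall u : H, `|u| ^+ 2 = dot u u)
    (domA : set H) (A : H -> H)
    (A_linear : linear_on domA A)
    (A_self_adjoint : self_adjoint dot domA A)
    (A_positive : positive_definite dot domA A)
    (A_compact_resolvent : compact_resolvent domA A)
    (A_unbounded : unbounded domA A)
    (omega sigma a b M : R) :
  0 <= omega -> sigma <= 2 -> 0 <= b ->
  (forall m, 0 < m -> plate_mode_bounds omega sigma a b M m) ->
  (sys_resolvent_limsup dot domA A omega sigma a < +oo)%E /\
  forall S, sys_semigroup dot domA A omega sigma S ->
  forall s, b < s -> sys_gevrey dot domA A omega s S.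
Proof.
move=> omega0 sigma2 b0 bounds.
have [e [mu [eb [delta delta0 mu_ge]]]] := eigenbasis_exists norm_dot A_linear
  A_self_adjoint A_positive A_compact_resolvent A_unbounded.
have mu0 n : 0 < mu n := lt_le_trans delta0 (mu_ge n).
have M0 : 0 <= M by have [] := bounds 1 ltr01.
have X0 := phase0 norm_dot A_self_adjoint eb delta0 mu_ge omega0.
have X_lin := phase_lin norm_dot A_self_adjoint eb delta0 mu_ge omega0.
have N_ge0 := phase_norm_ge0 dot domA A omega.
have xc_lin n a0 u v (_ : phase dot domA A omega u) (_ : phase dot domA A omega v) :=
  phase_coef_lin dot e mu omega n a0 u v.
have N_lim := phase_norm_lim norm_dot A_self_adjoint eb delta0 mu_ge omega0.
have xc_surj := phase_coef_surj norm_dot A_self_adjoint eb delta0 mu_ge omega0.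
have xc_inj u v (_ : phase dot domA A omega u) (_ : phase dot domA A omega v) :=
  @phase_coef_inj _ _ _ norm_dot _ _ _ _ eb _ delta0 mu_ge _ omega0 u v.
have D_char := sys_domP norm_dot A_self_adjoint eb delta0 mu_ge omega0 sigma2.
have T_char := sys_op_coef norm_dot A_linear A_self_adjoint A_positive eb delta0 mu_ge
  omega0 sigma2.
split.
  apply: (modal_resolvent_limsup X0 X_lin N_ge0 xc_lin N_lim xc_surj xc_inj D_char T_char
    M0 M0 mu0) => n l x; by have [_ h _] := bounds _ (mu0 n); exact: h.
move=> S [S1 S2 S3] s bs.
have N_scale := modal_N_scale X0 X_lin N_ge0 xc_lin N_lim.
have N_add := modal_N_add X_lin N_ge0 xc_lin N_lim.
(* The smoothing constant must be strictly positive, while the bounds only provide [M] >= 0. *)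
have M1 : 0 < M + 1 by exact: ltr_wpDl.
apply: (gevrey_of_smoothing X0 X_lin N_ge0 N_scale N_add S1 S2 S3 M1 b0 _ bs).
apply: (modal_smoothing X0 X_lin N_ge0 xc_lin N_lim xc_surj D_char T_char S1 S2 S3 (ltW M1)).
move=> n; have [_ _ h] := bounds _ (mu0 n).
by apply: ode_estimate_le h => //; rewrite lerDl.
Qed.

Unset Implicit Arguments.

(* MathComp / MathComp-Analysis *)
Theorem theorem21 (R : realType) (H : completeNormedModType R[i])
    (dot : {dot H for (@Num.conj R[i])})
    (norm_dot : forall u : H, `|u| ^+ 2 = dot u u)
    (domA : set H) (A : H -> H)
    (A_linear : linear_on domA A)
    (A_self_adjoint : self_adjoint dot domA A)
    (A_positive : positive_definite dot domA A)
    (A_compact_resolvent : compact_resolvent domA A)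
    (A_unbounded : unbounded domA A)
    (omega sigma : R) :
  [/\ omega = 0 -> 1 / 2 < sigma < 1 ->
        (sys_resolvent_limsup dot domA A omega sigma (2 * sigma - 1)
           < +oo)%E /\
        forall S, sys_semigroup dot domA A omega sigma S ->
        forall s, 1 / (2 * sigma - 1) < s ->
          sys_gevrey dot domA A omega s S,
      omega = 0 -> 1 < sigma < 3 / 2 ->
        (sys_resolvent_limsup dot domA A omega sigma (1 / sigma)
           < +oo)%E /\
        forall S, sys_semigroup dot domA A omega sigma S ->
        forall s, sigma < s ->
          sys_gevrey dot domA A omega s S &
      0 < omega -> 1 < sigma < 5 / 4 ->
        (sys_resolvent_limsup dot domA A omega sigma (4 * (sigma - 1))
           < +oo)%E /\
        forall S, sys_semigroup dot domA A omega sigma S ->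
        forall s, 1 / (4 * (sigma - 1)) < s ->
          sys_gevrey dot domA A omega s S].
Proof.
split.
- move=> -> s12; have [M bounds] := kirchhoff_bounds_low s12.
  move/andP: s12 => [s1 s2]; apply: sys_regularity bounds => //; first by lra.
  by rewrite divr_ge0 //; lra.
- move=> -> /andP[s1 s2]; have [M bounds] := kirchhoff_bounds_high s1.
  by apply: sys_regularity bounds => //; lra.
- move=> o0 s12; have [M bounds] := inertial_bounds o0 s12.
  move/andP: s12 => [s1 s2]; apply: sys_regularity bounds => //; [exact: ltW|lra|].
  by rewrite divr_ge0 //; lra.
Qed.
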